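(* Let $k,\beta\in\mathbb{N}=\{1,2,3,\dots\}$. Then, as $N\to\infty$ over the positive integers, $$\mathrm{MoM}_N(k,\beta)=\mathfrak{c}(k,\beta)\,N^{k^2\beta^2-k+1}+O\left(N^{k^2\beta^2-k}\right),$$ where the implicit constant depends only on $k$ and $\beta$, and where $\mathfrak{c}(k,\beta)=\mathrm{vol}\left(\mathcal{V}_{(k,\beta)}\right)$ is the $\left((k\beta)^2-(k-1)\right)$-dimensional Lebesgue measure of the convex region $\mathcal{V}_{(k,\beta)}\subset\mathbb{R}^{(k\beta)^2-(k-1)}$ defined in the context.
   Context: Moments of moments. For a unitary $N\times N$ matrix $U\in\mathbb{U}(N)$ and $\theta\in\mathbb{R}$ let $P_N(U,\theta)=\det(I-Ue^{-\mathrm{i}\theta})$, $\mathrm{i}=\sqrt{-1}$. Let $\mathbb{E}$ denote expectation with respect to normalized Haar measure on $\mathbb{U}(N)$, and $$\mathrm{MoM}_N(k,\beta)=\mathbb{E}\left[\left(\frac{1}{2\pi}\int_0^{2\pi}|P_N(U,\theta)|^{2\beta}\,d\theta\right)^k\right].$$ Monotone matrices. For $m\ge 1$, $\mathfrak{I}_m\subset\mathbb{R}^{m^2}$ is the set of real $m\times m$ matrices $(x_i^{(j)})_{i,j=1}^m$ (subscript = column, superscript = row) with $x_1^{(j)}\le x_2^{(j)}\le\cdots\le x_m^{(j)}$ for all $j\in\{1,\dots,m\}$ and $x_i^{(1)}\ge x_i^{(2)}\ge\cdots\ge x_i^{(m)}$ for all $i\in\{1,\dots,m\}$. The region $\mathcal{V}_{(k,\beta)}$.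 Let $$\mathcal{S}_{(k,\beta)}=\left\{(i,j):\ 1\le i,j\le k\beta,\ (i,j)\ne(1,2\beta l)\text{ and }(i,j)\ne(k\beta-2\beta l+1,k\beta)\text{ for all } l=1,\dots,\lfloor k/2\rfloor\right\},$$ a set with $(k\beta)^2-(k-1)$ elements (when $k$ is even and $l=k/2$ the two excluded pairs coincide). $\mathcal{V}_{(k,\beta)}$ is the set of all $(u_i^{(j)})_{(i,j)\in\mathcal{S}_{(k,\beta)}}\in\mathbb{R}^{(k\beta)^2-(k-1)}$ such that: (1) $0\le u_i^{(j)}\le 1$ for all $(i,j)\in\mathcal{S}_{(k,\beta)}$; (2) if for $l=1,\dots,\lfloor k/2\rfloor$ one defines the remaining entries by $$u_1^{(2\beta l)}=l\beta-u_2^{(2\beta l-1)}-\cdots-u_{2\beta l}^{(1)},\qquad u_{k\beta-2\beta l+1}^{(k\beta)}=l\beta-u_{k\beta-2\beta l+2}^{(k\beta-1)}-\cdots-u_{k\beta}^{(k\beta-2\beta l+1)},$$ then $0\le u_1^{(2\beta l)}\le1$ and $0\le u_{k\beta-2\beta l+1}^{(k\beta)}\le 1$ (for $k$ even and $l=k/2$ the two definitions coincide); (3) the resulting full matrix $(u_i^{(j)})_{i,j=1}^{k\beta}$ belongs to $\mathfrak{I}_{k\beta}$. *)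

(* Defs.v *)
From HB Require Import structures.
From mathcomp Require Import all_boot all_order all_algebra.
From mathcomp Require Import complex.
From mathcomp Require Import all_classical all_reals all_analysis.

Set Implicit Arguments.
Unset Strict Implicit.
Unset Printing Implicit Defensive.

Import Order.TTheory GRing.Theory Num.Theory.
Import numFieldNormedType.Exports.

Local Open Scope classical_set_scope.
Local Open Scope ring_scope.
Local Open Scope complex_scope.

Definition unitary_group (R : realType) (N : nat) : Type :=
  {U : 'M[R[i]]_N | U \is unitarymx}.

HB.instance Definition _ (R : realType) (N : nat) :=
  Choice.on (unitary_group R N).

Section UnitaryGroup.
Variables (R : realType) (N : nat).
Local Notation UN := (unitary_group R N).

Lemma one_unitary : (1%:M : 'M[R[i]]_N) \is unitarymx.
Proof. by apply/unitarymxP; rewrite trmx1 map_mx1 mulmx1. Qed.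

HB.instance Definition _ := isPointed.Build UN (exist _ 1%:M one_unitary).

Definition unitary_mul (U V : UN) : UN :=
  exist _ (val U *m val V) (mul_unitarymx (valP U) (valP V)).

Definition re_im (U : UN) : 'M[R]_N * 'M[R]_N :=
  (map_mx (@complex.Re R) (val U), map_mx (@complex.Im R) (val U)).

End UnitaryGroup.

(* The subspace topology, under M_N(C) = M_N(R) x M_N(R): R[i] itself carries
   no topology in the library. *)
HB.instance Definition _ (R : realType) (N : nat) :=
  Topological.copy (unitary_group R N) (initial_topology (@re_im R N)).

Notation borel_unitary R N :=
  (g_sigma_algebraType (@open (unitary_group R N))).

(* Left invariance; right invariance follows because U(N) is compact. *)
Definition is_haar (R : realType) (N : nat)
    (mu : probability (borel_unitary R N) R) : Prop :=
  forall (U : unitary_group R N) (A : set (borel_unitary R N)),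
    measurable A -> mu (unitary_mul U @^-1` A) = mu A.

Definition exp_neg_i (R : realType) (theta : R) : R[i] :=
  cos theta -i* sin theta.

Definition charpoly_circle (R : realType) (N : nat)
    (U : unitary_group R N) (theta : R) : R[i] :=
  \det (1%:M - exp_neg_i theta *: val U).

(* [normc] is the modulus with values in R, whereas `|z| lives in R[i]. *)
Definition MoM (R : realType) (N : nat)
    (mu : probability (borel_unitary R N) R) (k b : nat) : R :=
  fine 'E_mu[fun U =>
    ((2 * pi)^-1 *
     \int[lebesgue_measure]_(theta in `[0, 2 * pi]%classic)
       ComplexField.Normc.normc (charpoly_circle U theta) ^+ (2 * b)) ^+ k].

(* Lebesgue measure of R^I, I finite, as the infimum of the total volumes of
   the countable covers by boxes; the sets it is used for are closed. *)
Definition box (R : realType) (I : finType) (a b : I -> R) : set (I -> R) :=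
  [set x | forall i, a i <= x i <= b i].

Definition box_volume (R : realType) (I : finType) (a b : I -> R) : R :=
  \prod_i (b i - a i).

Definition lebesgue_vol (R : realType) (I : finType) (A : set (I -> R)) :
    \bar R :=
  ereal_inf [set x | exists a b : nat -> I -> R,
    [/\ forall n i, a n i <= b n i,
        A `<=` \bigcup_n box (a n) (b n)
      & x = (\sum_(0 <= n <oo) (box_volume (a n) (b n))%:E)%E]].

(* The entry x_i^(j) is [x j i]: superscript = row, subscript = column. *)
Definition monotone_matrix (R : realType) (m : nat) (x : 'M[R]_m) : Prop :=
  (forall j i1 i2 : 'I_m, (i1 <= i2)%N -> x j i1 <= x j i2) /\
  (forall i j1 j2 : 'I_m, (j1 <= j2)%N -> x j2 i <= x j1 i).

(* Pairs (i, j) keep their 1-based values, hence the ambient 'I_(k * b).+1. *)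
Definition free_index (k b i j : nat) : bool :=
  [&& (1 <= i <= k * b)%N, (1 <= j <= k * b)%N
    & all (fun l => ((i, j) != (1, 2 * b * l)%N) &&
                    ((i, j) != (k * b - 2 * b * l + 1, k * b)%N))
          (iota 1 (k %/ 2))].

Definition free_pos (k b : nat) : finType :=
  {p : 'I_(k * b).+1 * 'I_(k * b).+1 | free_index k b p.1 p.2}.

(* [x i j] is u_i^(j) for 1 <= i, j <= k * b; it is uniquely determined by u
   there, since the sums below only involve free positions.  Values outside
   this range are irrelevant. *)
Definition completes (R : realType) (k b : nat)
    (u : free_pos k b -> R) (x : nat -> nat -> R) : Prop :=
  (forall s : free_pos k b, x (val s).1 (val s).2 = u s) /\
  (forall l : nat, (1 <= l <= k %/ 2)%N ->
     x 1 (2 * b * l)%N = (l * b)%:R -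
       \sum_(2 <= t < (2 * b * l).+1) x t (2 * b * l + 1 - t)%N /\
     x (k * b - 2 * b * l + 1)%N (k * b)%N = (l * b)%:R -
       \sum_(2 <= t < (2 * b * l).+1)
          x (k * b - 2 * b * l + t)%N (k * b + 1 - t)%N).

Definition V_region (R : realType) (k b : nat) : set (free_pos k b -> R) :=
  [set u | (forall s, 0 <= u s <= 1) /\
    exists x : nat -> nat -> R,
      [/\ completes u x,
          forall l : nat, (1 <= l <= k %/ 2)%N ->
            0 <= x 1 (2 * b * l)%N <= 1 /\
            0 <= x (k * b - 2 * b * l + 1)%N (k * b)%N <= 1
        & monotone_matrix
            (\matrix_(j < k * b, i < k * b) x i.+1 j.+1)]].
Arguments V_region : clear implicits.

(* Main.v *)
From HB Require Import structures.
Require Import Defs.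
From mathcomp Require Import all_boot all_order all_algebra.
From mathcomp Require Import fingroup perm complex.
From mathcomp Require Import all_classical all_reals all_analysis.
From mathcomp Require Import measurable_realfun zify ring lra.
From mathcomp Require Import -(notations) mpoly.

(** The moment [MoM mu k b] is, for every [N], exactly the number of integer
    points of the [N]-fold dilate of the polytope [V_region R k b]; and a
    polytope of dimension [d] inside the unit cube has
    [N ^ d * vol + O(N ^ (d - 1))] integer points in its [N]-fold dilate.

    The exact count.  Write [det (1 + X U) = \sum_r e_r(U) X ^ r].  As [U] is
    unitary, the squared modulus of the characteristic polynomial on the circle
    is an explicit unimodular multiple of its square, so [circle_mean]
    identifies the mean of the [2b]-th power of the modulus with
    [conj (det U) ^ b] times a single coefficient of
    [(det (1 + X U)) ^ (2b)].  Expanding the [k]-th power,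
    MoM becomes the sum of the moments
    [F_r = E (conj (det U) ^ m * \prod_a e_(r_a)(U))], [m = k b], over the
    [r] in [nat ^ (2m)] all of whose [k] blocks of length [2b] have sum [N b].

    By [moment_patterns], [F_r] is the number of Gelfand-Tsetlin patterns with
    top row [(0 ^ m, N ^ m)] and weight [r], which says that [\sum_r F_r X ^ r]
    is the Schur polynomial of an [m] by [N] rectangle.  The proof needs neither
    Weyl's integration formula nor representation theory.  Multiply [U] by a
    reflection [1 + w v v^*], [v] a unit vector, [|1 + w| = 1]: each [e_r]
    changes by [w] times a quadratic form in [v], so invariance of the Haar
    measure is an identity between polynomials in [w].  Its coefficients of [w]
    and [w ^ 2], summed over a finite design of vectors ([design_sum]), give two
    relations between moments.  The first fixes the degree of [r].  After
    multiplication by the Vandermonde product, the second says that the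
    exponents [x] of the product have a fixed value of
    [\sum_(a != b) x_a x_b] ([vandermonde_conjugation], [moment_euler2]).  So
    the exponents have a fixed sum and a fixed sum of squares, and they are
    distinct by antisymmetry; since they are also bounded, [extremal_set] leaves
    a single set of exponents and the product is an alternant.  The branching
    rule [alternant_branching] then turns the quotient of this alternant by the
    Vandermonde product into a sum over patterns.

    Reading the diagonals of a pattern as the rows of a matrix, patterns become
    monotone [m] by [m] matrices with entries in [[0, N]], and the conditions on
    the blocks become prescribed sums on [k - 1] antidiagonals
    ([card_block_patterns]).  These are the equations that define the entries of
    [V_region] at the excluded positions, and they preserve integrality
    ([card_lattice_points]).

    The lattice point estimate.  Cut space into cubes of side [1 / N].  The cubes
    that meet a polytope cover it, and the cubes inside it have at most the total
    volume of any cover by boxes, as one sees by integrating indicator functions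
    one coordinate at a time ([slicing]).  A cube that meets the polytope without
    lying inside it is close to one of finitely many hyperplanes, and each of
    these accounts for [O(N ^ (d - 1))] cubes ([slab_count]). *)

Set Implicit Arguments.
Unset Strict Implicit.
Unset Printing Implicit Defensive.
Import Order.TTheory GRing.Theory Num.Theory.
Import numFieldNormedType.Exports.
Local Open Scope ring_scope.

(** * The branching rule for alternants *)

Section Alternant.
Variable S : comNzRingType.
Implicit Types (t : nat -> S) (l : nat -> nat).

Definition alternant t (j : nat) l : S := \det (\matrix_(i < j, a < j) t a ^+ l i).

Lemma det_scale_rows_cols j (c d : 'I_j -> S) (A : 'I_j -> 'I_j -> S) :
  \det (\matrix_(i, a) (c i * d a * A i a)) =
  (\prod_i c i) * (\prod_a d a) * \det (\matrix_(i, a) A i a).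
Proof.
rewrite /determinant mulr_sumr; apply: eq_bigr => s _.
rewrite mulrCA; congr (_ * _).
under [LHS]eq_bigr do rewrite mxE.
under [X in _ = _ * X]eq_bigr do rewrite mxE.
rewrite !big_split /=; congr (_ * _ * _).
by rewrite [RHS](reindex_inj (@perm_inj _ s)).
Qed.

(** Multilinearity in the rows. The choices of one summand per row are encoded
    as functions on all of ['I_n.+1], zero from [j] on, so that their type does
    not depend on [j]. *)
Lemma det_sum_rows n B j (Q : 'I_n.+1 -> pred 'I_B.+1)
    (F : nat -> 'I_B.+1 -> 'I_j -> S) : (j <= n.+1)%N ->
  \det (\matrix_(i < j, a < j) \sum_(q | Q (inord i) q) F i q a) =
  \sum_(f in pfamily (ord0 : 'I_B.+1) (fun i : 'I_n.+1 => i < j)%N Q)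
    \det (\matrix_(i < j, a < j) F i (f (inord i)) a).
Proof.
move=> jn.
rewrite /determinant exchange_big /=; apply: eq_bigr => s _.
rewrite -mulr_sumr; congr (_ * _).
pose G (i : 'I_n.+1) (q : 'I_B.+1) :=
  if insub (i : nat) is Some i' then F i q (s i') else 1 : S.
have GE (i : 'I_j) q : G (inord i) q = F i q (s i).
  rewrite /G inordK ?(leq_trans (ltn_ord i)) //.
  by rewrite insubT //= => lt_ij; congr (F _ _ (s _)); apply/val_inj.
transitivity (\prod_(i < n.+1 | (i < j)%N) \sum_(q | Q i q) G i q).
  transitivity (\prod_(i < j) \sum_(q | Q (inord i) q) G (inord i) q).
    by apply: eq_bigr => i _; rewrite mxE; apply: eq_bigr => q _; rewrite GE.
  rewrite (big_ord_widen _ (fun i => \sum_(q | Q (inord i) q) G (inord i) q) jn).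
  by apply: eq_bigr => i _; rewrite inord_val.
rewrite (big_distr_big_dep ord0); apply: eq_bigr => f _.
transitivity (\prod_(i < j) G (inord i) (f (inord i))); last first.
  by apply: eq_bigr => i _; rewrite mxE GE.
rewrite (big_ord_widen _ (fun i => G (inord i) (f (inord i))) jn).
by apply: eq_bigr => i _; rewrite inord_val.
Qed.

Lemma subXX_interval (x y : S) (p r : nat) : (p <= r)%N ->
  x ^+ r - y ^+ (r - p) * x ^+ p =
  (x - y) * \sum_(p <= q < r) y ^+ (r.-1 - q) * x ^+ q.
Proof.
move=> /subnK <-; move: (r - p)%N => d {r}; rewrite addnK.
rewrite -[X in \sum_(X <= _ < _) _]add0n big_addn addnK exprD -mulrBl.
rewrite -opprB subrXX -mulNr opprB -mulrA mulr_suml.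
congr (_ * _); rewrite big_mkord; apply: eq_bigr => q _.
have -> : ((d + p).-1 - (q + p) = d.-1 - q)%N by have := ltn_ord q; lia.
by rewrite -mulrA -exprD.
Qed.

(** Row operations: the last column is cleared except for its first entry, and
    every other column acquires a factor [t a - t j]. *)
Lemma alternant_recl t j l : (forall i, i < j -> l i <= l i.+1)%N ->
  alternant t j.+1 l = t j ^+ l 0%N * \prod_(a < j) (t j - t a) *
   \det (\matrix_(i < j, a < j)
      \sum_(l i <= q < l i.+1) t j ^+ ((l i.+1).-1 - q) * t a ^+ q).
Proof.
move=> lmono.
(* multiplication by [L] subtracts a multiple of the preceding row from each
   row but the first; the multiple is the one that clears the column of [t j] *)
pose L : 'M[S]_j.+1 := \matrix_(i, i') ((i == i')%:R -
   (i == i'.+1 :> nat)%:R * t j ^+ (l i - l i')%N).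
have detL : \det L = 1.
  rewrite det_trig; last first.
    apply/is_trig_mxP => i i' lt_ii'; rewrite mxE.
    have /negPf-> : i != i' by rewrite -val_eqE neq_ltn lt_ii'.
    by rewrite (_ : (_ == _.+1) = false) ?mul0r ?subr0 //; apply/negbTE; rewrite neq_ltn ltnS (ltnW lt_ii').
  by apply: big1 => i _; rewrite mxE eqxx (_ : (_ == _.+1) = false) ?mul0r ?subr0 //; lia.
pose M : 'M[S]_j.+1 := \matrix_(i < j.+1, a < j.+1) t a ^+ l i.
have LME i a : (L *m M) i a = M i a -
    \sum_(i' < j.+1) (i == i'.+1 :> nat)%:R * t j ^+ (l i - l i')%N * M i' a.
  rewrite mxE; under eq_bigr do rewrite mxE mulrBl.
  rewrite sumrB (bigD1 i) //= eqxx mul1r big1 ?addr0 // => i' /negPf.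
  by rewrite eq_sym => ->; rewrite mul0r.
have LM0 a : (L *m M) ord0 a = t a ^+ l 0%N.
  by rewrite LME big1 ?subr0 ?mxE // => i _; rewrite !mul0r.
have LMS (i : 'I_j) a : (L *m M) (lift ord0 i) a =
    (t a - t j) * \sum_(l i <= q < l i.+1) t j ^+ ((l i.+1).-1 - q) * t a ^+ q.
  rewrite LME (bigD1 (widen_ord (leqnSn j) i)) //= /bump leq0n add1n eqxx mul1r.
  rewrite big1 ?addr0 => [|i' /negPf ne]; last first.
    rewrite (_ : (_ == _) = false) ?mul0r //.
    by rewrite eqSS eq_sym; exact: ne.
  by rewrite !mxE /= subXX_interval ?lmono.
have -> : alternant t j.+1 l = \det (L *m M) by rewrite det_mulmx detL mul1r.
rewrite (expand_det_col _ ord_max) big_ord_recl big1 ?addr0; last first.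
  by move=> i _; rewrite LMS subrr !mul0r.
rewrite LM0 -mulrA; congr (_ * _).
rewrite /cofactor /= add0n.
transitivity ((-1) ^+ j * \det (\matrix_(i < j, a < j) (1 * (t a - t j) *
   \sum_(l i <= q < l i.+1) t j ^+ ((l i.+1).-1 - q) * t a ^+ q))).
  congr (_ * \det _); apply/matrixP => i a; rewrite !mxE.
  have := LMS i (lift ord_max a); rewrite !mxE => ->.
  by rewrite mul1r lift_max.
rewrite det_scale_rows_cols big1 // mul1r mulrA; congr (_ * _).
rewrite -{1}[j]card_ord -prodr_const -big_split /=.
by apply: eq_bigr => a _; rewrite mulN1r opprB.
Qed.

(** Rows of every length share one finite type, in which they are padded by
    zeros; entries are read at natural numbers so that indices can be shifted
    freely. *)
Definition row_entry n B (f : {ffun 'I_n.+1 -> 'I_B.+1}) (i : nat) : nat :=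
  f (inord i).

(** The branching rule of Schur polynomials, free of division: an alternant in
    [j.+1] variables expands over the exponents that interlace [lam], one summand
    of each geometric sum being chosen in each row of [alternant_recl]. *)
Lemma alternant_branching n B t j (lam : nat -> nat) : (j <= n.+1)%N ->
  (forall i, i < j -> lam i <= lam i.+1)%N -> (forall i, i <= j -> lam i <= B)%N ->
  alternant t j.+1 (fun i => lam i + i)%N = \prod_(a < j) (t j - t a) *
   \sum_(mu in pfamily (ord0 : 'I_B.+1) (fun i : 'I_n.+1 => i < j)%N
           (fun i : 'I_n.+1 => [pred q : 'I_B.+1 | lam i <= q <= lam i.+1]%N))
      t j ^+ (\sum_(i < j.+1) lam i - \sum_(i < j) row_entry mu i) *
      alternant t j (fun i => row_entry mu i + i)%N.
Proof.
move=> jn lmono lB.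
rewrite alternant_recl; last by move=> i ij; rewrite addnS leqW // leq_add2r lmono.
rewrite addn0 -mulrA mulrCA; congr (_ * _).
have E (i a : 'I_j) :
   \sum_(lam i + i <= q < lam i.+1 + i.+1)
     t j ^+ ((lam i.+1 + i.+1).-1 - q) * t a ^+ q =
   \sum_(q < B.+1 | (lam (@inord n i) <= q <= lam (@inord n i).+1)%N)
     t j ^+ (lam i.+1 - q) * t a ^+ (q + i)%N.
  rewrite inordK ?(leq_trans (ltn_ord i)) //.
  rewrite big_addn addnS -addSn addnK.
  rewrite (big_nat_widen _ _ B.+1); last by rewrite ltnS lB.
  rewrite (big_nat_widenl _ 0) // big_mkord.
  apply: eq_big => [q|q _]; first by rewrite ltnS andbC.
  by congr (_ ^+ _ * _); lia.
under eq_mx do rewrite E.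
rewrite (det_sum_rows (fun (i : 'I_n.+1) (q : 'I_B.+1) => (lam i <= q <= lam i.+1)%N)
  (fun i (q : 'I_B.+1) (a : 'I_j) =>
     t j ^+ (lam i.+1 - q) * t a ^+ (q + i)%N)) // mulr_sumr.
apply: eq_bigr => mu muP.
transitivity (t j ^+ lam 0%N * \det (\matrix_(i < j, a < j)
  ((t j ^+ (lam i.+1 - row_entry mu i)) * 1 * t a ^+ (row_entry mu i + i)))).
  congr (_ * \det _); apply/matrixP => i a; rewrite !mxE mulr1 //.
rewrite det_scale_rows_cols [X in _ * X * _]big1 // mulr1 mulrA; congr (_ * _).
rewrite -expr_sum -exprD; congr (_ ^+ _).
have muE (i : 'I_j) : (lam i <= row_entry mu i <= lam i.+1)%N.
  have /pfamilyP[_ /(_ (inord i))] := muP.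
  by rewrite -!topredE /= inordK ?(leq_trans (ltn_ord i)) // => /(_ isT).
rewrite big_ord_recl -addnBA; last by apply: leq_sum => i _; case/andP: (muE i).
by rewrite sumnB // => i _; case/andP: (muE i).
Qed.
End Alternant.

(** * Sums over chains of states *)

Section Transfer.
Variables (S : comNzRingType) (T : finType) (x0 : T) (n : nat).
Variables (R : nat -> rel T) (w : nat -> T -> T -> S).
Implicit Types (g : {ffun 'I_n.+1 -> T}).

(** The state above level [i], the final state [x] being the one at level [j].
    *)
Definition next_state g j x i := if i.+1 == j then x else g (inord i.+1).

(** Levels from [j] on are pinned to [x0], which makes chains of every length
    live in one finite type. *)
Definition chain j x g := [forall i : 'I_n.+1,
  if (i < j)%N then R i (g i) (next_state g j x i) else g i == x0].

(** Unfolding a one-step recursion [j] times sums over all the trajectories;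
    the reindexing adds or removes the last state. *)
Lemma transfer_sum (Z : nat -> T -> S) :
  (forall x, Z 0%N x = 1) ->
  (forall j x, Z j.+1 x = \sum_(y | R j y x) w j y x * Z j y) ->
  forall j x, (j <= n.+1)%N ->
  Z j x = \sum_(g | chain j x g) \prod_(i < j) w i (g (inord i)) (next_state g j x i).
Proof.
move=> Z0 ZS; elim=> [|j IH] x jn.
  rewrite Z0 (big_pred1 [ffun _ => x0]) ?big_ord0 // => g.
  apply/forallP/eqP => [gP|-> i]; last by rewrite /= ffunE.
  by apply/ffunP => i; rewrite ffunE; apply/eqP; exact: gP i.
rewrite ZS [RHS](partition_big (fun g => g (inord j)) (fun y => R j y x)) /=; last first.
  by move=> g /forallP/(_ (inord j)); rewrite inordK // ltnSn /next_state eqxx.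
apply: eq_bigr => y Ryx; rewrite IH ?(ltnW jn) // mulr_sumr.
pose h g : {ffun 'I_n.+1 -> T} := [ffun i : 'I_n.+1 => if (i : nat) == j then y else g i].
pose h' g : {ffun 'I_n.+1 -> T} := [ffun i : 'I_n.+1 => if (i : nat) == j then x0 else g i].
rewrite [RHS](reindex_onto h h') /=; last first.
  move=> g /andP[_ /eqP gy]; apply/ffunP => i; rewrite !ffunE.
  by case: eqP => // ij; rewrite -gy -ij inord_val.
have hj g : h g (inord j) = y by rewrite ffunE inordK // eqxx.
have hn g i : (i < j)%N -> next_state (h g) j.+1 x i = next_state g j y i.
  move=> ij; rewrite /next_state eqSS (ltn_eqF ij) ffunE.
  by rewrite inordK ?(leq_ltn_trans ij jn).
have hi g i : (i < j)%N -> h g (inord i) = g (inord i).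
  by move=> ij; rewrite ffunE inordK ?(ltn_eqF ij) ?(ltn_trans ij jn).
apply: eq_big => g; last first.
  move=> _; rewrite big_ord_recr /= hj mulrC; congr (_ * _); last first.
    by rewrite /next_state eqxx.
  by apply: eq_bigr => i _; rewrite hi // hn.
rewrite hj eqxx andbT.
apply/idP/andP => [/forallP gP|[/forallP gP /eqP gE]].
  split; last first.
    apply/eqP/ffunP => i; rewrite !ffunE; case: eqP => // ij.
    by have := gP i; rewrite ij ltnn => /eqP.
  apply/forallP => i; have := gP i; case: (ltngtP i j) => ij.
  - by rewrite ltnS ltnW // hn // ffunE (ltn_eqF ij).
  - by rewrite ltnS leqNgt ij /= ffunE (gtn_eqF ij).
  - by move=> _; rewrite ij ltnSn /next_state eqxx ffunE ij eqxx.
apply/forallP => i; have := gP i; case: (ltngtP i j) => ij.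
- by rewrite ltnS ltnW // hn // ffunE (ltn_eqF ij).
- by rewrite ltnS leqNgt ij /= ffunE (gtn_eqF ij).
- by move=> _; rewrite -gE !ffunE ij eqxx.
Qed.
End Transfer.

(** * Gelfand-Tsetlin patterns *)

Section Patterns.
Variables (S : comNzRingType) (n B : nat).
Local Notation row := {ffun 'I_n.+1 -> 'I_B.+1}.
Implicit Types (t : nat -> S) (lam mu : row).

Definition row0 : row := [ffun _ => ord0].

Definition interlaces j mu lam := mu \in pfamily (ord0 : 'I_B.+1)
  (fun i : 'I_n.+1 => i < j)%N
  (fun i : 'I_n.+1 => [pred q : 'I_B.+1 | row_entry lam i <= q <= row_entry lam i.+1]%N).

Lemma interlacesP j mu lam : (j <= n.+1)%N ->
  reflect ((forall i, i < j -> row_entry lam i <= row_entry mu i <= row_entry lam i.+1)%N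
    /\ forall i : 'I_n.+1, (j <= i)%N -> mu i = ord0) (interlaces j mu lam).
Proof.
move=> jn; apply: (iffP pfamilyP) => -[H1 H2]; split.
- move=> i ij; have := H2 (inord i).
  by rewrite -!topredE /= inordK ?(leq_trans ij) // => /(_ isT).
- move=> i ji; apply/eqP; apply/negPn/negP => ne.
  by have /fintype.subsetP/(_ i) := H1; rewrite -!topredE /= => /(_ ne); rewrite ltnNge ji.
- apply/fintype.subsetP => i; rewrite -!topredE /= => ne; rewrite ltnNge; apply/negP => ji.
  by rewrite H2 // eqxx in ne.
- by move=> i; rewrite -!topredE /= => /H1; rewrite /row_entry inord_val.
Qed.

Definition row_sum j lam := (\sum_(i < j) row_entry lam i)%N.

Fixpoint pattern_sum t j lam : S := if j is j'.+1 then
  \sum_(mu | interlaces j' mu lam)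
    t j' ^+ (row_sum j'.+1 lam - row_sum j' mu) * pattern_sum t j' mu
  else 1.

Definition vandermonde t j : S := \prod_(i < j) \prod_(a < i) (t i - t a).

Lemma vandermondeS t j :
  vandermonde t j.+1 = vandermonde t j * \prod_(a < j) (t j - t a).
Proof. by rewrite /vandermonde big_ord_recr. Qed.

(** The factors [t j - t a] that [alternant_branching] produces at each step
    build up the Vandermonde product. *)
Lemma alternant_pattern_sum t j lam : (j <= n.+1)%N ->
  (forall i, i.+1 < j -> row_entry lam i <= row_entry lam i.+1)%N ->
  alternant t j (fun i => row_entry lam i + i)%N = vandermonde t j * pattern_sum t j lam.
Proof.
elim: j lam => [|j IH] lam jn lmono.
  by rewrite /alternant det_mx00 /vandermonde big_ord0 mulr1.
rewrite (@alternant_branching _ n B) //; last 2 first.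
- exact: ltnW.
- by move=> i _; rewrite -ltnS ltn_ord.
rewrite vandermondeS.
rewrite [vandermonde t j * _]mulrC -mulrA; congr (_ * _); rewrite mulr_sumr.
apply: eq_bigr => mu /(interlacesP _ _ (ltnW jn)) [muP _].
rewrite [RHS]mulrCA; congr (_ * _); apply: IH (ltnW jn) _ => i ij.
have /andP[_ h1] := muP i (ltnW ij); have /andP[h2 _] := muP _ ij.
exact: leq_trans h1 h2.
Qed.

(** The combinatorial formula of Schur polynomials, multiplied by the
    denominator of the bialternant formula. *)
Lemma alternant_patterns t lam :
  (forall i, i.+1 < n.+1 -> row_entry lam i <= row_entry lam i.+1)%N ->
  alternant t n.+1 (fun i => row_entry lam i + i)%N = vandermonde t n.+1 *
  \sum_(g : {ffun 'I_n.+1 -> row} | chain row0 interlaces n.+1 lam g) \prod_(i < n.+1)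
     t i ^+ (row_sum i.+1 (next_state g n.+1 lam i) - row_sum i (g (inord i))).
Proof.
move=> lmono; rewrite alternant_pattern_sum //; congr (_ * _).
pose w j mu lam := t j ^+ (row_sum j.+1 lam - row_sum j mu).
by apply: (@transfer_sum _ _ row0 n interlaces w (pattern_sum t)).
Qed.
End Patterns.

(** * Conjugation by a Vandermonde product *)

Section Derivations.
Variables (S : comNzRingType).

Definition derivation (D : S -> S) :=
  (forall x y, D (x + y) = D x + D y) /\ (forall x y, D (x * y) = D x * y + x * D y).

Lemma derivation1 D : derivation D -> D 1 = 0.
Proof.
move=> [_ DM]; have := DM 1 1; rewrite !mulr1 mul1r.
by rewrite -{1}[D 1]addr0 => /addrI.
Qed.

Lemma derivation_sum D (I : Type) (r : seq I) (P : pred I) (f : I -> S) :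
  derivation D -> D (\sum_(i <- r | P i) f i) = \sum_(i <- r | P i) D (f i).
Proof.
move=> [DA _]; have D0 : D 0 = 0.
  by have := DA 0 0; rewrite addr0 -{1}[D 0]addr0 => /addrI.
by elim/big_rec2: _ => // i x y Pi <-.
Qed.

Lemma derivation_prod_seq D (I : eqType) (r : seq I) (f : I -> S) :
  derivation D -> uniq r -> D (\prod_(i <- r) f i) =
  \sum_(i <- r) D (f i) * \prod_(j <- r | j != i) f j.
Proof.
move=> HD; elim: r => [|i r IH] /=; first by rewrite !big_nil (derivation1 HD).
case/andP=> ir ur; rewrite !big_cons eqxx /= HD.2 (IH ur); congr (_ * _ + _).
  rewrite [LHS]big_seq_cond [RHS]big_seq_cond; apply: eq_bigl => j.
  by case: eqP => [->|]; rewrite ?(negPf ir) ?andbT.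
rewrite mulr_sumr; apply: eq_big_seq => j jr.
rewrite big_cons; have -> : i != j by apply: contraNneq ir => ->.
by rewrite mulrCA.
Qed.

Lemma derivation_prod D (I : finType) (P : pred I) (f : I -> S) :
  derivation D -> D (\prod_(i | P i) f i) =
  \sum_(i | P i) D (f i) * \prod_(j | P j && (j != i)) f j.
Proof.
move=> HD; rewrite -big_filter derivation_prod_seq ?filter_uniq ?index_enum_uniq //.
rewrite big_filter; apply: eq_bigr => i _; congr (_ * _).
by rewrite big_filter_cond.
Qed.

Variables (I : finType) (t : I -> S) (D : I -> S -> S) (q : I -> S) (M : I -> I -> S).
Variables (Delta : S) (delta : I -> I -> S).
Hypothesis derD : forall a, derivation (D a).
Hypothesis Dq : forall a b, a != b -> D a (q b) = 0.
Hypothesis DDq : forall a b, a != b -> D a (D b (q b)) = 0.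
Hypothesis M_eq : forall a b, a != b ->
  (t a - t b) * M a b = t a * q a * D b (q b) - t b * q b * D a (q a).
Hypothesis Delta_eq : forall a b, a != b -> Delta = (t a - t b) * delta a b.
Hypothesis delta_anti : forall a b, a != b -> delta b a = - delta a b.
Hypothesis DDelta : forall a, D a Delta = \sum_(b | b != a) t a * delta a b.

Local Notation Q := (\prod_a q a).
Local Notation Qrest a b := (\prod_(c | (c != a) && (c != b)) q c).

Let QEE a b : b != a -> \prod_(c | c != a) q c = q b * Qrest a b.
Proof. by move=> ba; rewrite (bigD1 b). Qed.

Let DQ a : D a Q = D a (q a) * \prod_(c | c != a) q c.
Proof.
rewrite derivation_prod // [LHS](bigD1 a) //= [X in _ + X]big1 ?addr0 // => b ba.
by rewrite Dq ?mul0r // eq_sym.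
Qed.

Let DDQ a b : b != a -> D a (D b Q) = D a (q a) * D b (q b) * Qrest a b.
Proof.
move=> ba; rewrite DQ (derD a).2 DDq 1?eq_sym // mul0r add0r derivation_prod //.
rewrite [X in _ * X = _](bigD1 a) 1?eq_sym //= [X in _ + X]big1 ?addr0; last first.
  by move=> c /andP[_ ca]; rewrite Dq ?mul0r // eq_sym.
rewrite mulrCA mulrA; congr (_ * _); apply: eq_bigl => c; exact: andbC.
Qed.

Lemma sum_offdiag_swap (f : I -> I -> S) :
  \sum_a \sum_(b | b != a) f a b = \sum_a \sum_(b | b != a) f b a.
Proof.
rewrite (exchange_big_dep predT) //=; apply: eq_bigr => a _.
by apply: eq_bigl => b; rewrite eq_sym.
Qed.

(** Conjugation by [Delta] removes the interaction [M]. In the application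
    [Delta] is the Vandermonde product, [D a] the Euler operator of the variable
    [t a], [q a] a polynomial in this variable alone and [M a b] the trace of a
    product of two resolvents. By the relation [M_eq], and as [Delta] is divisible
    by [t a - t b], the terms [Delta * M a b] become first order terms in [Q];
    those in which the quotient [delta a b] survives add up to derivatives of
    [Delta] and are the cross terms of the Leibniz rule for [D a (D b (Delta *
    Q))]. *)
Lemma vandermonde_conjugation :
  Delta * (\sum_a \sum_(b | b != a) (D a (q a) * D b (q b) + M a b) * Qrest a b)
   + (\sum_a \sum_(b | b != a) D a (D b Delta)) * Q
   + ((\sum_a D a Delta) * \sum_a D a Q) *+ 2
  = \sum_a \sum_(b | b != a) D a (D b (Delta * Q))
   + (Delta * \sum_a D a Q) *+ (#|I|.-1 * 2).
Proof.
(* the diagonal cross terms, which both the interaction and the Leibniz rule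
   produce and which cancel *)
pose T := \sum_a D a Delta * D a Q.
have eM a b : b != a -> Delta * (M a b * Qrest a b) =
    Delta * (D a Q + D b Q) - t a * delta a b * D a Q - t b * delta b a * D b Q.
  move=> ba; have ab : a != b by rewrite eq_sym.
  have e1 : (t a - t b) * M a b * Qrest a b = t a * D b Q - t b * D a Q.
    rewrite M_eq // !DQ (QEE ba) (QEE ab).
    have -> : Qrest b a = Qrest a b by apply: eq_bigl => c; exact: andbC.
    by ring.
  rewrite (Delta_eq ab) (delta_anti ab).
  transitivity (delta a b * ((t a - t b) * M a b * Qrest a b)); first by ring.
  by rewrite e1; ring.
have sM : \sum_a \sum_(b | b != a) Delta * (M a b * Qrest a b) =
    (Delta * \sum_a D a Q) *+ (#|I|.-1 * 2) - T *+ 2.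
  have c1 (f : I -> S) : \sum_a \sum_(b | b != a) f a = (\sum_a f a) *+ #|I|.-1.
    rewrite -sumrMnl; apply: eq_bigr => a _; rewrite sumr_const; congr (_ *+ _).
    by rewrite -[in RHS](cardC1 a); apply: eq_card => b.
  have c2 : \sum_a \sum_(b | b != a) t a * delta a b * D a Q = T.
    by apply: eq_bigr => a _; rewrite DDelta mulr_suml.
  transitivity (\sum_a \sum_(b | b != a)
     (Delta * (D a Q + D b Q) - t a * delta a b * D a Q - t b * delta b a * D b Q)).
    by apply: eq_bigr => a _; apply: eq_bigr => b ba; exact: eM.
  under [LHS]eq_bigr do rewrite !sumrB.
  rewrite !sumrB c2 [X in _ - X](sum_offdiag_swap (fun a b => t b * delta b a * D b Q)) c2.
  rewrite mulr2n opprD addrA; congr (_ - _ - _).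
  transitivity (\sum_a \sum_(b | b != a) (Delta * D a Q + Delta * D b Q)).
    by apply: eq_bigr => a _; apply: eq_bigr => b _; rewrite mulrDr.
  under [LHS]eq_bigr do rewrite big_split /=.
  rewrite big_split /= (sum_offdiag_swap (fun a b => Delta * D b Q)) c1.
  by rewrite -mulr_sumr -mulr2n -mulrnA.
have sD : \sum_a \sum_(b | b != a) D a Delta * D b Q =
    (\sum_a D a Delta) * (\sum_a D a Q) - T.
  rewrite mulr_suml /T -sumrB; apply: eq_bigr => a _.
  by rewrite mulr_sumr [X in _ = X - _](bigD1 a) //= addrAC subrr add0r.
have e3 a b : b != a -> D a (D b (Delta * Q)) = D a (D b Delta) * Q
    + D a Delta * D b Q + D b Delta * D a Q + Delta * (D a (q a) * D b (q b) * Qrest a b).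
  move=> ba; rewrite (derD b).2 (derD a).1 !(derD a).2 DDQ //; ring.
have sX : \sum_a \sum_(b | b != a) D a (D b (Delta * Q)) =
    (\sum_a \sum_(b | b != a) D a (D b Delta)) * Q
    + ((\sum_a D a Delta) * (\sum_a D a Q) - T) *+ 2
    + Delta * \sum_a \sum_(b | b != a) D a (q a) * D b (q b) * Qrest a b.
  transitivity (\sum_a \sum_(b | b != a) (D a (D b Delta) * Q
    + D a Delta * D b Q + D b Delta * D a Q + Delta * (D a (q a) * D b (q b) * Qrest a b))).
    by apply: eq_bigr => a _; apply: eq_bigr => b ba; exact: e3.
  under [LHS]eq_bigr do rewrite !big_split /=.
  rewrite !big_split /= sD (sum_offdiag_swap (fun a b => D b Delta * D a Q)) sD.
  rewrite -!addrA; congr (_ + _).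
    by rewrite mulr_suml; apply: eq_bigr => a _; rewrite mulr_suml.
  congr (_ + (_ + (_ + (_ + _)))).
  by rewrite mulr_sumr; apply: eq_bigr => a _; rewrite mulr_sumr.
have sW : Delta * (\sum_a \sum_(b | b != a) (D a (q a) * D b (q b) + M a b) * Qrest a b)
    = Delta * (\sum_a \sum_(b | b != a) D a (q a) * D b (q b) * Qrest a b)
      + \sum_a \sum_(b | b != a) Delta * (M a b * Qrest a b).
  rewrite !mulr_sumr -big_split /=; apply: eq_bigr => a _.
  rewrite !mulr_sumr -big_split /=; apply: eq_bigr => b _.
  by rewrite mulrDl mulrDr.
rewrite sX sW sM; ring.
Qed.

End Derivations.

(** * Euler operators *)

Section PolynomialRing.
Variables (K : numFieldType) (n' : nat).
Local Notation n := n'.+1.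
Local Notation S := (mpoly n K).
Local Notation var i := (mpolyX K (mnm1 i) : S).
Implicit Types (i a b : 'I_n) (p : S) (x r : multinom n).

Definition euler a p : S := var a * mderiv a p.

Lemma mcoeff_euler a p x : mcoeff x (euler a p) = (x a)%:R * mcoeff x p.
Proof.
rewrite /euler {1}[p]mpolyE [X in _ = _ * mcoeff _ X]mpolyE.
rewrite !raddf_sum /= mulr_sumr raddf_sum /= mulr_sumr; apply: eq_bigr => m _.
rewrite linearZ /= mderivX -!scalerAr !mcoeffZ [RHS]mulrCA; congr (_ * _).
have [m0|m0] := eqVneq (m a) 0%N.
  rewrite m0 mul0r mcoeffX; case: eqP => [<-|_]; rewrite ?mulr0 //.
  by rewrite m0 mul0r.
rewrite [var a * _]mulrC -mpolyXD submK; last by rewrite lep1mP.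
by rewrite mcoeffX; case: eqP => [->|_] //; rewrite !mulr0.
Qed.

Lemma derivation_euler a : derivation (euler a).
Proof.
split=> [p q|p q]; rewrite /euler.
  by rewrite mderivD mulrDr.
by rewrite mderivM mulrDr mulrCA mulrA [X in _ + X]mulrCA mulrA; ring.
Qed.

(** Substituting the variable [a] in a univariate polynomial puts copies of
    one polynomial into independent variables. *)
Definition evalX a (p : {poly K}) : S := horner_alg (var a) p.

Lemma evalXE a (p : {poly K}) D : (size p <= D)%N ->
  evalX a p = \sum_(i < D) p`_i *: (var a) ^+ i.
Proof.
move=> sD; have {1}-> : p = \sum_(i < D) p`_i *: 'X^i.
  rewrite -poly_def; apply/polyP => i; rewrite coef_poly.
  by case: ltnP => // Di; rewrite nth_default // (leq_trans sD).
rewrite /evalX linear_sum; apply: eq_bigr => i _ /=.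
by rewrite linearZ /= rmorphXn /= horner_algX -scalerAl mul1r.
Qed.

Lemma mcoeff_prod_evalX (f : 'I_n -> {poly K}) x :
  mcoeff x (\prod_a evalX a (f a)) = \prod_a (f a)`_(x a).
Proof.
pose D := (\max_a maxn (size (f a)) (x a).+1)%N.
have Dx a : (x a < D)%N.
  by apply: leq_trans (leq_bigmax a); rewrite leq_max leqnn orbT.
have fE a : evalX a (f a) = \sum_(i < D) (f a)`_i *: var a ^+ i.
  by apply: evalXE; apply: leq_trans (leq_bigmax a); rewrite leq_max leqnn.
under eq_bigr do rewrite fE.
rewrite bigA_distr_bigA /= raddf_sum /=.
pose g0 : {ffun 'I_n -> 'I_D} := [ffun a => Ordinal (Dx a)].
have gE (g : {ffun 'I_n -> 'I_D}) :
    \prod_a ((f a)`_(g a) *: var a ^+ g a) =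
    (\prod_a (f a)`_(g a)) *: mpolyX K (Multinom [tuple (g a : nat) | a < n]).
  rewrite mpolyXE_id -scaler_prod; apply: eq_bigr => a _; congr (_ *: _ ^+ _).
  by rewrite multinomE tnth_mktuple.
rewrite (bigD1 g0) //= gE mcoeffZ mcoeffX [X in _ + X]big1 ?addr0.
  rewrite (_ : (_ == x) = true) ?mulr1; last first.
    by apply/eqP/mnmP => a; rewrite multinomE tnth_mktuple ffunE.
  by apply: eq_bigr => a _; rewrite ffunE.
move=> g /eqP ne; rewrite gE mcoeffZ mcoeffX; case: eqP => [E|]; last by rewrite mulr0.
case: ne; apply/ffunP => a; apply/val_inj; rewrite ffunE /= -E.
by rewrite multinomE tnth_mktuple.
Qed.

Lemma euler_sum a (I : Type) (s : seq I) (P : pred I) (F : I -> S) :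
  euler a (\sum_(i <- s | P i) F i) = \sum_(i <- s | P i) euler a (F i).
Proof. exact/derivation_sum/derivation_euler. Qed.

Lemma eulerZ a c p : euler a (c *: p) = c *: euler a p.
Proof. by rewrite /euler linearZ /= scalerAr. Qed.

Lemma eulerX a b (i : nat) : euler a (var b ^+ i) = (i * (b == a))%:R *: var b ^+ i.
Proof.
apply/mpolyP => x; rewrite mcoeff_euler mcoeffZ mcoeffXn; case: eqP => [<-|]; last by rewrite !mulr0.
by rewrite mulmnE mnm1E mulnC.
Qed.

Lemma euler_evalX a (p : {poly K}) : euler a (evalX a p) = evalX a ('X * p^`()).
Proof.
rewrite (@evalXE a p (size p).+1) // (@evalXE a ('X * _) (size p).+1); last first.
  have [->|p0] := eqVneq p 0; first by rewrite deriv0 mulr0 size_poly0.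
  apply: leq_trans (size_polyMleq _ _) _; rewrite size_polyX /= ltnS.
  exact: ltnW (lt_size_deriv p0).
rewrite euler_sum; apply: eq_bigr => i _; rewrite eulerZ. rewrite [euler a _](eulerX a a i) eqxx muln1 scalerA.
congr (_ *: _); rewrite coefXM coef_deriv; case: i => -[|i] /= _.
  by rewrite mulr0.
by rewrite mulr_natr.
Qed.

Lemma euler_evalX_neq a b (p : {poly K}) : a != b -> euler a (evalX b p) = 0.
Proof.
move=> ab; rewrite (@evalXE b p (size p)) // euler_sum big1 // => i _.
by rewrite eulerZ [euler a _](eulerX a b i) eq_sym (negPf ab) muln0 scale0r scaler0.
Qed.

End PolynomialRing.

(** * The Vandermonde polynomial *)

Section VandermondePolynomial.
Variables (K : numFieldType) (n' : nat).
Local Notation n := n'.+1.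
Local Notation S := (mpoly n K).
Local Notation var i := (mpolyX K (mnm1 i) : S).
Implicit Types (a b : 'I_n) (p : S) (x r : multinom n) (s : 'S_n).

Definition tvar (i : nat) : S := var (inord i).

Lemma tvarE a : tvar a = var a. Proof. by rewrite /tvar inord_val. Qed.

(** The exponent of the term of the permutation [s] in an alternant. *)
Definition perm_exp (l : nat -> nat) s : multinom n :=
  Multinom [tuple l ((s^-1)%g a) | a < n].

Lemma perm_expE l s a : perm_exp l s a = l ((s^-1)%g a).
Proof. by rewrite multinomE tnth_mktuple. Qed.

Lemma mcoeff_sign (e : bool) p x : mcoeff x ((-1) ^+ e * p) = (-1) ^+ e * mcoeff x p.
Proof. by case: e; rewrite ?mul1r // !mulN1r mcoeffN. Qed.

Lemma alternantE l :
  alternant tvar n l = \sum_(s : 'S_n) (-1) ^+ s * mpolyX K (perm_exp l s).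
Proof.
rewrite /alternant /determinant; apply: eq_bigr => s _; congr (_ * _).
rewrite mpolyXE_id [RHS](reindex_inj (@perm_inj _ s)) /=; apply: eq_bigr => i _.
by rewrite mxE tvarE perm_expE permK.
Qed.

Definition vdm : S := vandermonde tvar n.

Lemma vdm_pairs : vdm = \prod_(p : 'I_n * 'I_n | (p.2 < p.1)%N) (var p.1 - var p.2).
Proof.
rewrite -(pair_big_dep predT (fun i a : 'I_n => (a < i)%N) (fun i a => var i - var a)) /=.
rewrite /vdm /vandermonde; apply: eq_bigr => i _; rewrite tvarE.
rewrite (big_ord_widen n (fun a : nat => var i - tvar a)) 1?ltnW ?ltn_ord //.
by apply: eq_bigr => a _; rewrite tvarE.
Qed.

Lemma vdm_alternant : vdm = alternant tvar n id.
Proof.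
pose a : 'rV[S]_n := \row_i tvar i.
have -> : alternant tvar n id = \det (Vandermonde n a).
  by congr (\det _); apply/matrixP => i j; rewrite !mxE.
rewrite det_Vandermonde vdm_pairs.
rewrite -(pair_big_dep predT (fun i a : 'I_n => (a < i)%N) (fun i a => var i - var a)) /=.
rewrite (exchange_big_dep predT) //=; apply: eq_bigr => i _; apply: eq_bigr => j _.
by rewrite !mxE !tvarE.
Qed.

Lemma mcoeff_mpolyXM m p x : mcoeff x (mpolyX K m * p) =
  if lem m x then mcoeff (mnm_sub x m) p else 0.
Proof.
case: ifP => mx; first by rewrite -{1}(submK mx) addmC mulrC mcoeffMX.
rewrite [p]mpolyE mulr_sumr raddf_sum big1 //= => r _.
rewrite -scalerAr mcoeffZ -mpolyXD mcoeffX; case: eqP => [E|]; last by rewrite mulr0.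
by rewrite -E lem_addr in mx.
Qed.

(** Products with the Vandermonde polynomial have coefficients that depend
    linearly on those of the other factor; this is what commutes with
    expectations. *)
Lemma mcoeff_vdmM p x : mcoeff x (vdm * p) =
  \sum_(s : 'S_n) (-1) ^+ s *
    (if lem (perm_exp id s) x then mcoeff (mnm_sub x (perm_exp id s)) p else 0).
Proof.
rewrite vdm_alternant alternantE mulr_suml raddf_sum /=; apply: eq_bigr => s _.
by rewrite -mulrA mcoeff_sign mcoeff_mpolyXM.
Qed.

(** The first two elementary symmetric functions of the exponents, the second
    one doubled: the eigenvalues of symmetric Euler operators on monomials. *)
Definition euler_deg x : K := \sum_a (x a)%:R.
Definition euler_deg2 x : K := \sum_a \sum_(b | b != a) (x a)%:R * (x b)%:R.

Lemma mcoeff_sum_euler p x :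
  mcoeff x (\sum_a euler a p) = euler_deg x * mcoeff x p.
Proof.
by rewrite raddf_sum mulr_suml; apply: eq_bigr => a _ /=; rewrite mcoeff_euler.
Qed.

Lemma mcoeff_sum_euler2 p x :
  mcoeff x (\sum_a \sum_(b | b != a) euler a (euler b p)) = euler_deg2 x * mcoeff x p.
Proof.
rewrite raddf_sum mulr_suml; apply: eq_bigr => a _ /=.
rewrite raddf_sum mulr_suml; apply: eq_bigr => b _ /=.
by rewrite !mcoeff_euler mulrA.
Qed.

Lemma euler_deg_perm l s : euler_deg (perm_exp l s) = \sum_(i < n) (l i)%:R.
Proof.
rewrite /euler_deg (reindex_inj (@perm_inj _ s)) /=.
by apply: eq_bigr => i _; rewrite perm_expE permK.
Qed.

Lemma euler_deg2_perm l s :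
  euler_deg2 (perm_exp l s) = \sum_(i < n) \sum_(j < n | j != i) (l i)%:R * (l j)%:R.
Proof.
rewrite /euler_deg2 (reindex_inj (@perm_inj _ s)) /=; apply: eq_bigr => i _.
rewrite (reindex_inj (@perm_inj _ s)) /=; apply: eq_big => [j|j _].
  by rewrite (inj_eq perm_inj).
by rewrite !perm_expE !permK.
Qed.

Definition stair_deg : K := \sum_(i < n) (i : nat)%:R.
Definition stair_deg2 : K := \sum_(i < n) \sum_(j < n | j != i) (i : nat)%:R * (j : nat)%:R.

(** Every monomial of the Vandermonde polynomial is a rearrangement of the
    staircase, so both eigenvalues are constant on it. *)
Lemma mcoeff_vdm x : mcoeff x vdm != 0 ->
  euler_deg x = stair_deg /\ euler_deg2 x = stair_deg2.
Proof.
rewrite vdm_alternant alternantE raddf_sum /= => nz.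
suff [s ->] : exists s, x = perm_exp id s.
  by rewrite euler_deg_perm euler_deg2_perm.
have [/existsP[s /eqP]|/existsPn H] := boolP [exists s, x == perm_exp id s].
  by exists s.
case/eqP: nz; apply: big1 => s _; rewrite mcoeff_sign mcoeffX eq_sym.
by rewrite (negPf (H s)) mulr0.
Qed.

Lemma sum_euler_vdm : \sum_a euler a vdm = stair_deg *: vdm.
Proof.
apply/mpolyP => x; rewrite mcoeff_sum_euler mcoeffZ.
by have [->|/mcoeff_vdm[-> _]] := eqVneq (mcoeff x vdm) 0; rewrite ?mulr0.
Qed.

Lemma sum_euler2_vdm : \sum_a \sum_(b | b != a) euler a (euler b vdm) = stair_deg2 *: vdm.
Proof.
apply/mpolyP => x; rewrite mcoeff_sum_euler2 mcoeffZ.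
by have [->|/mcoeff_vdm[_ ->]] := eqVneq (mcoeff x vdm) 0; rewrite ?mulr0.
Qed.

Definition vdm_rest (p : 'I_n * 'I_n) : S :=
  \prod_(p' : 'I_n * 'I_n | (p'.2 < p'.1)%N && (p' != p)) (var p'.1 - var p'.2).

(** The quotient of the Vandermonde product by [var a - var b]. *)
Definition vdm_cof a b : S := if (b < a)%N then vdm_rest (a, b) else - vdm_rest (b, a).

Lemma vdm_cofE a b : a != b -> vdm = (var a - var b) * vdm_cof a b.
Proof.
move=> ab; rewrite vdm_pairs /vdm_cof; case: ltnP => ba.
  by rewrite (bigD1 (a, b)).
rewrite mulrN -mulNr opprB (bigD1 (b, a)) //=.
by rewrite ltn_neqAle ba andbT; exact: ab.
Qed.

Lemma vdm_cofN a b : a != b -> vdm_cof b a = - vdm_cof a b.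
Proof.
move=> ab; rewrite /vdm_cof; case: ltngtP => ba; rewrite ?opprK //.
by move/val_inj: ba ab => ->; rewrite eqxx.
Qed.

Lemma euler_var a b : euler a (var b) = (b == a)%:R * var a.
Proof.
rewrite -[var b]expr1 eulerX expr1 mul1n; case: eqP => [->|_].
  by rewrite scale1r mul1r.
by rewrite scale0r mul0r.
Qed.

(** Logarithmic differentiation of the product over pairs. *)
Lemma euler_vdm a : euler a vdm = \sum_(b | b != a) var a * vdm_cof a b.
Proof.
rewrite vdm_pairs (derivation_prod _ _ (derivation_euler K a)).
have eB (p : 'I_n * 'I_n) : euler a (var p.1 - var p.2) =
    ((p.1 == a)%:R - (p.2 == a)%:R) * var a.
  by rewrite /euler mderivB mulrBr -/(euler a _) -/(euler a _) !euler_var mulrBl.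
transitivity (\sum_(i : 'I_n) \sum_(j : 'I_n | (j < i)%N)
   ((i == a)%:R - (j == a)%:R) * var a * vdm_rest (i, j)).
  rewrite pair_big_dep /=; apply: eq_bigr => -[i j] _ /=; by rewrite (eB (i, j)).
transitivity (\sum_(i : 'I_n) \sum_(j : 'I_n | (j < i)%N) (i == a)%:R * (var a * vdm_rest (i, j)) -
   \sum_(i : 'I_n) \sum_(j : 'I_n | (j < i)%N) (j == a)%:R * (var a * vdm_rest (i, j))).
  rewrite -sumrB; apply: eq_bigr => i _; rewrite -sumrB; apply: eq_bigr => j _.
  by rewrite !mulrBl !mulrA.
rewrite (bigD1 a) //= [X in _ + X - _]big1 ?addr0; last first.
  by move=> i /negPf ia; apply: big1 => j _; rewrite ia mul0r.
rewrite (exchange_big_dep predT) //= [X in _ - X](bigD1 a) //= [X in _ - (_ + X)]big1 ?addr0; last first.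
  by move=> i /negPf ia; apply: big1 => j _; rewrite ia mul0r.
rewrite (bigID (fun b : 'I_n => (b < a)%N) (fun b => b != a)) /= -sumrN.
congr (_ + _); apply: eq_big => b.
- by rewrite andbC; case: ltngtP => //= ba; rewrite -val_eqE /= ltn_eqF.
- by move=> ba; rewrite eqxx mul1r /vdm_cof ba.
- by rewrite -leqNgt ltn_neqAle eq_sym.
- by move=> ab; rewrite eqxx mul1r /vdm_cof ltnNge (ltnW ab) /= mulrN.
Qed.

End VandermondePolynomial.

(** * A characterisation of rectangular Schur polynomials *)

Lemma sum_offdiag_nat (n : nat) (x : 'I_n -> nat) :
  ((\sum_a \sum_(b | b != a) x a * x b) + \sum_a x a ^ 2 = (\sum_a x a) ^ 2)%N.
Proof.
rewrite -mulnn big_distrl /= -big_split /=; apply: eq_bigr => a _.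
by rewrite -big_distrr /= -mulnn -mulnDr addnC [in RHS](bigD1 a) /=.
Qed.

(** Among the sets of integers in an interval, a set with a gap in the middle
    is determined by its cardinality, sum and sum of squares. *)
Lemma extremal_set (M m N : nat) (X : {set 'I_M}) (L := [set v : 'I_M | (v < m) || (N + m <= v)]%N) :
  (0 < m)%N ->
  #|X| = #|L| -> (\sum_(v in X) v = \sum_(v in L) v)%N ->
  (\sum_(v in X) v ^ 2 = \sum_(v in L) v ^ 2)%N -> X = L.
Proof.
move=> m0 cXL s1 s2.
(* [h] is negative exactly on the gap, and the three hypotheses say that it
   has the same sum over [X] and over [L] *)
pose h (v : nat) : int := (v%:Z - (m.-1)%:Z) * (v%:Z - (N + m)%:Z).
have hE (A : {set 'I_M}) : \sum_(v in A) h v =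
   (\sum_(v in A) v ^ 2)%N%:Z - (m.-1 + N + m)%:Z * (\sum_(v in A) v)%N%:Z + (m.-1 * (N + m))%:Z *+ #|A|.
  rewrite -sumr_const -!natz !raddf_sum mulr_sumr -sumrB -big_split /=.
  apply: eq_bigr => v _; rewrite /h !natz -mulnn; nia.
have hXL : \sum_(v in X) h v = \sum_(v in L) h v by rewrite !hE cXL s1 s2.
have neg : X :\: L = finset.set0.
  apply/eqP; rewrite -finset.subset0; apply/fintype.subsetP => v0 v0in.
  have : \sum_(v in X :\: L) h v = \sum_(v in L :\: X) h v.
    move: hXL; rewrite (big_setID L) /= [RHS](big_setID X) /= finset.setIC => /addrI //.
  have : \sum_(v in L :\: X) h v >= 0.
    apply: sumr_ge0 => v; rewrite !inE /h => /andP[_ /orP[vm|vm]]; nia.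
  have : \sum_(v in X :\: L) h v < 0.
    rewrite (big_setD1 v0) //=.
    have neg v : v \in X :\: L -> h v < 0.
      by rewrite !inE /h negb_or -leqNgt -ltnNge => /andP[/andP[h1 h2] _]; nia.
    rewrite -[ltRHS]addr0; apply: ltr_leD; first exact: neg.
    by apply: sumr_le0 => v /setD1P[_ /neg/ltW].
  lia.
apply/eqP; rewrite eqEcard cXL leqnn andbT -finset.setD_eq0 neg //.
Qed.

Section RectangularSchur.
Variables (K : numFieldType) (n' m N : nat).
Local Notation n := n'.+1.
Local Notation S := (mpoly n K).
Implicit Types (a b : 'I_n) (x r : multinom n) (s : 'S_n).
Hypothesis n_eq : n = (m + m)%N.

Definition mperm x s : multinom n := Multinom [tuple x (s a) | a < n].

Lemma mpermE x s a : mperm x s a = x (s a).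
Proof. by rewrite multinomE tnth_mktuple. Qed.

Variable F : multinom n -> K.
Hypothesis F_big : forall r a, (N < r a)%N -> F r = 0.
Hypothesis F_sym : forall r s, F (mperm r s) = F r.

(** The coefficient of the monomial [x] in the product of the Vandermonde
    polynomial with the generating polynomial of [F]. *)
Definition vdm_conv x : K := \sum_(s : 'S_n) (-1) ^+ s *
  (if lem (perm_exp id s) x then F (mnm_sub x (perm_exp id s)) else 0).

Definition top_part (i : nat) : nat := if (i < m)%N then 0%N else N.
(** The exponents of the alternant attached to the rectangle. *)
Definition top_exp (i : nat) : nat := (top_part i + i)%N.

Lemma top_exp_inj : injective top_exp.
Proof.
by move=> i j; rewrite /top_exp /top_part; case: (ltnP i m); case: (ltnP j m); lia.
Qed.

Hypothesis F_deg : exists c, forall r, F r != 0 -> euler_deg K r = c.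
Hypothesis conv_deg2 : exists c, forall x, vdm_conv x != 0 -> euler_deg2 K x = c.
Hypothesis F_top : F (Multinom [tuple top_part a | a < n]) = 1.

Lemma vdm_conv_perm x s : vdm_conv (mperm x s) = (-1) ^+ s * vdm_conv x.
Proof.
rewrite /vdm_conv (reindex_inj (mulIg (s^-1)%g)) /= mulr_sumr; apply: eq_bigr => u _.
have peE : perm_exp id (u * s^-1)%g = mperm (perm_exp id u) s.
  by apply/mnmP => a; rewrite mpermE !perm_expE invMg invgK permM.
rewrite peE odd_permM odd_permV signr_addb mulrA [(-1) ^+ u * _]mulrC; congr (_ * _).
have -> : lem (mperm (perm_exp id u) s) (mperm x s) = lem (perm_exp id u) x.
  apply/mnm_lepP/mnm_lepP => H a; last by rewrite !mpermE.
  by have := H ((s^-1)%g a); rewrite !mpermE permKV.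
case: ifP => // _; rewrite -[RHS](F_sym _ s); congr (F _).
by apply/mnmP => a; rewrite !(mpermE, mnmBE).
Qed.

Lemma vdm_conv_neq0 x : vdm_conv x != 0 ->
  exists s, lem (perm_exp id s) x /\ F (mnm_sub x (perm_exp id s)) != 0.
Proof.
move=> nz.
have [/existsP[s /andP[h1 h2]]|/existsPn H] := boolP [exists s : 'S_n,
   lem (perm_exp id s) x && (F (mnm_sub x (perm_exp id s)) != 0)]; first by exists s.
case/eqP: nz; apply: big1 => s _; have := H s.
by case: ifP => //= _; rewrite ?negbK ?mulr0 // => /eqP ->; rewrite mulr0.
Qed.

Lemma vdm_conv_lt x a : vdm_conv x != 0 -> (x a < N + n)%N.
Proof.
case/vdm_conv_neq0 => s [/mnm_lepP le nz].
rewrite ltnNge; apply/negP => xa; case/eqP: nz; apply: (F_big (a := a)).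
rewrite mnmBE perm_expE; have := ltn_ord ((s^-1)%g a); move: xa; clear; lia.
Qed.

Lemma vdm_conv_deg : exists c : nat, forall x, vdm_conv x != 0 -> (\sum_a x a = c)%N.
Proof.
have [c Hc] := F_deg.
have key x y : vdm_conv x != 0 -> vdm_conv y != 0 -> (\sum_a x a = \sum_a y a)%N.
  have E z : vdm_conv z != 0 -> (\sum_a z a)%:R = c + stair_deg K n'.
    case/vdm_conv_neq0 => s [/mnm_lepP le /Hc <-].
    have <- : euler_deg K (perm_exp id s) = stair_deg K n' := euler_deg_perm K id s.
    rewrite /euler_deg -big_split /= natr_sum.
    by apply: eq_bigr => a _; rewrite -natrD mnmBE subnK.
  by move=> /E hx /E hy; apply/eqP; rewrite -(eqr_nat K) hx hy.
have [[x xnz]|H] := pselect (exists x, vdm_conv x != 0).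
  by exists (\sum_a x a)%N => y ynz; apply: key.
by exists 0%N => y ynz; case: H; exists y.
Qed.

Definition top_mnm : multinom n := perm_exp top_exp 1%g.

Lemma top_mnmE a : top_mnm a = top_exp a.
Proof. by rewrite perm_expE invg1 perm1. Qed.

Lemma vdm_conv_top : vdm_conv top_mnm = 1.
Proof.
rewrite /vdm_conv (bigD1 1%g) //= [X in _ + X]big1 => [|s ns].
  rewrite odd_perm1 mul1r addr0 ifT; last first.
    by apply/mnm_lepP => a; rewrite top_mnmE perm_expE invg1 perm1 leq_addl.
  rewrite -[RHS]F_top; congr (F _); apply/mnmP => a.
  by rewrite mnmBE top_mnmE perm_expE invg1 perm1 addnK multinomE tnth_mktuple.
case: ifP; rewrite ?mulr0 // => /mnm_lepP le.
have [->|nz] := eqVneq (F (mnm_sub top_mnm (perm_exp id s))) 0; first by rewrite mulr0.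
case/eqP: ns; apply/permP => b; rewrite perm1.
pose tau := (s^-1)%g.
suff tE a : tau a = a by rewrite -[in RHS](permK s b) -/tau tE.
have rN i : (mnm_sub top_mnm (perm_exp id s) i <= N)%N.
  by rewrite leqNgt; apply: contra nz => /F_big ->.
have low (i : 'I_n) : (i < m)%N -> (tau i <= i)%N.
  by move=> im; have := le i; rewrite perm_expE top_mnmE /top_exp /top_part im.
have high (i : 'I_n) : (m <= i)%N -> (i <= tau i)%N.
  move=> im; have := rN i; rewrite mnmBE perm_expE top_mnmE /top_exp /top_part.
  by rewrite ltnNge im /= -/tau; lia.
have [am|ma] := ltnP a m.
  have [k] := ubnP (a : nat); elim: k a am => [|k IH] a am; [by rewrite ltn0|rewrite ltnS => ak].
  have := low a am; rewrite leq_eqVlt => /orP[/eqP/val_inj //|ta].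
  have /perm_inj E := IH (tau a) (ltn_trans ta am) (leq_trans ta ak).
  by rewrite E ltnn in ta.
have [k] := ubnP (n - a)%N; elim: k a ma => [|k IH] a ma; [by rewrite ltn0|rewrite ltnS => ak].
have := high a ma; rewrite leq_eqVlt => /orP[/eqP E|ta]; first by apply/esym/val_inj.
have /perm_inj E : tau (tau a) = tau a.
  apply: IH; first exact: leq_trans ma (ltnW ta).
  by apply: leq_trans ak; have := ltn_ord (tau a); clear -ta; lia.
by rewrite E ltnn in ta.
Qed.

(** The exponents of an antisymmetric polynomial are distinct, and here they
    are bounded by [N + n] with prescribed sum and sum of squares, so
    [extremal_set] applies to the set of their values. *)
Lemma vdm_conv_support x : vdm_conv x != 0 -> exists s, x = perm_exp top_exp s.
Proof.
move=> xnz.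
have [c2 Hc2] := conv_deg2; have [c1 Hc1] := vdm_conv_deg.
have lnz : vdm_conv top_mnm != 0 by rewrite vdm_conv_top oner_eq0.
(* a transposition of two equal exponents fixes [x] and changes the sign of
   the coefficient *)
have xinj : injective x.
  move=> a b ab; apply/eqP/negPn/negP => ne; case/eqP: xnz.
  have := vdm_conv_perm x (tperm a b); rewrite odd_tperm ne expr1 mulN1r.
  have -> : mperm x (tperm a b) = x.
    by apply/mnmP => i; rewrite mpermE; case: tpermP => [->|->|].
  by move/eqP; rewrite -subr_eq0 opprK -mulr2n mulrn_eq0 => /eqP.
have d1 : (\sum_a x a = \sum_a top_mnm a)%N by rewrite (Hc1 _ xnz) (Hc1 _ lnz).
have d2 : (\sum_a x a ^ 2 = \sum_a top_mnm a ^ 2)%N.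
  have e2 y : euler_deg2 K y = (\sum_a \sum_(b | b != a) y a * y b)%N%:R.
    rewrite natr_sum; apply: eq_bigr => a _; rewrite natr_sum; apply: eq_bigr => b _.
    by rewrite natrM.
  have := Hc2 _ xnz; rewrite -(Hc2 _ lnz) !e2 => /eqP; rewrite eqr_nat => /eqP E.
  have := sum_offdiag_nat (fun a => x a); rewrite d1 -(sum_offdiag_nat (fun a => top_mnm a)).
  by rewrite /= E => /addnI.
have xlt a : (x a < N + n)%N by apply: vdm_conv_lt.
have llt a : (top_mnm a < N + n)%N by apply: vdm_conv_lt.
pose fx a : 'I_(N + n) := Ordinal (xlt a).
pose fl a : 'I_(N + n) := Ordinal (llt a).
have linj : injective fl.
  move=> a b /(congr1 val) /=; rewrite !top_mnmE => E.
  exact/val_inj/top_exp_inj.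
have fxinj : injective fx by move=> a b /(congr1 val) /xinj.
pose X := [set fx a | a : 'I_n]; pose L := [set fl a | a : 'I_n].
have LE : L = [set v : 'I_(N + n) | (v < m) || (N + m <= v)]%N.
  apply/setP => v; rewrite !inE; apply/imsetP/idP => [[a _ ->]|].
    rewrite /= top_mnmE /top_exp /top_part.
    by case: (ltnP a m) => am; [rewrite ?add0n am | rewrite leq_add2l am orbT].
  case/orP => [vm|mv].
    have vn : (v < n)%N by rewrite (leq_trans vm) // n_eq leq_addr.
    exists (Ordinal vn) => //; apply/val_inj.
    by rewrite /= top_mnmE /top_exp /top_part /= vm.
  have vn : (v - N < n)%N by rewrite ltn_subLR // (leq_trans _ mv) // leq_addr.
  exists (Ordinal vn) => //; apply/val_inj.
  have vmN : (m <= v - N)%N by rewrite leq_subRL // (leq_trans _ mv) // leq_addr.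
  by rewrite /= top_mnmE /top_exp /top_part /= ltnNge vmN /= subnKC // (leq_trans _ mv) // leq_addr.
have sumE (f : 'I_n -> 'I_(N + n)) (w : nat -> nat) : injective f ->
    (\sum_(v in [set f a | a : 'I_n]) w v = \sum_a w (f a))%N.
  by move=> finj; rewrite big_imset //=; move=> a b _ _; exact: finj.
have m0 : (0 < m)%N by case: (m) n_eq.
have XL : X = L.
  rewrite LE; apply: extremal_set => //; rewrite -LE.
  - by rewrite !card_imset.
  - by rewrite (sumE _ id) // (sumE _ id).
  - by rewrite (sumE _ (fun v => v ^ 2)%N) // (sumE _ (fun v => v ^ 2)%N).
have pick a : exists b, fx a == fl b.
  have : fx a \in L by rewrite -XL; apply/imsetP; exists a.
  by case/imsetP => b _ ->; exists b.
pose u a := xchoose (pick a).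
have uE a : fx a = fl (u a) by apply/eqP; exact: (xchooseP (pick a)).
have uinj : injective u by move=> a b ab; apply: fxinj; rewrite !uE ab.
exists (perm uinj)^-1%g; apply/mnmP => a.
have /(congr1 val) /= := uE a; rewrite top_mnmE => ->.
by rewrite perm_expE invgK permE.
Qed.

(** An antisymmetric function is determined by its values on a set of
    representatives, and [vdm_conv_support] leaves a single orbit. *)
Lemma vdm_conv_alternant x : vdm_conv x = mcoeff x (alternant (tvar K n') n top_exp).
Proof.
rewrite alternantE raddf_sum /=.
have top_inj s s' : perm_exp top_exp s = perm_exp top_exp s' -> s = s' :> 'S_n.
  move=> E; apply/(can_inj (@invgK _))/permP => a.
  have := congr1 (fun z : multinom n => z a) E; rewrite /= !perm_expE => E'.
  exact/val_inj/top_exp_inj.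
have [[s0 xE]|H] := pselect (exists s, x = perm_exp top_exp s).
  have -> : x = mperm top_mnm (s0^-1)%g.
    by apply/mnmP => a; rewrite xE mpermE top_mnmE perm_expE.
  rewrite vdm_conv_perm vdm_conv_top odd_permV mulr1.
  have <- : x = mperm top_mnm (s0^-1)%g.
    by apply/mnmP => a; rewrite xE mpermE top_mnmE perm_expE.
  rewrite (bigD1 s0) //= mcoeff_sign mcoeffX xE eqxx mulr1 big1 ?addr0 // => s ns.
  rewrite mcoeff_sign mcoeffX; case: eqP => [/top_inj E|]; last by rewrite mulr0.
  by rewrite E eqxx in ns.
have -> : vdm_conv x = 0.
  by apply/eqP/negPn/negP => /vdm_conv_support.
rewrite big1 // => s _; rewrite mcoeff_sign mcoeffX; case: eqP => [E|]; last by rewrite mulr0.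
by case: H; exists s.
Qed.

Definition top_row : {ffun 'I_n -> 'I_N.+1} := [ffun a : 'I_n => inord (top_part a)].

Lemma top_part_le i : (top_part i <= N)%N.
Proof. by rewrite /top_part; case: ifP. Qed.

Lemma row_entry_top i : (i < n)%N -> row_entry top_row i = top_part i.
Proof. by move=> iN; rewrite /row_entry ffunE !inordK // ltnS top_part_le. Qed.

(** The difference of the sums of two consecutive rows of a pattern. *)
Definition pattern_weight (g : {ffun 'I_n -> {ffun 'I_n -> 'I_N.+1}}) (i : nat) : nat :=
  (row_sum i.+1 (next_state g n top_row i) - row_sum i (g (inord i)))%N.

(** Symmetry, the degree bounds and the two eigenvalue conditions force the
    product of the Vandermonde polynomial with the generating polynomial of [F] to
    be the alternant of the rectangle. The Vandermonde polynomial can be cancelled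
    in the formula for this alternant. *)
Theorem rectangular_schur r :
  F r = #|[set g | chain (@row0 n' N) (@interlaces n' N) n top_row g &
                   [forall a : 'I_n, r a == pattern_weight g a]]|%:R.
Proof.
pose FP : S := \sum_(f : {ffun 'I_n -> 'I_N.+1})
   F (Multinom [tuple (f a : nat) | a < n]) *: mpolyX K (Multinom [tuple (f a : nat) | a < n]).
have FPE x : mcoeff x FP = F x.
  rewrite raddf_sum /=.
  have [/forallP small|/forallPn[a]] := boolP [forall a, (x a <= N)%N]; last first.
    rewrite -ltnNge => /[dup] xa /F_big ->; apply: big1 => f _.
    rewrite mcoeffZ mcoeffX; case: eqP => [E|]; last by rewrite mulr0.
    by move: xa; rewrite -E multinomE tnth_mktuple ltnNge -ltnS ltn_ord.
  pose f0 : {ffun 'I_n -> 'I_N.+1} := [ffun a => inord (x a)].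
  have f0E : Multinom [tuple (f0 a : nat) | a < n] = x.
    by apply/mnmP => a; rewrite multinomE tnth_mktuple ffunE inordK // ltnS.
  rewrite (bigD1 f0) //= mcoeffZ mcoeffX f0E eqxx mulr1 big1 ?addr0 // => f nf.
  rewrite mcoeffZ mcoeffX; case: eqP => [E|]; last by rewrite mulr0.
  case/eqP: nf; apply/ffunP => a; apply/val_inj.
  by rewrite ffunE -E multinomE tnth_mktuple inord_val.
have alt_eq : vdm K n' * FP = alternant (tvar K n') n top_exp.
  apply/mpolyP => x; rewrite -vdm_conv_alternant mcoeff_vdmM /vdm_conv.
  by apply: eq_bigr => s _; rewrite FPE.
have := @alternant_patterns S n' N (tvar K n') top_row.
have -> : alternant (tvar K n') n (fun i => row_entry top_row i + i)%N =
   alternant (tvar K n') n top_exp.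
  by congr (\det _); apply/matrixP => i a; rewrite !mxE row_entry_top.
rewrite -alt_eq => /(_ _) /mulfI.
have vdm_neq0 : vdm K n' != 0.
  apply/eqP => v0; have := vdm_conv_alternant top_mnm.
  by rewrite vdm_conv_top -alt_eq v0 mul0r mcoeff0 => /eqP; rewrite oner_eq0.
move=> H; rewrite -FPE (H vdm_neq0); last first.
  move=> i iN; rewrite !row_entry_top ?(ltnW iN) // /top_part.
  by case: (ltnP i.+1 m) => [/ltnW ->|] //; case: ifP.
rewrite raddf_sum /= -sum1_card natr_sum.
rewrite [RHS](eq_bigl _ _ (fun g => finset.in_set _ g)) /= [RHS]big_mkcondr /=; apply: eq_bigr => g _.
transitivity (mcoeff r (mpolyX K (Multinom [tuple pattern_weight g a | a < n]))).
  congr (mcoeff r _); rewrite mpolyXE_id; apply: eq_bigr => a _.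
  by rewrite multinomE tnth_mktuple tvarE.
rewrite mcoeffX; case: eqP => [<-|ne].
  by rewrite ifT //; apply/forallP => a; rewrite multinomE tnth_mktuple.
rewrite ifF //; apply/negbTE; apply/negP => /forallP E; case: ne.
by apply/mnmP => a; rewrite multinomE tnth_mktuple; apply/esym/eqP.
Qed.
End RectangularSchur.

(** * Secular polynomials *)

Section MatrixLemmas.

Lemma derivation_det (R : comNzRingType) (D : R -> R) N (A : 'M[R]_N) :
  derivation D -> D (\det A) = \tr (map_mx D A *m \adj A).
Proof.
move=> HD; have D0 : D 0 = 0.
  by have := HD.1 0 0; rewrite addr0 -{1}[D 0]addr0 => /addrI.
have Dsign (e : bool) x : D ((-1) ^+ e * x) = (-1) ^+ e * D x.
  case: e; rewrite ?mul1r // !mulN1r; apply/eqP; rewrite -addr_eq0 -HD.1 addNr.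
  by rewrite D0.
rewrite /mxtrace {1}/determinant derivation_sum //.
under eq_bigr do rewrite Dsign derivation_prod // mulr_sumr.
rewrite exchange_big; apply: eq_bigr => i _.
pose B : 'M[R]_N := \matrix_(i', j) (if i' == i then D (A i j) else A i' j).
transitivity (\det B).
  apply: eq_bigr => s _; congr (_ * _); rewrite [RHS](bigD1 i) //= mxE eqxx; congr (_ * _).
  by apply: eq_bigr => j /negPf ji; rewrite mxE ji.
rewrite (expand_det_row _ i) mxE; apply: eq_bigr => j _.
rewrite !mxE eqxx; congr (_ * _); rewrite /cofactor; congr (_ * \det _).
by apply/matrixP => k l; rewrite !mxE eq_sym (negPf (neq_lift _ _)).
Qed.

(** The matrix determinant lemma, with the adjugate in place of the inverse:
    the two triangular reductions of one block matrix give two expressions of its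
    determinant, and [\det B] cancels. *)
Lemma det_rank_one (R : idomainType) N (B : 'M[R]_N) (x : 'cV[R]_N) (y : 'rV[R]_N) :
  \det B != 0 -> \det (B + x *m y) = \det B + (y *m \adj B *m x) 0 0.
Proof.
move=> dB; pose M : 'M[R]_(N + 1) := block_mx B (- x) y 1%:M.
have e1 : \det M = \det (B + x *m y).
  have := det_mulmx M (block_mx 1%:M 0 (- y) 1%:M).
  rewrite det_lblock !det1 !mulr1 => <-.
  rewrite mulmx_block !mulmx1 !mulmx0 !add0r ?mul1mx mulNmx mulmxN opprK subrr.
  by rewrite det_ublock det1 mulr1.
have := det_mulmx M (block_mx 1%:M (\adj B *m x) 0 (\det B)%:M).
rewrite det_ublock det1 mul1r det_scalar1.
rewrite mulmx_block !mulmx1 !mulmx0 !addr0 !mulmxA mul_mx_adj mulNmx.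
rewrite mul_scalar_mx mul_mx_scalar subrr det_lblock mul1mx.
rewrite -e1 [\det M * _]mulrC => /(mulfI dB) <-.
by rewrite [_ + _%:M]mx11_scalar det_scalar1 !mxE eqxx mulr1n addrC.
Qed.

(** The relation for [A] says that it is [p * x V / (1 + x V)], and likewise
    for [B]; in this form the identity is a partial fraction decomposition of the
    product. The relations replace the quotients, so that no inverse is required.
    *)
Lemma trace_resolvent_product (R : comNzRingType) N (x y p q : R) (A B V : 'M[R]_N) :
  A = x *: (V *m (p%:M - A)) -> B = y *: (V *m (q%:M - B)) ->
  A *m V = V *m A ->
  (x - y) * \tr (A *m B) = x * p * \tr B - y * q * \tr A.
Proof.
move=> eA eB AV.
have trA : x * \tr (V *m A) = x * p * \tr V - \tr A.
  rewrite [X in _ - \tr X]eA mxtraceZ mulmxBr mul_mx_scalar raddfB /= mxtraceZ; ring.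
have trB : y * \tr (V *m B) = y * q * \tr V - \tr B.
  rewrite [X in _ - \tr X]eB mxtraceZ mulmxBr mul_mx_scalar raddfB /= mxtraceZ; ring.
have e1 : \tr (A *m B) = y * (q * \tr (V *m A) - \tr (V *m A *m B)).
  rewrite {1}eB -scalemxAr mxtraceZ mulmxBr mulmxBr mul_mx_scalar -scalemxAr AV.
  by rewrite raddfB /= mxtraceZ mulmxA AV.
have e2 : \tr (A *m B) = x * (p * \tr (V *m B) - \tr (V *m A *m B)).
  rewrite {1}eA -scalemxAl mxtraceZ mulmxBr mulmxBl mul_mx_scalar -scalemxAl.
  by rewrite raddfB /= mxtraceZ.
rewrite mulrBl {1}e1 e2.
have -> : x * (y * (q * \tr (V *m A) - \tr (V *m A *m B))) -
   y * (x * (p * \tr (V *m B) - \tr (V *m A *m B))) =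
   y * q * (x * \tr (V *m A)) - x * p * (y * \tr (V *m B)) by ring.
rewrite trA trB; ring.
Qed.

End MatrixLemmas.

Section SecularPolynomial.
Variables (K : numFieldType) (N : nat).
Implicit Types (U : 'M[K]_N).

Definition scaled_mx U : 'M[{poly K}]_N := 'X *: map_mx polyC U.
(** The generating polynomial of the elementary symmetric functions of the
    eigenvalues of [U]. *)
Definition secular U : {poly K} := \det (1%:M + scaled_mx U).
(** [X U (1 + X U)^-1] multiplied by the secular polynomial. By
    [secular_rank_one] its quadratic forms are the first variations of the secular
    polynomial under rank one perturbations, and its trace gives Newton's
    identities. *)
Definition newton_mx U : 'M[{poly K}]_N := scaled_mx U *m \adj (1%:M + scaled_mx U).

Lemma adj_newton U : \adj (1%:M + scaled_mx U) = (secular U)%:M - newton_mx U.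
Proof.
have := mul_mx_adj (1%:M + scaled_mx U); rewrite mulmxDl mul1mx => <-.
by rewrite addrK.
Qed.

Lemma newton_mxE U :
  newton_mx U = 'X *: (map_mx polyC U *m ((secular U)%:M - newton_mx U)).
Proof. by rewrite -adj_newton scalemxAl. Qed.

Lemma newton_mx_comm U : newton_mx U *m map_mx polyC U = map_mx polyC U *m newton_mx U.
Proof.
have e : \adj (1%:M + scaled_mx U) *m scaled_mx U = newton_mx U.
  have := mul_adj_mx (1%:M + scaled_mx U); rewrite mulmxDr mulmx1 => e.
  by apply: (addrI (\adj (1%:M + scaled_mx U))); rewrite e adj_newton subrK.
(* the commutation is clear after multiplication by ['X], which is not a zero
   divisor *)
have E : 'X *: (newton_mx U *m map_mx polyC U) = 'X *: (map_mx polyC U *m newton_mx U).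
  by rewrite scalemxAr scalemxAl -/(scaled_mx U) {1}/newton_mx -mulmxA e.
apply/matrixP => i j; move/matrixP/(_ i j): E; rewrite !mxE => /mulfI; apply.
by rewrite polyX_eq0.
Qed.

Lemma derivation_Xderiv : derivation (fun p : {poly K} => 'X * p^`()).
Proof. by split=> p q; rewrite ?derivD ?derivM; ring. Qed.

(** The derivative of a determinant, applied to [1 + X U]. *)
Lemma tr_newton_mx U : \tr (newton_mx U) = 'X * (secular U)^`().
Proof.
rewrite /secular (derivation_det _ derivation_Xderiv); congr (\tr (_ *m _)).
apply/matrixP => i j; rewrite !mxE derivD derivM derivX derivC.
by rewrite mulr0 addr0 mul1r; case: eqP => _; rewrite ?derivC ?deriv1 ?deriv0 add0r.
Qed.

Lemma secular0 U : (secular U).[0] = 1.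
Proof.
rewrite /secular -horner_evalE -det_map_mx -[RHS](det1 K N); congr (\det _).
apply/matrixP => i j; rewrite !mxE /= horner_evalE hornerD hornerM hornerX mul0r addr0.
by case: eqP; rewrite hornerE.
Qed.

Lemma secular_neq0 U : secular U != 0.
Proof. by apply/eqP => E; have := secular0 U; rewrite E horner0 => /eqP; rewrite eq_sym oner_eq0. Qed.

(** [det_rank_one] applied to [1 + X U]: the reflected matrix differs from [U]
    by a matrix of rank one. *)
Lemma secular_rank_one U (w : K) (v : 'cV[K]_N) (u : 'rV[K]_N) :
  secular ((1%:M + w *: (v *m u)) *m U) =
  secular U + w *: (map_mx polyC u *m newton_mx U *m map_mx polyC v) 0 0.
Proof.
rewrite {1}/secular.
have -> : 1%:M + scaled_mx ((1%:M + w *: (v *m u)) *m U) =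
   (1%:M + scaled_mx U) + (w%:P *: map_mx polyC v) *m (map_mx polyC u *m scaled_mx U).
  rewrite -addrA; congr (_ + _).
  rewrite /scaled_mx mulmxDl mul1mx raddfD /= scalerDr; congr (_ + _).
  rewrite -!scalemxAl map_mxZ !map_mxM /= -!scalemxAr !scalerA mulrC mulmxA //.
rewrite det_rank_one ?secular_neq0 // mulmxA; congr (_ + _).
by rewrite /newton_mx -scalemxAr [LHS]mxE mul_polyC.
Qed.

Lemma size_secular U : (size (secular U) <= N.+1)%N.
Proof.
rewrite /secular /determinant.
apply: leq_trans (size_sum _ _ _) _; apply/bigmax_leqP => s _.
rewrite size_Msign; apply: leq_trans (size_poly_prod_leq _ _) _.
rewrite leq_subLR card_ord addnS ltnS.
have -> : (N + N = \sum_(i < N) 2)%N by rewrite sum_nat_const card_ord; lia.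
apply: leq_sum => i _; rewrite !mxE.
apply: leq_trans (size_polyD _ _) _; rewrite geq_max; apply/andP; split.
  by case: eqP => _; rewrite ?size_poly1 ?size_poly0.
apply: leq_trans (size_polyMleq _ _) _; rewrite size_polyX /=.
exact: size_polyC_leq1.
Qed.

Lemma secular_lead U : (secular U)`_N = \det U.
Proof.
rewrite /secular /determinant coef_sum; apply: eq_bigr => s _.
have -> p : ((-1) ^+ s * p : {poly K})`_N = (-1) ^+ s * p`_N.
  by case: (odd_perm s); rewrite ?mul1r // !mulN1r coefN.
congr (_ * _).
have E : forall k (f g : 'I_k -> K), (\prod_(i < k) ((g i)%:P + 'X * (f i)%:P))`_k = \prod_(i < k) f i.
  elim=> [|k IH] f g; first by rewrite !big_ord0 coef1.
  rewrite !big_ord_recr /= mulrDr coefD coefMC mulrA coefMC coefMX /= IH.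
  rewrite nth_default ?mul0r ?add0r //.
  apply: leq_trans (size_poly_prod_leq _ _) _.
  rewrite leq_subLR card_ord addnS ltnS.
  have -> : (k + k = \sum_(i < k) 2)%N by rewrite sum_nat_const card_ord; lia.
  apply: leq_sum => i _.
  apply: leq_trans (size_polyD _ _) _; rewrite geq_max (leq_trans (size_polyC_leq1 _)) //=.
  apply: leq_trans (size_polyMleq _ _) _; rewrite size_polyX /=.
  exact: size_polyC_leq1.
transitivity ((\prod_(i < N) ((i == s i)%:R%:P + 'X * (U i (s i))%:P))`_N); last exact: E.
congr (nth 0 (polyseq _) N).
by apply: eq_bigr => i _; rewrite !mxE polyCMn polyC1.
Qed.

End SecularPolynomial.

(** * Bounded continuous functions on the unitary group *)

Section NiceFunctions.
Local Open Scope classical_set_scope.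
Variables (R : realType) (N : nat).
Local Notation UN := (unitary_group R N).
Local Notation C := R[i].

Definition bounded_continuous (f : UN -> R) :=
  continuous f /\ exists M, forall U, `|f U| <= M.

Lemma bounded_continuous_cst c : bounded_continuous (fun=> c).
Proof. by split; [exact: cst_continuous | exists `|c|]. Qed.

Lemma bounded_continuousD f g : bounded_continuous f -> bounded_continuous g ->
  bounded_continuous (fun U => f U + g U).
Proof.
move=> [cf [Mf bf]] [cg [Mg bg]]; split.
  by move=> U; apply: continuousD; [exact: cf | exact: cg].
by exists (Mf + Mg) => U; rewrite (le_trans (ler_normD _ _)) // lerD.
Qed.

Lemma bounded_continuousN f : bounded_continuous f -> bounded_continuous (fun U => - f U).
Proof.
move=> [cf [Mf bf]]; split; first by move=> U; apply: continuousN; exact: cf.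
by exists Mf => U; rewrite normrN.
Qed.

Lemma bounded_continuousM f g : bounded_continuous f -> bounded_continuous g ->
  bounded_continuous (fun U => f U * g U).
Proof.
move=> [cf [Mf bf]] [cg [Mg bg]]; split.
  by move=> U; apply: continuousM; [exact: cf | exact: cg].
by exists (Mf * Mg) => U; rewrite normrM ler_pM.
Qed.

(** The real and imaginary parts are treated separately because the
    expectation of a complex function is defined through them. *)
Definition nice (f : UN -> C) :=
  bounded_continuous (fun U => complex.Re (f U)) /\
  bounded_continuous (fun U => complex.Im (f U)).

Lemma nice_ext f g : f =1 g -> nice f -> nice g.
Proof. by move=> /funext ->. Qed.

Lemma nice_cst c : nice (fun=> c).
Proof. by split; exact: bounded_continuous_cst. Qed.

Lemma niceD f g : nice f -> nice g -> nice (fun U => f U + g U).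
Proof.
move=> [rf jf] [rg jg]; split.
  have := bounded_continuousD rf rg; congr bounded_continuous; apply/funext => U.
  by case: (f U); case: (g U).
have := bounded_continuousD jf jg; congr bounded_continuous; apply/funext => U.
by case: (f U); case: (g U).
Qed.

Lemma niceM f g : nice f -> nice g -> nice (fun U => f U * g U).
Proof.
move=> [rf jf] [rg jg]; split.
  have := bounded_continuousD (bounded_continuousM rf rg)
    (bounded_continuousN (bounded_continuousM jf jg)).
  by congr bounded_continuous; apply/funext => U; case: (f U); case: (g U).
have := bounded_continuousD (bounded_continuousM rf jg) (bounded_continuousM jf rg).
by congr bounded_continuous; apply/funext => U; case: (f U); case: (g U).
Qed.

Lemma nice_conj f : nice f -> nice (fun U => (f U)^*).
Proof.
move=> [rf jf]; split.
  by move: rf; congr bounded_continuous; apply/funext => U; case: (f U).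
have := bounded_continuousN jf.
by congr bounded_continuous; apply/funext => U; case: (f U).
Qed.

Lemma nice_sum (I : Type) (r : seq I) (P : pred I) (F : I -> UN -> C) :
  (forall i, nice (F i)) -> nice (fun U => \sum_(i <- r | P i) F i U).
Proof.
move=> nF; elim: r => [|i r IH].
  by apply: nice_ext (nice_cst 0) => U; rewrite big_nil.
case Pi : (P i); last by apply: nice_ext IH => U; rewrite big_cons Pi.
by apply: nice_ext (niceD (nF i) IH) => U; rewrite big_cons Pi.
Qed.

Lemma nice_prod (I : Type) (r : seq I) (P : pred I) (F : I -> UN -> C) :
  (forall i, nice (F i)) -> nice (fun U => \prod_(i <- r | P i) F i U).
Proof.
move=> nF; elim: r => [|i r IH].
  by apply: nice_ext (nice_cst 1) => U; rewrite big_nil.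
case Pi : (P i); last by apply: nice_ext IH => U; rewrite big_cons Pi.
by apply: nice_ext (niceM (nF i) IH) => U; rewrite big_cons Pi.
Qed.

Lemma niceX f k : nice f -> nice (fun U => f U ^+ k).
Proof.
move=> nf; elim: k => [|k IH]; first exact: nice_ext (nice_cst 1).
by apply: nice_ext (niceM nf IH) => U; rewrite exprS.
Qed.

(** The squared moduli of the entries of a row add up to one. *)
Lemma unitary_entry_le1 (U : UN) i j : `|val U i j| <= 1.
Proof.
have /unitarymxP /matrixP/(_ i i) := valP U; rewrite !mxE eqxx => E.
have : `|val U i j| ^+ 2 <= 1.
  rewrite -[leRHS]E (bigD1 j) //= !mxE -normCK lerDl.
  by apply: sumr_ge0 => k _; rewrite !mxE -normCK exprn_ge0.
by rewrite -[leRHS](expr1n _ 2) ler_sqr ?nnegrE.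
Qed.

Lemma nice_entry i j : nice (fun U : UN => val U i j).
Proof.
have cre : continuous (@re_im R N) by exact: initial_continuous.
have bnd (U : UN) : `|complex.Re (val U i j)| <= 1 /\ `|complex.Im (val U i j)| <= 1.
  have := unitary_entry_le1 U i j; case: (val U i j) => x y.
  rewrite normc_def lecR /= => h.
  have h2 : x ^+ 2 + y ^+ 2 <= 1.
    by rewrite -[leLHS]sqr_sqrtr ?addr_ge0 ?sqr_ge0 // expr_le1 // sqrtr_ge0.
  have [x0 y0] := (sqr_ge0 x, sqr_ge0 y).
  split; rewrite -[leRHS](expr1n _ 2) -ler_sqr ?nnegrE // ?real_normK ?num_real; nra.
split; split; [|by exists 1 => U; case: (bnd U)| |by exists 1 => U; case: (bnd U)].
- have -> : (fun U : UN => complex.Re (val U i j)) =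
      (fun M : 'M[R]_N => M i j) \o (fst \o @re_im R N).
    by apply/funext => U; rewrite /= mxE.
  move=> U; apply: continuous_comp; last exact: coord_continuous.
  by apply: continuous_comp; [exact: cre | exact: cvg_fst].
- have -> : (fun U : UN => complex.Im (val U i j)) =
      (fun M : 'M[R]_N => M i j) \o (snd \o @re_im R N).
    by apply/funext => U; rewrite /= mxE.
  move=> U; apply: continuous_comp; last exact: coord_continuous.
  by apply: continuous_comp; [exact: cre | exact: cvg_snd].
Qed.

Lemma unitary_mul_continuous (V : UN) : continuous (unitary_mul V).
Proof.
have ent i j : nice (fun U => val (unitary_mul V U) i j).
  apply: nice_ext (nice_sum (index_enum 'I_N) predT
    (F := fun k U => val V i k * val U k j) _) => [U|k].
    by rewrite /= mxE.
  by apply: niceM; [exact: nice_cst | exact: nice_entry].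
have mxc (f : UN -> 'M[R]_N) : (forall i j, continuous (fun U => f U i j)) -> continuous f.
  move=> cf U A [P nP sPA].
  have : nbhs U [set U' | forall i j, P i j (f U' i j)].
    have FU : Filter (nbhs U) by exact: nbhs_filter.
    have H1 i := @filter_forall UN 'I_N (fun j U' => P i j (f U' i j)) (nbhs U) FU
      (fun j => cf i j U _ (nP i j)).
    exact: (@filter_forall UN 'I_N (fun i U' => forall j, P i j (f U' i j)) (nbhs U) FU H1).
  by apply: filterS => U' PU'; apply: sPA => i j; exact: PU'.
have c1 : continuous (@re_im R N \o unitary_mul V).
  have cf : continuous (fun U => map_mx (@complex.Re R) (val (unitary_mul V U))).
    apply: mxc => i j.
    have [[h _] _] := ent i j.
    rewrite (_ : (fun U => _) = (fun U => complex.Re (val (unitary_mul V U) i j))) //.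
    by apply/funext => U'; rewrite mxE.
  have cg : continuous (fun U => map_mx (@complex.Im R) (val (unitary_mul V U))).
    apply: mxc => i j.
    have [_ [h _]] := ent i j.
    rewrite (_ : (fun U => _) = (fun U => complex.Im (val (unitary_mul V U) i j))) //.
    by apply/funext => U'; rewrite mxE.
  by move=> U; exact: (cvg_pair (cf U) (cg U)).
apply/continuousP => A [B oB <-].
have /continuousP/(_ _ oB) := c1; congr open.
Qed.

End NiceFunctions.

(** * Haar expectation *)

Section HaarExpectation.
Local Open Scope classical_set_scope.
Variables (R : realType) (N : nat) (mu : probability (borel_unitary R N) R).
Local Notation UN := (unitary_group R N).
Local Notation BN := (borel_unitary R N).
Local Notation C := R[i].

Lemma borel_measurable (f : UN -> R) : continuous f ->
  measurable_fun setT (f : BN -> R).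
Proof.
move=> /continuousP cf; apply: (measurability _ (measurable_realfun.RGenOpens.measurableE R)).
move=> _ [_ [a [b ->] <-]]; rewrite setTI.
by apply: sub_sigma_algebra; exact/cf/interval_open.
Qed.

Lemma bounded_continuous_integrable f : bounded_continuous f ->
  mu.-integrable setT (EFin \o (f : BN -> R)).
Proof.
move=> [cf [M bM]]; apply: measurable_bounded_integrable => //.
- by apply: (@le_lt_trans _ _ 1%E); [exact: probability_le1 | rewrite ltry].
- exact: borel_measurable.
- exists M; split; first exact: num_real.
  by move=> M' MM' U _ /=; rewrite (le_trans (bM U)) // ltW.
Qed.

Definition expect (f : UN -> R) : R := \int[mu]_U f U.

Lemma expectD f g : bounded_continuous f -> bounded_continuous g ->
  expect (fun U => f U + g U) = expect f + expect g.
Proof.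
by move=> nf ng; apply: RintegralD => //; exact: bounded_continuous_integrable.
Qed.

Lemma expectZ c f : bounded_continuous f -> expect (fun U => c * f U) = c * expect f.
Proof.
by move=> nf; apply: RintegralZl => //; exact: bounded_continuous_integrable.
Qed.

Lemma expect_cst c : expect (fun=> c) = c.
Proof. rewrite /expect Rintegral_cst //. by rewrite [X in fine X]probability_setT mulr1. Qed.

(** The expectation of a complex function, integrated part by part. *)
Definition cexpect (f : UN -> C) : C :=
  ((expect (fun U => complex.Re (f U))) +i* (expect (fun U => complex.Im (f U))))%C.

Lemma cexpect_ext f g : f =1 g -> cexpect f = cexpect g.
Proof. by move=> /funext ->. Qed.

Lemma cexpectD f g : nice f -> nice g ->
  cexpect (fun U => f U + g U) = cexpect f + cexpect g.
Proof.
move=> [rf jf] [rg jg]; rewrite /cexpect.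
have -> : (fun U => complex.Re (f U + g U)) = (fun U => complex.Re (f U) + complex.Re (g U)).
  by apply/funext => U; case: (f U); case: (g U).
have -> : (fun U => complex.Im (f U + g U)) = (fun U => complex.Im (f U) + complex.Im (g U)).
  by apply/funext => U; case: (f U); case: (g U).
by rewrite !expectD.
Qed.

Lemma cexpectZ c f : nice f -> cexpect (fun U => c * f U) = c * cexpect f.
Proof.
move=> [rf jf]; rewrite /cexpect; case: c => x y.
have bZ z g : bounded_continuous g -> bounded_continuous (fun U => z * g U).
  by apply: bounded_continuousM; exact: bounded_continuous_cst.
have -> : (fun U => complex.Re ((x +i* y)%C * f U)) =
    (fun U => x * complex.Re (f U) + - y * complex.Im (f U)).
  by apply/funext => U; case: (f U) => a b /=; rewrite mulNr.
have -> : (fun U => complex.Im ((x +i* y)%C * f U)) =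
    (fun U => x * complex.Im (f U) + y * complex.Re (f U)).
  by apply/funext => U; case: (f U) => a b /=.
rewrite !expectD ?expectZ //; try exact: bZ.
by apply/eqP; rewrite eq_complex /= mulNr !eqxx.
Qed.

Lemma cexpect_cst c : cexpect (fun=> c) = c.
Proof. by rewrite /cexpect !expect_cst; case: c. Qed.

Lemma cexpect_sum (I : Type) (r : seq I) (P : pred I) (F : I -> UN -> C) :
  (forall i, nice (F i)) ->
  cexpect (fun U => \sum_(i <- r | P i) F i U) = \sum_(i <- r | P i) cexpect (F i).
Proof.
move=> nF; elim: r => [|i r IH].
  by rewrite big_nil -[RHS](cexpect_cst 0); apply: cexpect_ext => U; rewrite big_nil.
rewrite big_cons; case Pi : (P i); last first.
  by rewrite -IH; apply: cexpect_ext => U; rewrite big_cons Pi.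
rewrite -IH -cexpectD //; last exact: nice_sum.
by apply: cexpect_ext => U; rewrite big_cons Pi.
Qed.

Hypothesis haar : is_haar mu.

(** The change of variables formula for the push-forward under a translation,
    which preserves the measure of all Borel sets. *)
Lemma expect_translate V f : bounded_continuous f ->
  expect (fun U => f (unitary_mul V U)) = expect f.
Proof.
move=> bf.
have mV : measurable_fun [set: BN] (unitary_mul V : BN -> BN).
  apply: (@measurability _ _ BN BN setT (unitary_mul V : BN -> BN) (@open UN)); first by [].
  move=> _ [A oA <-]; rewrite setTI; apply: sub_sigma_algebra.
  by have /continuousP/(_ _ oA) := @unitary_mul_continuous R N V.
have bfV : bounded_continuous (fun U => f (unitary_mul V U)).
  case: bf => cf [M bM]; split; last by exists M.
  by move=> U; apply: continuous_comp; [exact: unitary_mul_continuous | exact: cf].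
have /measurable_realfun.measurable_EFinP mf := borel_measurable bf.1.
have := integral_pushforward mV mf (bounded_continuous_integrable bfV) measurableT.
rewrite preimage_setT /expect /Rintegral => <-; congr fine.
by apply: eq_measure_integral => A mA _; exact: haar.
Qed.

Lemma cexpect_translate V f : nice f ->
  cexpect (fun U => f (unitary_mul V U)) = cexpect f.
Proof.
move=> [rf jf]; rewrite /cexpect.
by rewrite (expect_translate V rf) (expect_translate V jf).
Qed.

End HaarExpectation.

(** * Polynomials with random coefficients *)

Section NicePolynomials.
Variables (R : realType) (N : nat).
Local Notation UN := (unitary_group R N).
Local Notation C := R[i].

(** Polynomial identities between random quantities are integrated coefficient
    by coefficient. *)
Definition nice_poly (p : UN -> {poly C}) := forall k, nice (fun U => (p U)`_k).

Lemma nice_poly_cst p : nice_poly (fun=> p).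
Proof. by move=> k; exact: nice_cst. Qed.

Lemma nice_polyD p q : nice_poly p -> nice_poly q -> nice_poly (fun U => p U + q U).
Proof. by move=> np nq k; apply: nice_ext (niceD (np k) (nq k)) => U; rewrite coefD. Qed.

Lemma nice_polyM p q : nice_poly p -> nice_poly q -> nice_poly (fun U => p U * q U).
Proof.
move=> np nq k; apply: nice_ext (nice_sum (index_enum 'I_k.+1) predT
  (F := fun (j : 'I_k.+1) U => (p U)`_j * (q U)`_(k - j)) _) => [U|j].
  by rewrite coefM.
exact: niceM.
Qed.

Lemma nice_poly_ext p q : p =1 q -> nice_poly p -> nice_poly q.
Proof. by move=> /funext ->. Qed.

Lemma nice_poly_sum (I : Type) (r : seq I) (P : pred I) (F : I -> UN -> {poly C}) :
  (forall i, nice_poly (F i)) -> nice_poly (fun U => \sum_(i <- r | P i) F i U).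
Proof.
move=> nF; elim: r => [|i r IH].
  by apply: nice_poly_ext (nice_poly_cst 0) => U; rewrite big_nil.
case Pi : (P i); last by apply: nice_poly_ext IH => U; rewrite big_cons Pi.
by apply: nice_poly_ext (nice_polyD (nF i) IH) => U; rewrite big_cons Pi.
Qed.

Lemma nice_poly_prod (I : Type) (r : seq I) (P : pred I) (F : I -> UN -> {poly C}) :
  (forall i, nice_poly (F i)) -> nice_poly (fun U => \prod_(i <- r | P i) F i U).
Proof.
move=> nF; elim: r => [|i r IH].
  by apply: nice_poly_ext (nice_poly_cst 1) => U; rewrite big_nil.
case Pi : (P i); last by apply: nice_poly_ext IH => U; rewrite big_cons Pi.
by apply: nice_poly_ext (nice_polyM (nF i) IH) => U; rewrite big_cons Pi.
Qed.

Lemma nice_poly_det m (A : UN -> 'M[{poly C}]_m) :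
  (forall i j, nice_poly (fun U => A U i j)) -> nice_poly (fun U => \det (A U)).
Proof.
move=> nA; apply: nice_poly_sum => s; apply: nice_polyM; first exact: nice_poly_cst.
by apply: nice_poly_prod => i; exact: nA.
Qed.

Lemma nice_poly_secular_mx i j :
  nice_poly (fun U : UN => (1%:M + scaled_mx (val U)) i j).
Proof.
apply: nice_poly_ext (nice_polyD (nice_poly_cst (1%:M i j))
  (nice_polyM (nice_poly_cst 'X) (q := fun U => (val U i j)%:P) _)) => [U|k].
  by rewrite !mxE.
apply: (@nice_ext R N (fun U => val U i j * (k == 0%N)%:R)) => [U|]; last first.
  by apply: niceM; [exact: nice_entry | exact: nice_cst].
by rewrite coefC; case: eqP; rewrite ?mulr1 ?mulr0.
Qed.

Lemma nice_poly_secular : nice_poly (fun U : UN => secular (val U)).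
Proof. by apply: nice_poly_det => i j; exact: nice_poly_secular_mx. Qed.

Lemma nice_poly_newton i j : nice_poly (fun U : UN => newton_mx (val U) i j).
Proof.
apply: nice_poly_ext (nice_polyD (q := fun U => - \adj (1%:M + scaled_mx (val U)) i j)
   (nice_polyM nice_poly_secular (nice_poly_cst (i == j)%:R)) _) => [U|].
  have : newton_mx (val U) = (secular (val U))%:M - \adj (1%:M + scaled_mx (val U)).
    by rewrite adj_newton opprB addrC subrK.
  by move/matrixP/(_ i j) ->; rewrite !mxE mulr_natr.
apply: nice_poly_ext (nice_polyM (nice_poly_cst (- (-1) ^+ (j + i)))
  (nice_poly_det (A := fun U => row' j (col' i (1%:M + scaled_mx (val U)))) _)) => [U|k l].
  by rewrite !mxE /cofactor mulNr.
apply: nice_poly_ext (nice_poly_secular_mx (lift j k) (lift i l)) => U.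
by rewrite !mxE.
Qed.

Lemma nice_det : nice (fun U : UN => \det (val U)).
Proof. by apply: nice_ext (nice_poly_secular N) => U; rewrite secular_lead. Qed.

End NicePolynomials.

Section LinearFactors.
Variables (K : numFieldType) (I : finType) (e y : I -> K).
Local Notation lin a := ((e a)%:P + y a *: 'X).

Lemma derivation_deriv : derivation (fun p : {poly K} => p^`()).
Proof. by split=> p q; rewrite ?derivD ?derivM. Qed.

Lemma coef1_prod_linear :
  (\prod_a lin a)`_1 = \sum_a y a * \prod_(b | b != a) e b.
Proof.
transitivity ((\prod_a lin a)^`().[0]); first by rewrite horner_coef0 coef_deriv mulr1n.
rewrite (derivation_prod _ _ derivation_deriv) horner_sum; apply: eq_bigr => a _.
rewrite hornerM derivD derivC derivZ derivX add0r alg_polyC hornerC horner_prod.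
by congr (_ * _); apply: eq_bigr => b _; rewrite !hornerE.
Qed.

(** The second derivative at the origin; the doubling avoids a sum over
    unordered pairs. *)
Lemma coef2_prod_linear :
  (\prod_a lin a)`_2 *+ 2 =
  \sum_a \sum_(b | b != a) y a * y b * \prod_(c | (c != a) && (c != b)) e c.
Proof.
transitivity ((\prod_a lin a)^`()^`().[0]).
  by rewrite horner_coef0 !coef_deriv mulr1n.
have dl a : (lin a)^`() = (y a)%:P by rewrite derivD derivC derivZ derivX add0r alg_polyC.
rewrite (derivation_prod _ _ derivation_deriv) (derivation_sum _ _ _ derivation_deriv).
rewrite horner_sum; apply: eq_bigr => a _.
rewrite dl derivM derivC mul0r add0r (derivation_prod _ _ derivation_deriv).
rewrite hornerM hornerC horner_sum mulr_sumr; apply: eq_bigr => b _.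
rewrite dl hornerM hornerC horner_prod mulrA; congr (_ * _).
by apply: eq_bigr => c _; rewrite !hornerE.
Qed.

End LinearFactors.

(** * Reflections *)

Section Reflections.
Variables (R : realType) (N : nat).
Local Notation UN := (unitary_group R N).
Local Notation C := R[i].
Local Notation "M ^t*" := (map_mx Num.conj (M^T)) (at level 30).

(** The reflection acts on the line of [v] as multiplication by [1 + w] and
    trivially on its orthogonal complement. *)
Lemma reflection_unitary (w : C) (v : 'cV[C]_N) :
  (v ^t* *m v) 0 0 = 1 -> `|1 + w| = 1 -> (1%:M + w *: (v *m v ^t*)) \is unitarymx.
Proof.
move=> v1 w1; apply/unitarymxP.
have vv : v ^t* *m v = 1%:M by rewrite [LHS]mx11_scalar v1.
have -> : (1%:M + w *: (v *m v ^t*)) ^t* = 1%:M + w^* *: (v *m v ^t*).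
  rewrite linearD /= map_mxD trmx1 map_mx1; congr (_ + _).
  rewrite linearZ /= map_mxZ; congr (_ *: _); rewrite trmx_mul map_mxM.
  congr (_ *m _); apply/matrixP => i j; rewrite !mxE; exact: conjCK.
rewrite mulmxDl mul1mx mulmxDr mulmx1 -scalemxAl -scalemxAr mulmxA -[v *m _ *m v]mulmxA vv mulmx1.
rewrite scalerA addrACA -[RHS]addr0 -addrA; congr (_ + _).
have : (1 + w) * (1 + w)^* = 1 by rewrite -normCK w1 expr1n.
rewrite rmorphD rmorph1 mulrDl mul1r mulrDr mulr1 -addrA => /(congr1 (fun z => z - 1)).
rewrite addrAC subrr add0r => E.
by rewrite -!scalerDl addrCA E scale0r.
Qed.

Lemma det_reflection (w : C) (v : 'cV[C]_N) :
  (v ^t* *m v) 0 0 = 1 -> \det (1%:M + w *: (v *m v ^t*)) = 1 + w.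
Proof.
move=> v1; rewrite scalemxAl det_rank_one ?det1 ?oner_eq0 //; congr (_ + _).
have := mul_mx_adj (1%:M : 'M[C]_N); rewrite mul1mx det1 => ->.
by rewrite mulmx1 -scalemxAr mxE v1 mulr1.
Qed.

(** The Cayley parametrisation: adding one gives [(k + 'i) / (k - 'i)]. *)
Definition unit_circle_shift (k : nat) : C := (2%:R * 'i) / (k%:R - 'i).

Lemma natr_subi_neq0 k : k%:R - 'i != 0 :> C.
Proof.
rewrite subr_eq0; apply/eqP => E.
have := sqrCi C; rewrite -E -natrX => /eqP.
by rewrite -addr_eq0 natr1 pnatr_eq0.
Qed.

Lemma unit_circle_shift_norm k : `|1 + unit_circle_shift k| = 1.
Proof.
have nz := natr_subi_neq0 k.
have -> : 1 + unit_circle_shift k = (k%:R - 'i)^* / (k%:R - 'i).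
  rewrite /unit_circle_shift -{1}(divff nz) -mulrDl; congr (_ / _).
  by rewrite rmorphB /= conjCi rmorph_nat opprK mulr_natl mulr2n; ring.
by rewrite normf_div norm_conjC divff // normr_eq0.
Qed.

Lemma unit_circle_shift_inj : injective unit_circle_shift.
Proof.
move=> k l; rewrite /unit_circle_shift => /mulfI H.
have /H/invr_inj/addIr/eqP : 2%:R * 'i != 0 :> C by rewrite mulf_neq0 ?neq0Ci ?pnatr_eq0.
by rewrite eqr_nat => /eqP.
Qed.

Lemma nice_translate (V : UN) f : nice f -> nice (fun U => f (unitary_mul V U)).
Proof.
have bc g : bounded_continuous g -> bounded_continuous (fun U => g (unitary_mul V U)).
  move=> [cg [M bM]]; split; last by exists M.
  by move=> U; apply: continuous_comp; [exact: unitary_mul_continuous | exact: cg].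
by move=> [rf jf]; split; [exact: (bc _ rf) | exact: (bc _ jf)].
Qed.

(** The circle contains infinitely many points; those given by the Cayley
    parametrisation at the integers suffice. *)
Lemma poly_eq_circle (p q : {poly C}) :
  (forall w, `|1 + w| = 1 -> p.[w] = q.[w]) -> p = q.
Proof.
move=> pq; apply/eqP; rewrite -subr_eq0.
pose s := [seq unit_circle_shift k | k <- iota 0 (size (p - q))].
apply/eqP; apply: (@roots_geq_poly_eq0 _ _ s).
- apply/allP => _ /mapP[k _ ->]; rewrite rootE !hornerE pq ?subrr //.
  exact: unit_circle_shift_norm.
- by rewrite map_inj_uniq ?iota_uniq //; exact: unit_circle_shift_inj.
- by rewrite size_map size_iota.
Qed.

Variables (mu : probability (borel_unitary R N) R) (m : nat) (n : nat).
Hypothesis haar : is_haar mu.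
Local Notation E := (cexpect mu).

Definition quad_form (v : 'cV[C]_N) (U : UN) (r : nat) : C :=
  ((map_mx polyC (v ^t*) *m newton_mx (val U) *m map_mx polyC v) 0 0)`_r.

Definition conj_det (U : UN) : C := (\det (val U))^* ^+ m.

Lemma nice_conj_det : nice conj_det.
Proof. exact/niceX/nice_conj/nice_det. Qed.

Definition sec_coef (U : UN) (r : nat) : C := (secular (val U))`_r.

Lemma nice_sec_coef r : nice (fun U => sec_coef U r).
Proof. exact: nice_poly_secular. Qed.

Lemma quad_formE v U r :
  quad_form v U r = \sum_i \sum_j (v i 0)^* * (newton_mx (val U) i j)`_r * v j 0.
Proof.
rewrite /quad_form mxE coef_sum exchange_big /=; apply: eq_bigr => j _.
rewrite !mxE coefMC coef_sum mulr_suml; apply: eq_bigr => i _.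
by rewrite !mxE coefCM.
Qed.

Lemma nice_quad_form v r : nice (fun U => quad_form v U r).
Proof.
apply: (@nice_ext R N (fun U =>
  \sum_i \sum_j (v i 0)^* * (newton_mx (val U) i j)`_r * v j 0)) => [U|].
  by rewrite quad_formE.
apply: nice_sum => i; apply: nice_sum => j.
apply: niceM; last exact: nice_cst.
by apply: niceM; [exact: nice_cst | exact: nice_poly_newton].
Qed.

Definition secular_moment (r : 'I_n -> nat) : C :=
  E (fun U => conj_det U * \prod_a sec_coef U (r a)).

(** Invariance of the Haar measure under a reflection. The determinant
    contributes the conjugate of [1 + w] to the power [m], whose inverse is [(1 +
    w) ^+ m] because [1 + w] lies on the circle. *)
Lemma reflected_moment (r : 'I_n -> nat) (w : C) (v : 'cV[C]_N) :
  (v ^t* *m v) 0 0 = 1 -> `|1 + w| = 1 ->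
  E (fun U => conj_det U * \prod_a (sec_coef U (r a) + w * quad_form v U (r a))) =
  (1 + w) ^+ m * secular_moment r.
Proof.
move=> v1 w1.
pose V : UN := exist (fun U : 'M[C]_N => U \is unitarymx) _ (reflection_unitary v1 w1).
pose f (U : UN) := conj_det U * \prod_a sec_coef U (r a).
have nf : nice f.
  by apply: niceM; [exact: nice_conj_det | apply: nice_prod => a; exact: nice_sec_coef].
rewrite -[secular_moment r](cexpect_translate haar V nf).
rewrite -cexpectZ; last exact: nice_translate.
apply: cexpect_ext => U.
rewrite /f /conj_det /= det_mulmx det_reflection // rmorphM exprMn !mulrA -exprMn.
rewrite -normCK w1 !expr1n mul1r; congr (_ * _); apply: eq_bigr => a _.
by rewrite /sec_coef /= secular_rank_one coefD coefZ.
Qed.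

Lemma nice_poly_linear_factors (r : 'I_n -> nat) (v : 'cV[C]_N) :
  nice_poly (fun U => \prod_a ((sec_coef U (r a))%:P + quad_form v U (r a) *: 'X)).
Proof.
apply: nice_poly_prod => a; apply: nice_polyD => k.
  apply: (@nice_ext R N (fun U => sec_coef U (r a) * (k == 0%N)%:R)) => [U|].
    by rewrite coefC; case: eqP; rewrite ?mulr1 ?mulr0.
  by apply: niceM; [exact: nice_sec_coef | exact: nice_cst].
apply: (@nice_ext R N (fun U => quad_form v U (r a) * ('X`_k))) => [U|].
  by rewrite coefZ.
by apply: niceM; [exact: nice_quad_form | exact: nice_cst].
Qed.

(** Both sides of [reflected_moment] are polynomials in [w] that agree on a
    circle, hence coefficient by coefficient. *)
Lemma reflected_moment_coef (r : 'I_n -> nat) (v : 'cV[C]_N) j :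
  (v ^t* *m v) 0 0 = 1 ->
  E (fun U => conj_det U *
     (\prod_a ((sec_coef U (r a))%:P + quad_form v U (r a) *: 'X))`_j) =
  ((1 + 'X) ^+ m : {poly C})`_j * secular_moment r.
Proof.
move=> v1.
pose pU (U : UN) : {poly C} := \prod_a ((sec_coef U (r a))%:P + quad_form v U (r a) *: 'X).
have npU : nice_poly pU by exact: nice_poly_linear_factors.
pose c k := E (fun U => conj_det U * (pU U)`_k).
have spU U : (size (pU U) <= n.+1)%N.
  apply: leq_trans (size_poly_prod_leq _ _) _.
  rewrite leq_subLR card_ord addnS ltnS.
  have -> : (n + n = \sum_(i < n) 2)%N by rewrite sum_nat_const card_ord; lia.
  apply: leq_sum => a _; apply: leq_trans (size_polyD _ _) _.
  rewrite geq_max (leq_trans (size_polyC_leq1 _)) //=.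
  by apply: leq_trans (size_scale_leq _ _) _; rewrite size_polyX.
suff H : \poly_(k < n.+1) c k = secular_moment r *: (1 + 'X) ^+ m.
  have [jn|nj] := ltnP j n.+1.
    have := congr1 (fun p : {poly C} => p`_j) H; rewrite coef_poly jn coefZ mulrC //.
  have := congr1 (fun p : {poly C} => p`_j) H; rewrite coef_poly ltnNge nj /= coefZ mulrC => <-.
  rewrite -[RHS](cexpect_cst mu 0); apply: cexpect_ext => U.
  by rewrite nth_default ?mulr0 // (leq_trans (spU U)).
apply: poly_eq_circle => w w1.
rewrite hornerZ !hornerE [RHS]mulrC -(reflected_moment r v1 w1).
rewrite horner_poly.
have -> : \sum_(i < n.+1) c i * w ^+ i =
   E (fun U => \sum_(i < n.+1) w ^+ i * (conj_det U * (pU U)`_i)).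
  rewrite cexpect_sum => [|i]; last first.
    apply: niceM; first exact: nice_cst.
    by apply: niceM; [exact: nice_conj_det | exact: npU].
  apply: eq_bigr => i _; rewrite cexpectZ 1?mulrC //.
  by apply: niceM; [exact: nice_conj_det | exact: npU].
apply: cexpect_ext => U.
transitivity (conj_det U * (pU U).[w]).
  rewrite (horner_coef_wide _ (spU U)) mulr_sumr; apply: eq_bigr => i _.
  by rewrite mulrC -mulrA.
congr (_ * _); rewrite horner_prod; apply: eq_bigr => a _.
by rewrite !hornerE mulrC.
Qed.

End Reflections.

(** * A finite design of unit vectors *)

Section Design.
Variables (R : realType) (N : nat).
Local Notation C := R[i].
Local Notation "M ^t*" := (map_mx Num.conj (M^T)) (at level 30).

Definition hform (v : 'cV[C]_N) (A : 'M[C]_N) : C := \sum_i \sum_j (v i 0)^* * A i j * v j 0.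

Definition basis_vec (i : 'I_N) : 'cV[C]_N := delta_mx i 0.

Lemma hform_basis i A : hform (basis_vec i) A = A i i.
Proof.
rewrite /hform (bigD1 i) //= [X in _ + X]big1 ?addr0 => [|k ki]; last first.
  by apply: big1 => j _; rewrite mxE (negPf ki) /= conjC0 !mul0r.
rewrite (bigD1 i) //= [X in _ + X]big1 ?addr0 => [|k ki]; last first.
  by rewrite [basis_vec i k 0]mxE (negPf ki) mulr0.
by rewrite !mxE !eqxx conjC1 mul1r mulr1.
Qed.

Definition pair_vec (i j : 'I_N) (z : C) : 'cV[C]_N :=
  (sqrtC 2)^-1 *: (basis_vec i + z *: basis_vec j).

Lemma hform_pair i j z A : i != j ->
  hform (pair_vec i j z) A =
  2^-1 * (A i i + z * A i j + z^* * A j i + z * z^* * A j j).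
Proof.
move=> ij; have ji : j != i by rewrite eq_sym.
have c2 : ((sqrtC 2)^-1)^* * (sqrtC 2)^-1 = 2^-1 :> C.
  by rewrite geC0_conj ?invr_ge0 ?sqrtC_ge0 // -expr2 exprVn sqrtCK.
have vE k : pair_vec i j z k 0 = (sqrtC 2)^-1 * ((k == i)%:R + z * (k == j)%:R).
  by rewrite !mxE !andbT.
pose g k : C := (k == i)%:R + z * (k == j)%:R.
have sg (f : 'I_N -> C) : \sum_k f k * g k = f i + z * f j.
  rewrite (bigD1 i) //= (bigD1 j) 1?eq_sym //= big1 ?addr0 => [|k /andP[ki kj]].
    by rewrite /g !eqxx (negPf ij) (negPf ji) mulr0 addr0 mulr1 add0r mulr1 mulrC.
  by rewrite /g (negPf ki) (negPf kj) mulr0 addr0 mulr0.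
have sgc (f : 'I_N -> C) : \sum_k (g k)^* * f k = f i + z^* * f j.
  rewrite (bigD1 i) //= (bigD1 j) 1?eq_sym //= big1 ?addr0 => [|k /andP[ki kj]].
    rewrite /g !eqxx (negPf ij) (negPf ji) mulr0 addr0 add0r mulr1.
    by rewrite conjC1 mul1r.
  by rewrite /g (negPf ki) (negPf kj) mulr0 addr0 conjC0 mul0r.
transitivity (2^-1 * \sum_k (g k)^* * (\sum_l A k l * g l)).
  rewrite mulr_sumr; apply: eq_bigr => k _; rewrite !mulr_sumr; apply: eq_bigr => l _.
  by rewrite !vE -/(g k) -/(g l) rmorphM /= -c2; ring.
rewrite sgc !sg; ring.
Qed.

Lemma unit_basis i : (basis_vec i ^t* *m basis_vec i) 0 0 = 1.
Proof.
rewrite mxE (bigD1 i) //= big1 ?addr0 => [|k /negPf ki]; last first.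
  by rewrite [basis_vec i k 0]mxE ki mulr0.
by rewrite !mxE !eqxx conjC1 mulr1.
Qed.

Lemma hform1 v : hform v 1%:M = (v ^t* *m v) 0 0.
Proof.
rewrite mxE; apply: eq_bigr => i _; rewrite (bigD1 i) //= big1 ?addr0 => [|k ki].
  by rewrite !mxE eqxx mulr1.
by rewrite mxE eq_sym (negPf ki) mulr0 mul0r.
Qed.

Lemma unit_pair i j z : i != j -> z * z^* = 1 ->
  (pair_vec i j z ^t* *m pair_vec i j z) 0 0 = 1.
Proof.
move=> ij zz; have ji : j != i by rewrite eq_sym.
rewrite -hform1 hform_pair // zz !mxE !eqxx (negPf ij) (negPf ji).
rewrite !mulr0 !addr0 mul1r -mulr2n -[_ *+ 2]mulr_natl mulr1 mulVf // pnatr_eq0.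
Qed.

Definition i_pow (k : 'I_4) : C := 'i ^+ k.

Lemma i_pow_unit k : i_pow k * (i_pow k)^* = 1.
Proof. by rewrite -normCK normrX normCi !expr1n. Qed.

(** Orthogonality of the powers of the fourth roots of unity keeps the
    products in which the roots cancel. *)
Lemma sum_fourth_roots (a b c a' b' c' : C) :
  \sum_(k < 4) (2^-1 * (a + i_pow k * b + (i_pow k)^* * c)) *
               (2^-1 * (a' + i_pow k * b' + (i_pow k)^* * c')) =
  a * a' + b * c' + c * b'.
Proof.
have ic (k : 'I_4) : (i_pow k)^* = (- 'i) ^+ k by rewrite rmorphXn /= conjCi.
under eq_bigr do rewrite ic /i_pow.
have := sqrCi C; move: 'i => x x2.
have h : (2^-1 : C) * 2 = 1 by rewrite mulVf ?pnatr_eq0.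
move: (2^-1) h => d h.
have x3 : x ^+ 3 = - x by rewrite exprSr x2 mulN1r.
have nx2 : (- x) ^+ 2 = -1 by rewrite sqrrN.
have nx3 : (- x) ^+ 3 = x by rewrite exprSr nx2 mulN1r opprK.
rewrite !big_ord_recr big_ord0 /= add0r !expr0 !expr1 nx2 nx3 x2 x3.
have x22 : x * x = -1 by rewrite -expr2.
have -> : a * a' + b * c' + c * b' = (d * 2) ^+ 2 * (a * a' + b * c' + c * b').
  by rewrite h expr1n mul1r.
transitivity (d ^+ 2 * (4 * a * a' + 2 * (b + c) * (b' + c') + 2 * (x * x) * (b - c) * (b' - c'))).
  ring.
rewrite x22; ring.
Qed.

Lemma pair_design i j (A B : 'M[C]_N) : i != j ->
  \sum_(k < 4) hform (pair_vec i j (i_pow k)) A * hform (pair_vec i j (i_pow k)) B =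
  (A i i + A j j) * (B i i + B j j) + A i j * B j i + A j i * B i j.
Proof.
move=> ij; rewrite -sum_fourth_roots; apply: eq_bigr => k _.
by rewrite !hform_pair // !i_pow_unit; congr (_ * _ * (_ * _)); ring.
Qed.

(** Vectors along the coordinate axes and along [e_i + z e_j], [z] a fourth
    root of unity. The summands with [i = j] have weight zero and only serve to
    index by all pairs. *)
Definition design_index : finType := ('I_N * 'I_N * 'I_4 + 'I_N)%type.

Definition design_vec (t : design_index) : 'cV[C]_N :=
  match t with
  | inl (i, j, k) => if i == j then basis_vec i else pair_vec i j (i_pow k)
  | inr i => basis_vec i
  end.

(** The pairs produce [A i i * B i i] once for each of the [N - 1] partners of
    [i], whereas [design_sum] asks for it twice; the weight of the coordinate
    vectors is the difference. *)
Definition design_weight (t : design_index) : C :=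
  match t with
  | inl (i, j, _) => if i == j then 0 else 2^-1
  | inr _ => 3%:R - N%:R
  end.

Lemma design_unit t : (design_vec t ^t* *m design_vec t) 0 0 = 1.
Proof.
case: t => [[[i j] k]|i] /=; last exact: unit_basis.
case: eqP => [_|/eqP ij]; first exact: unit_basis.
by apply: unit_pair => //; exact: i_pow_unit.
Qed.

(** The design replaces the average over the whole unit sphere, on which a
    product of two quadratic forms [v^* A v] integrates to a multiple of the right
    hand side. *)
Lemma design_sum (A B : 'M[C]_N) :
  \sum_t design_weight t * (hform (design_vec t) A * hform (design_vec t) B) =
  \tr A * \tr B + \tr (A *m B).
Proof.
rewrite big_sumType /=.
pose f i j := 2^-1 * ((A i i + A j j) * (B i i + B j j) + A i j * B j i + A j i * B i j).
have -> : \sum_(t : 'I_N * 'I_N * 'I_4) design_weight (inl t) *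
    (hform (design_vec (inl t)) A * hform (design_vec (inl t)) B) =
    \sum_i \sum_(j | j != i) f i j.
  pose G (t : design_index) := design_weight t *
    (hform (design_vec t) A * hform (design_vec t) B).
  transitivity (\sum_(i < N) \sum_(j < N) \sum_(k < 4) G (inl (i, j, k))).
    by rewrite pair_bigA /= pair_bigA /=; apply: eq_bigr => -[[i j] k] _.
  rewrite /G.
  apply: eq_bigr => i _; rewrite [RHS]big_mkcond /=; apply: eq_bigr => j _.
  rewrite eq_sym; case: eqP => [->|/eqP ij] /=.
    by rewrite big1 // => k _; rewrite ?eqxx mul0r.
  by rewrite -mulr_sumr pair_design // eq_sym.
have -> : \sum_i \sum_(j | j != i) f i j =
    \sum_i \sum_j f i j - \sum_i f i i.
  rewrite -sumrB; apply: eq_bigr => i _.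
  by rewrite [X in _ = X - _](bigD1 i) //= addrAC subrr add0r.
have sf : \sum_i \sum_j f i j = N%:R * (\sum_i A i i * B i i) + \tr A * \tr B + \tr (A *m B).
  have c0 (g : 'I_N -> C) : \sum_(i < N) \sum_(j < N) g i = N%:R * \sum_i g i.
    rewrite mulr_sumr; apply: eq_bigr => i _.
    by rewrite sumr_const card_ord mulr_natl.
  have c1 : \sum_i \sum_j A i j * B j i = \tr (A *m B).
    by apply: eq_bigr => i _; rewrite mxE.
  have c2 : \sum_i \sum_j A i i * B j j = \tr A * \tr B.
    by rewrite mulr_suml; apply: eq_bigr => i _; rewrite mulr_sumr.
  have sw (g : 'I_N -> 'I_N -> C) : \sum_i \sum_j g i j = \sum_i \sum_j g j i.
    exact: exchange_big.
  transitivity (2^-1 * (\sum_(i < N) \sum_(j < N) A i i * B i i + \sum_(i < N) \sum_(j < N) A j j * B j j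
    + (\sum_i \sum_j A i i * B j j + \sum_i \sum_j A j j * B i i)
    + (\sum_i \sum_j A i j * B j i + \sum_i \sum_j A j i * B i j))).
    rewrite -!big_split /= mulr_sumr; apply: eq_bigr => i _.
    rewrite -!big_split /= mulr_sumr; apply: eq_bigr => j _.
    by rewrite /f; congr (_ * _); ring.
  rewrite (sw (fun i j => A j j * B j j)) (sw (fun i j => A j j * B i i)).
  rewrite (sw (fun i j => A j i * B i j)) c1 c2 (c0 (fun i => A i i * B i i)).
  have h : (2^-1 : C) * 2 = 1 by rewrite mulVf ?pnatr_eq0.
  transitivity ((2^-1 * 2) * (N%:R * (\sum_i A i i * B i i) + \tr A * \tr B + \tr (A *m B))).
    ring.
  by rewrite h mul1r.
have sd : \sum_i f i i = 3%:R * \sum_i A i i * B i i.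
  rewrite mulr_sumr; apply: eq_bigr => i _; rewrite /f.
  have h : (2^-1 : C) * 2 = 1 by rewrite mulVf ?pnatr_eq0.
  transitivity ((2^-1 * 2) * (3%:R * (A i i * B i i))); first by ring.
  by rewrite h mul1r.
rewrite sf sd; under eq_bigr do rewrite !hform_basis.
rewrite -mulr_sumr; ring.
Qed.

End Design.

(** * First and second order relations between moments *)

Section SecularMoments.
Variables (R : realType) (N : nat) (mu : probability (borel_unitary R N) R).
Variables (m n' : nat).
Local Notation n := n'.+1.
Local Notation UN := (unitary_group R N).
Local Notation C := R[i].
Local Notation E := (cexpect mu).
Hypothesis haar : is_haar mu.

Definition newton_coef (U : UN) (r : nat) : 'M[C]_N := \matrix_(i, j) (newton_mx (val U) i j)`_r.

Lemma quad_form_hform v U r : quad_form v U r = hform v (newton_coef U r).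
Proof.
rewrite quad_formE; apply: eq_bigr => i _; apply: eq_bigr => j _.
by rewrite [newton_coef U r i j]mxE.
Qed.

(** Newton's identities. *)
Lemma tr_newton_coef U r : \tr (newton_coef U r) = r%:R * sec_coef U r.
Proof.
have := congr1 (fun p : {poly C} => p`_r) (tr_newton_mx (val U)).
rewrite /= coefXM coef_deriv /mxtrace coef_sum => e.
transitivity (\sum_i (newton_mx (val U) i i)`_r).
  by apply: eq_bigr => i _; rewrite [LHS]mxE.
by rewrite e /sec_coef; case: r {e} => [|r] /=; rewrite ?mul0r // mulr_natl.
Qed.

Definition moment (r : multinom n) : C := secular_moment mu m (fun a : 'I_n => r a).

Local Notation prod_except r U a := (\prod_(b | b != a) sec_coef U (r b)).
Local Notation prod_except2 r U a b := (\prod_(c | (c != a) && (c != b)) sec_coef U (r c)).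

Lemma nice_newton_coef i j r : nice (fun U => newton_coef U r i j).
Proof.
apply: (@nice_ext R N (fun U => (newton_mx (val U) i j)`_r)) => [U|]; first by rewrite [RHS]mxE.
exact: nice_poly_newton.
Qed.

Lemma nice_tr_newton r : nice (fun U => \tr (newton_coef U r)).
Proof. by apply: nice_sum => i; exact: nice_newton_coef. Qed.

Lemma nice_tr_newton2 r s : nice (fun U => \tr (newton_coef U r *m newton_coef U s)).
Proof.
apply: nice_sum => i.
apply: (@nice_ext R N (fun U => \sum_j newton_coef U r i j * newton_coef U s j i)) => [U|].
  by rewrite [RHS]mxE.
by apply: nice_sum => j; apply: niceM; exact: nice_newton_coef.
Qed.

Lemma nice_prod_sec (P : pred 'I_n) r : nice (fun U : UN => \prod_(a | P a) sec_coef U (r a)).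
Proof. by apply: nice_prod => a; exact: nice_sec_coef. Qed.

(** The coefficient of [w] in the reflected moments, summed over the
    coordinate vectors. *)
Lemma first_order_moment (r : multinom n) :
  E (fun U => conj_det m U * \sum_a \tr (newton_coef U (r a)) * prod_except r U a) =
  N%:R * ((1 + 'X) ^+ m : {poly C})`_1 * moment r.
Proof.
transitivity (\sum_(i < N) E (fun U => conj_det m U *
   \sum_a quad_form (basis_vec R i) U (r a) * prod_except r U a)).
  rewrite -cexpect_sum => [|i]; last first.
    apply: niceM; first exact: nice_conj_det.
    apply: nice_sum => a; apply: niceM; [exact: nice_quad_form | exact: (nice_prod_sec _ (fun a => r a))].
  apply: cexpect_ext => U; rewrite -mulr_sumr; congr (_ * _).
  rewrite exchange_big /=; apply: eq_bigr => a _; rewrite -mulr_suml; congr (_ * _).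
  by apply: eq_bigr => i _; rewrite quad_form_hform hform_basis.
rewrite -mulrA mulr_natl -[X in _ *+ X]card_ord -sumr_const; apply: eq_bigr => i _.
rewrite -(reflected_moment_coef m haar (fun a => r a) 1 (unit_basis R i)).
by apply: cexpect_ext => U; rewrite coef1_prod_linear.
Qed.

(** What [design_sum] makes of the product of two quadratic forms. *)
Definition pair_trace (U : UN) r s : C :=
  \tr (newton_coef U r) * \tr (newton_coef U s) + \tr (newton_coef U r *m newton_coef U s).

Lemma nice_pair_trace r s : nice (fun U => pair_trace U r s).
Proof.
apply: niceD; last exact: nice_tr_newton2.
by apply: niceM; exact: nice_tr_newton.
Qed.

Definition second_order_const : C :=
  (\sum_t design_weight R (N := N) t) * (((1 + 'X) ^+ m : {poly C})`_2 *+ 2).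

(** The coefficient of [w ^ 2] in the reflected moments, summed over the
    design. *)
Lemma second_order_moment (r : multinom n) :
  E (fun U => conj_det m U * \sum_a \sum_(b | b != a)
       pair_trace U (r a) (r b) * prod_except2 r U a b) =
  second_order_const * moment r.
Proof.
pose G t U := conj_det m U * \sum_a \sum_(b | b != a)
   quad_form (design_vec R (N := N) t) U (r a) * quad_form (design_vec R t) U (r b)
     * prod_except2 r U a b.
have nG t : nice (G t).
  apply: niceM; first exact: nice_conj_det.
  apply: nice_sum => a; apply: nice_sum => b; apply: niceM; last exact: (nice_prod_sec _ (fun a => r a)).
  by apply: niceM; exact: nice_quad_form.
transitivity (\sum_t design_weight R t * E (G t)).
  transitivity (E (fun U => \sum_t design_weight R t * G t U)); last first.
    rewrite cexpect_sum => [|t]; last by apply: niceM; [exact: nice_cst | exact: nG].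
    by apply: eq_bigr => t _; rewrite cexpectZ.
  apply: cexpect_ext => U; rewrite /G.
  under [RHS]eq_bigr do rewrite mulrCA.
  rewrite -mulr_sumr; congr (_ * _).
  under [RHS]eq_bigr do rewrite mulr_sumr.
  rewrite [RHS]exchange_big /=; apply: eq_bigr => a _.
  under [RHS]eq_bigr do rewrite mulr_sumr.
  rewrite [RHS]exchange_big /=; apply: eq_bigr => b _.
  under [RHS]eq_bigr do rewrite !quad_form_hform mulrA.
  by rewrite -mulr_suml design_sum.
rewrite /second_order_const -mulrA mulr_suml; apply: eq_bigr => t _; congr (_ * _).
have := reflected_moment_coef m haar (fun a => r a) 2 (design_unit R t).
move=> /(congr1 (fun z : C => 2%:R * z)).
rewrite -cexpectZ; last first.
  apply: niceM; first exact: nice_conj_det.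
  exact: (nice_poly_linear_factors (fun a => r a)).
rewrite mulrA mulr_natl => <-; apply: cexpect_ext => U.
by rewrite mulrCA mulr_natl coef2_prod_linear.
Qed.

End SecularMoments.

(** * Moments of secular coefficients *)

Section EvalProducts.
Variables (K : numFieldType) (n' : nat).
Local Notation n := n'.+1.

Lemma mcoeff_evalX_pair (r : multinom n) (a b : 'I_n) (f g h : {poly K}) : b != a ->
  mcoeff r (evalX a f * evalX b g * \prod_(c | (c != a) && (c != b)) evalX c h) =
  f`_(r a) * g`_(r b) * \prod_(c | (c != a) && (c != b)) h`_(r c).
Proof.
move=> ba; have ab : a != b by rewrite eq_sym.
pose F c := if c == a then f else if c == b then g else h.
have e (T : comNzRingType) (G : 'I_n -> {poly K} -> T) :
    \prod_c G c (F c) = G a f * G b g * \prod_(c | (c != a) && (c != b)) G c h.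
  rewrite (bigD1 a) //= (bigD1 b) //= mulrA /F eqxx (negPf ba) eqxx; congr (_ * _).
  by apply: eq_bigr => c /andP[/negPf-> /negPf->].
by rewrite -(e _ (fun c p => evalX c p)) mcoeff_prod_evalX (e _ (fun c p => p`_(r c))).
Qed.

Local Notation ev c := (horner_alg (mpolyX K (mnm1 c) : mpoly n K)).

Lemma map_newton_mx (T : comNzRingType) (f : {rmorphism {poly K} -> T}) N (U : 'M[K]_N) :
  map_mx f (newton_mx U) =
  f 'X *: (map_mx f (map_mx polyC U) *m ((f (secular U))%:M - map_mx f (newton_mx U))).
Proof. by rewrite {1}newton_mxE map_mxZ map_mxM map_mxB map_scalar_mx. Qed.

Lemma map_newton_mx_comm (T : comNzRingType) (f : {rmorphism {poly K} -> T}) N (U : 'M[K]_N) :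
  map_mx f (newton_mx U) *m map_mx f (map_mx polyC U) =
  map_mx f (map_mx polyC U) *m map_mx f (newton_mx U).
Proof. by rewrite -!map_mxM newton_mx_comm. Qed.

Lemma tr_map_newton_mx (T : comNzRingType) (f : {rmorphism {poly K} -> T}) N (U : 'M[K]_N) :
  \tr (map_mx f (newton_mx U)) = f ('X * (secular U)^`()).
Proof. by rewrite -tr_newton_mx trace_map_mx. Qed.

(** [trace_resolvent_product] in two independent variables; this is the
    relation [M_eq] that [vandermonde_conjugation] asks of the interaction. *)
Lemma evalX_newton_relation N (U : 'M[K]_N) (a b : 'I_n) :
  (mpolyX K (mnm1 a) - mpolyX K (mnm1 b)) *
   (\sum_i \sum_j evalX a (newton_mx U i j) * evalX b (newton_mx U j i)) =
  mpolyX K (mnm1 a) * evalX a (secular U) * euler b (evalX b (secular U)) -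
  mpolyX K (mnm1 b) * evalX b (secular U) * euler a (evalX a (secular U)).
Proof.
rewrite /evalX.
pose A (c : 'I_n) := map_mx (ev c) (newton_mx U).
pose V : 'M[mpoly n K]_N := map_mx (fun x => x%:A) U.
have VE (c : 'I_n) : map_mx (ev c) (map_mx polyC U) = V.
  by apply/matrixP => i j; rewrite !mxE /= horner_algC.
have evX (c : 'I_n) : ev c 'X = mpolyX K (mnm1 c) by rewrite /= horner_algX.
have AE (c : 'I_n) : A c = mpolyX K (mnm1 c) *: (V *m ((ev c (secular U))%:M - A c)).
  transitivity (ev c 'X *: (map_mx (ev c) (map_mx polyC U) *m ((ev c (secular U))%:M - A c))).
    exact: (map_newton_mx (ev c)).
  by rewrite evX VE.
have AV (c : 'I_n) : A c *m V = V *m A c.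
  have := map_newton_mx_comm (ev c) U; by rewrite -/(A c) VE.
have trA (c : 'I_n) : \tr (A c) = euler c (ev c (secular U)).
  by rewrite [RHS](euler_evalX c); exact: (tr_map_newton_mx (ev c)).
have := trace_resolvent_product (AE a) (AE b) (AV a).
rewrite !trA => <-; congr (_ * _); apply: eq_bigr => i _; rewrite mxE.
by apply: eq_bigr => j _; rewrite !mxE.
Qed.

End EvalProducts.

Section MomentPatterns.
Variables (R : realType) (N : nat) (mu : probability (borel_unitary R N) R).
Variables (m n' : nat).
Local Notation n := n'.+1.
Local Notation UN := (unitary_group R N).
Local Notation C := R[i].
Local Notation E := (cexpect mu).
Local Notation S := (mpoly n C).
Hypothesis haar : is_haar mu.
Hypothesis n_eq : n = (m + m)%N.
Local Notation moment := (@moment R N mu m n').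
Implicit Types (r x : multinom n) (a b : 'I_n).

Lemma moment_big r a : (N < r a)%N -> moment r = 0.
Proof.
move=> ra; rewrite -[RHS](cexpect_cst mu 0); apply: cexpect_ext => U.
rewrite (bigD1 a) //= [sec_coef _ _]nth_default ?mul0r ?mulr0 //.
exact: leq_trans (size_secular _) _.
Qed.

Lemma moment_sym r (s : 'S_n) : moment (mperm r s) = moment r.
Proof.
apply: cexpect_ext => U; congr (_ * _).
rewrite [RHS](reindex_inj (@perm_inj _ s)) /=.
by apply: eq_bigr => a _; rewrite mpermE.
Qed.

Definition first_order_const : C := N%:R * ((1 + 'X) ^+ m : {poly C})`_1.

(** By Newton's identities the first order relation is an eigenvalue equation:
    moments vanish off one degree. *)
Lemma moment_euler r : euler_deg C r * moment r = first_order_const * moment r.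
Proof.
rewrite -(first_order_moment m haar) -cexpectZ; last first.
  apply: niceM; first exact: nice_conj_det.
  by apply: nice_prod => a; exact: nice_sec_coef.
apply: cexpect_ext => U; rewrite mulrCA; congr (_ * _).
rewrite mulr_suml; apply: eq_bigr => a _.
by rewrite tr_newton_coef (bigD1 a) //= mulrA.
Qed.

Lemma conj_detM (U : UN) : \det (val U) * (\det (val U))^* = 1.
Proof.
have /unitarymxP /(congr1 determinant) := valP U.
by rewrite det_mulmx det1 det_map_mx det_tr.
Qed.

(** The coefficients of index [0] and [N] of the secular polynomial are [1]
    and the determinant, so the integrand is constant. *)
Lemma moment_top : moment (Multinom [tuple top_part m N a | a < n]) = 1.
Proof.
rewrite -[RHS](cexpect_cst mu 1); apply: cexpect_ext => U.
have -> : \prod_(a < n) sec_coef U (Multinom [tuple top_part m N a | a < n] a) =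
   \det (val U) ^+ m.
  transitivity (\prod_(a < n) (if (a < m)%N then 1 else \det (val U))).
    apply: eq_bigr => a _; rewrite multinomE tnth_mktuple /top_part /sec_coef.
    case: ifP => _; last exact: secular_lead.
    by rewrite -horner_coef0 secular0.
  rewrite (bigID (fun a : 'I_n => (a < m)%N)) /= big1 ?mul1r => [|a ->] //.
  under eq_bigr => a /negPf-> do over.
  rewrite prodr_const; congr (_ ^+ _).
  have mn : (m <= n)%N by rewrite n_eq leq_addr.
  have : (\sum_(a < n) 1 = \sum_(a < n | (a < m)%N) 1 + \sum_(a < n | ~~ (a < m)%N) 1)%N.
    by rewrite (bigID (fun a : 'I_n => (a < m)%N)).
  rewrite sum1_card card_ord {1}n_eq /= -(big_ord_widen n (fun=> 1%N) mn).
  by rewrite sum1_card card_ord => /addnI E; rewrite -sum1_card [RHS]E; apply: eq_bigl => a.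
by rewrite /conj_det -exprMn mulrC conj_detM expr1n.
Qed.

(** Multiplication by the Vandermonde polynomial is linear in the coefficients
    and commutes with the expectation. *)
Lemma moment_vdm_conv (P : UN -> S) c x :
  (forall r, nice (fun U => mcoeff r (P U))) ->
  (forall r, E (fun U => conj_det m U * mcoeff r (P U)) = c r * moment r) ->
  E (fun U => conj_det m U * mcoeff x (vdm C n' * P U)) =
  \sum_(s : 'S_n) (-1) ^+ s * (if lem (perm_exp id s) x then
     c (mnm_sub x (perm_exp id s)) * moment (mnm_sub x (perm_exp id s)) else 0).
Proof.
move=> nP EP.
pose G (s : 'S_n) U := conj_det m U *
  (if lem (perm_exp id s) x then mcoeff (mnm_sub x (perm_exp id s)) (P U) else 0).
have nG s : nice (G s).
  apply: niceM; first exact: nice_conj_det.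
  by case: (lem _ _); [exact: nP | exact: nice_cst].
transitivity (E (fun U => \sum_(s : 'S_n) (-1) ^+ s * G s U)).
  apply: cexpect_ext => U; rewrite mcoeff_vdmM mulr_sumr; apply: eq_bigr => s _.
  by rewrite mulrCA.
rewrite cexpect_sum => [|s]; last by apply: niceM; [exact: nice_cst | exact: nG].
apply: eq_bigr => s _; rewrite cexpectZ //; congr (_ * _).
rewrite /G; case: (lem _ _); first exact: EP.
by rewrite -[RHS](cexpect_cst mu 0); apply: cexpect_ext => U; rewrite mulr0.
Qed.

Local Notation q U a := (evalX a (secular (val U)) : S).
Definition secular_prod (U : UN) : S := \prod_a q U a.

Lemma mcoeff_secular_prod U r : mcoeff r (secular_prod U) = \prod_a sec_coef U (r a).
Proof. exact: mcoeff_prod_evalX. Qed.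

(** The trace of the product of two copies of [newton_mx] in independent
    variables. *)
Definition newton_pair (U : UN) a b : S :=
  \sum_i \sum_j evalX a (newton_mx (val U) i j) * evalX b (newton_mx (val U) j i).

(** The generating polynomial of the integrands of the second order relation.
    *)
Definition pair_sum (U : UN) : S :=
  \sum_a \sum_(b | b != a) (euler a (q U a) * euler b (q U b) + newton_pair U a b) *
     \prod_(c | (c != a) && (c != b)) q U c.

Lemma mcoeff_pair_sum U r : mcoeff r (pair_sum U) =
  \sum_a \sum_(b | b != a) pair_trace U (r a) (r b) *
     \prod_(c | (c != a) && (c != b)) sec_coef U (r c).
Proof.
rewrite raddf_sum; apply: eq_bigr => a _; rewrite raddf_sum; apply: eq_bigr => b ba /=.
rewrite !mulrDl mcoeffD; congr (_ + _).
  rewrite !euler_evalX mcoeff_evalX_pair // -!tr_newton_mx.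
  have trE k : (\tr (newton_mx (val U)))`_k = \tr (newton_coef U k).
    by rewrite /mxtrace coef_sum; apply: eq_bigr => i _; rewrite [RHS]mxE.
  by rewrite !trE.
rewrite mulr_suml raddf_sum /= mulr_suml; apply: eq_bigr => i _.
rewrite mulr_suml raddf_sum /= [X in X * _]mxE mulr_suml; apply: eq_bigr => j _.
by rewrite mcoeff_evalX_pair //; congr (_ * _ * _); rewrite [RHS]mxE.
Qed.

(** The coefficient of [x] in an identity of the shape of
    [vandermonde_conjugation], when [V] is an eigenvector of both symmetric Euler
    operators. *)
Lemma coef_conjugation (V W Q T D1 D2 : S) (c1 c2 : C) k x :
  D2 = c2 *: V -> D1 = c1 *: V ->
  V * W + D2 * Q + (D1 * T) *+ 2 =
  \sum_a \sum_(b | b != a) euler a (euler b (V * Q)) + (V * T) *+ k ->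
  mcoeff x (V * W) =
    (euler_deg2 C x - c2) * mcoeff x (V * Q) + k%:R * mcoeff x (V * T)
    - (c1 *+ 2) * mcoeff x (V * T).
Proof.
move=> -> -> /(congr1 (mcoeff x)).
rewrite -!scalerAl !mcoeffD mcoeff_sum_euler2 !mcoeffMn !mcoeffZ.
move: (mcoeff x (V * W)) (mcoeff x (V * Q)) (mcoeff x (V * T)) => A B D.
rewrite -[D *+ k]mulr_natl => H.
transitivity (euler_deg2 C x * B + k%:R * D - c2 * B - c1 * D *+ 2).
  by rewrite -H; ring.
ring.
Qed.

Lemma secular_conjugation U :
  vdm C n' * pair_sum U + (\sum_a \sum_(b | b != a) euler a (euler b (vdm C n'))) * secular_prod U
   + ((\sum_a euler a (vdm C n')) * (\sum_a euler a (secular_prod U))) *+ 2 =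
  \sum_a \sum_(b | b != a) euler a (euler b (vdm C n' * secular_prod U))
   + (vdm C n' * (\sum_a euler a (secular_prod U))) *+ (n' * 2).
Proof.
have := @vandermonde_conjugation S 'I_n (fun a => mpolyX C (mnm1 a)) (@euler C n')
    (fun a => q U a) (newton_pair U) (vdm C n') (@vdm_cof C n').
move/(_ (@derivation_euler C n') (fun a b ab => euler_evalX_neq _ ab)).
have e2 a b : a != b -> euler a (euler b (q U b)) = 0.
  by move=> ab; rewrite (euler_evalX b) euler_evalX_neq.
move/(_ e2 (fun a b _ => evalX_newton_relation (val U) a b)).
move/(_ (@vdm_cofE C n') (@vdm_cofN C n') (@euler_vdm C n')).
by rewrite card_ord.
Qed.

Lemma cexpect_lin2 f g h (a b : C) : nice g -> nice h ->
  (forall U, f U = a * g U + b * h U) -> E f = a * E g + b * E h.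
Proof.
move=> ng nh e; rewrite -!cexpectZ // -cexpectD; first exact: cexpect_ext.
- by apply: niceM => //; exact: nice_cst.
- by apply: niceM => //; exact: nice_cst.
Qed.

(** In the expectation of [secular_conjugation], the coefficient of [x] of
    every term is a multiple of [vdm_conv moment x]: by the second order relation
    for the interaction, by the first order relation for the terms of degree one.
    Comparison of the multiples gives the eigenvalue. *)
Lemma moment_euler2 : exists c, forall x, vdm_conv moment x != 0 -> euler_deg2 C x = c.
Proof.
set k1 := first_order_const; set k2 := second_order_const R N m.
exists (k2 + stair_deg2 C n' + stair_deg C n' * k1 *+ 2 - k1 *+ (n' * 2)) => x xnz.
pose Th U := \sum_a euler a (secular_prod U).
have nQ r : nice (fun U => mcoeff r (secular_prod U)).
  apply: (@nice_ext R N (fun U => \prod_a sec_coef U (r a))) => [U|].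
    by rewrite mcoeff_secular_prod.
  by apply: nice_prod => a; exact: nice_sec_coef.
have nTh r : nice (fun U => mcoeff r (Th U)).
  apply: (@nice_ext R N (fun U => euler_deg C r * mcoeff r (secular_prod U))) => [U|].
    by rewrite mcoeff_sum_euler.
  by apply: niceM; [exact: nice_cst | exact: nQ].
have nW r : nice (fun U => mcoeff r (pair_sum U)).
  apply: (@nice_ext R N (fun U => \sum_a \sum_(b | b != a) pair_trace U (r a) (r b) *
     \prod_(c | (c != a) && (c != b)) sec_coef U (r c))) => [U|].
    by rewrite mcoeff_pair_sum.
  apply: nice_sum => a; apply: nice_sum => b.
  by apply: niceM; [exact: nice_pair_trace | apply: nice_prod => c; exact: nice_sec_coef].
have EQ r : E (fun U => conj_det m U * mcoeff r (secular_prod U)) = 1 * moment r.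
  by rewrite mul1r; apply: cexpect_ext => U; rewrite mcoeff_secular_prod.
have ETh r : E (fun U => conj_det m U * mcoeff r (Th U)) = k1 * moment r.
  rewrite -moment_euler -[moment r]mul1r -EQ -cexpectZ; last first.
    by apply: niceM; [exact: nice_conj_det | exact: nQ].
  by apply: cexpect_ext => U; rewrite mcoeff_sum_euler mulrCA.
have EW r : E (fun U => conj_det m U * mcoeff r (pair_sum U)) = k2 * moment r.
  by rewrite -second_order_moment //; apply: cexpect_ext => U; rewrite mcoeff_pair_sum.
have conv k (P : UN -> S) : (forall r, nice (fun U => mcoeff r (P U))) ->
    (forall r, E (fun U => conj_det m U * mcoeff r (P U)) = k * moment r) ->
    E (fun U => conj_det m U * mcoeff x (vdm C n' * P U)) = k * vdm_conv moment x.
  move=> nP EP; rewrite (moment_vdm_conv x nP EP) /vdm_conv mulr_sumr.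
  by apply: eq_bigr => s _; rewrite mulrCA; case: ifP; rewrite ?mulr0.
have nvdm (P : UN -> S) : (forall r, nice (fun U => mcoeff r (P U))) ->
    nice (fun U => conj_det m U * mcoeff x (vdm C n' * P U)).
  move=> nP; apply: niceM; first exact: nice_conj_det.
  apply: (@nice_ext R N (fun U => \sum_(s : 'S_n) (-1) ^+ s *
     (if lem (perm_exp id s) x then mcoeff (mnm_sub x (perm_exp id s)) (P U) else 0))) => [U|].
    by rewrite mcoeff_vdmM.
  apply: nice_sum => s; apply: niceM; first exact: nice_cst.
  by case: (lem _ _); [exact: nP | exact: nice_cst].
have key U : mcoeff x (vdm C n' * pair_sum U) =
    (euler_deg2 C x - stair_deg2 C n') * mcoeff x (vdm C n' * secular_prod U)
    + (n' * 2)%:R * mcoeff x (vdm C n' * Th U)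
    - (stair_deg C n' *+ 2) * mcoeff x (vdm C n' * Th U).
  exact: (coef_conjugation x (sum_euler2_vdm C n') (sum_euler_vdm C n') (secular_conjugation U)).
have EWx := conv _ _ nW EW; have EQx := conv _ _ nQ EQ; have ETx := conv _ _ nTh ETh.
have eqn : k2 * vdm_conv moment x =
    (euler_deg2 C x - stair_deg2 C n') * vdm_conv moment x
    + (n' * 2)%:R * (k1 * vdm_conv moment x)
    - (stair_deg C n' *+ 2) * (k1 * vdm_conv moment x).
  have e U : conj_det m U * mcoeff x (vdm C n' * pair_sum U) =
     (euler_deg2 C x - stair_deg2 C n') * (conj_det m U * mcoeff x (vdm C n' * secular_prod U))
    + ((n' * 2)%:R - stair_deg C n' *+ 2) * (conj_det m U * mcoeff x (vdm C n' * Th U)).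
    rewrite key; move: (mcoeff _ _) (mcoeff _ _) (conj_det _ _) => A B c; ring.
  have := cexpect_lin2 (nvdm _ nQ) (nvdm _ nTh) e.
  rewrite EWx EQx ETx mul1r => ->; ring.
apply: (mulIf xnz); rewrite -[k1 *+ _]mulr_natr.
transitivity (k2 * vdm_conv moment x +
  (stair_deg2 C n' + stair_deg C n' * k1 *+ 2 - k1 * (n' * 2)%:R) * vdm_conv moment x).
  rewrite eqn; ring.
ring.
Qed.

(** [moment_big], [moment_sym], [moment_euler], [moment_euler2] and
    [moment_top] are the properties that characterise the coefficients of the
    rectangular Schur polynomial. *)
Theorem moment_patterns r :
  moment r = #|[set g | chain (@row0 n' N) (@interlaces n' N) n (top_row n' m N) g &
                   [forall a : 'I_n, r a == pattern_weight m g a]]|%:R.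
Proof.
apply: (rectangular_schur n_eq).
- exact: moment_big.
- exact: moment_sym.
- exists first_order_const => r' nz; apply: (mulIf nz); exact: moment_euler.
- exact: moment_euler2.
- exact: moment_top.
Qed.

End MomentPatterns.

(** * Trigonometric integrals *)

Section TrigIntegrals.
Local Open Scope classical_set_scope.
Variable R : realType.
Local Notation C := R[i].
Local Notation mean f := (\int[lebesgue_measure]_(theta in `[0, 2 * pi]%classic) f theta).

Lemma twopi_gt0 : 0 < 2 * pi :> R.
Proof. by rewrite mulr_gt0 ?pi_gt0. Qed.

Lemma continuous_integrable (f : R -> R) : continuous f ->
  lebesgue_measure.-integrable `[0, 2 * pi] (EFin \o f).
Proof.
move=> cf; apply: continuous_compact_integrable; first exact: segment_compact.
exact: continuous_subspaceT.
Qed.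

Lemma mean_sum (I : Type) (s : seq I) (f : I -> R -> R) : (forall i, continuous (f i)) ->
  mean (fun x => \sum_(i <- s) f i x) = \sum_(i <- s) mean (f i).
Proof.
move=> cf; elim: s => [|i s IH].
  rewrite big_nil -[RHS](mul0r (fine (@lebesgue_measure R `[0, 2 * pi]))) -Rintegral_cst //.
  by apply: eq_Rintegral => x _; rewrite big_nil.
rewrite big_cons -IH -RintegralD //.
- by apply: eq_Rintegral => x _; rewrite big_cons.
- exact: continuous_integrable.
- apply: continuous_integrable => x.
  elim: s {IH} => [|j s IH].
    have -> : (fun x => \sum_(i <- [::]) f i x) = (fun=> 0) by apply/funext => y; rewrite big_nil.
    exact: cst_continuous.
  have -> : (fun x => \sum_(i <- j :: s) f i x) = (fun y => f j y + \sum_(i <- s) f i y).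
    by apply/funext => y; rewrite big_cons.
  by apply: continuousD; [exact: cf | exact: IH].
Qed.

Lemma continuous_scale_comp (f : R -> R) (k : R) : continuous f -> continuous (fun x => f (k * x)).
Proof.
move=> cf x; apply: (@continuous_comp _ _ _ (fun x => k * x) f); last exact: cf.
exact: mulrl_continuous.
Qed.

Lemma FTC_mean (f F : R -> R) : continuous f -> (forall x : R, is_derive x (1 : R) F (f x)) ->
  F (2 * pi) = F 0 -> mean f = 0.
Proof.
move=> cf dF F0; rewrite /Rintegral (@continuous_FTC2 _ _ F) ?twopi_gt0 //.
- by rewrite F0 subee.
- exact: continuous_subspaceT.
- have cF : continuous F.
    by move=> x; apply: differentiable_continuous; apply/derivable1_diffP; case: (dF x).
  split; first by move=> x _; case: (dF x).
    by apply: cvg_at_right_filter; exact: cF.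
  by apply: cvg_at_left_filter; exact: cF.
- by move=> x _; rewrite derive1E; case: (dF x).
Qed.

Definition expi (x : R) : C := (cos x +i* sin x)%C.

Lemma expiD x y : expi (x + y) = expi x * expi y.
Proof. by rewrite /expi cosD sinD; apply/eqP; rewrite eq_complex /= [sin x * _ + _]addrC !eqxx. Qed.

Lemma expi0 : expi 0 = 1.
Proof. by rewrite /expi cos0 sin0. Qed.

Lemma expiX x k : expi x ^+ k = expi (k%:R * x).
Proof.
elim: k => [|k IH]; first by rewrite mul0r expi0.
by rewrite exprS IH -expiD -natr1 mulrDl mul1r addrC.
Qed.

Lemma expiN x : expi (- x) = (expi x)^*.
Proof. by rewrite /expi cosN sinN. Qed.

Lemma expi_2pi k : expi (k%:R * (2 * pi)) = 1.
Proof.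
rewrite -expiX (_ : 2 * pi = pi *+ 2) ?mulr_natl //.
by rewrite /expi cos2pi sin2pi expr1n.
Qed.

Lemma mean_expi (r M : nat) :
  mean (fun x => complex.Re (expi ((M%:R - r%:R) * x))) = (M == r)%:R * (2 * pi) /\
  mean (fun x => complex.Im (expi ((M%:R - r%:R) * x))) = 0.
Proof.
have [->|Mr] := eqVneq M r.
  rewrite subrr mul1r; split.
    under eq_Rintegral do rewrite mul0r expi0 /=.
    rewrite Rintegral_cst // mul1r.
    have := @lebesgue_measure_itv R (Interval (BLeft 0) (BRight (2 * pi))) : (_ = _)%E.
    by rewrite /= lte_fin twopi_gt0 -EFinD subr0 => E; rewrite [LHS](congr1 fine E).
  under eq_Rintegral do rewrite mul0r expi0 /=.
  by rewrite Rintegral_cst // mul0r.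
set k : R := M%:R - r%:R.
have k0 : k != 0 by rewrite subr_eq0 eqr_nat.
have e2 : expi (k * (2 * pi)) = 1.
  by rewrite mulrBl expiD expiN !expi_2pi conjC1 mulr1.
have dk (x : R) : is_derive x (1 : R) (fun x => k * x) k.
  have := is_deriveZ k (is_derive_id x (1 : R)); by rewrite /GRing.scale /= mulr1.
rewrite mul0r; split.
  apply: (@FTC_mean _ (fun x => k^-1 * sin (k * x))).
  - by apply: (@continuous_scale_comp cos k); exact: continuous_cos.
  - move=> x.
    have := is_deriveZ k^-1 (is_derive1_comp (is_derive_sin (k * x)) (dk x)).
    by rewrite /GRing.scale /= mulrCA mulVf // mulr1.
  - by have := congr1 (@complex.Im R) e2; rewrite /= => ->; rewrite !mulr0 sin0 mulr0.
apply: (@FTC_mean _ (fun x => - k^-1 * cos (k * x))).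
- by apply: (@continuous_scale_comp sin k); exact: continuous_sin.
- move=> x.
  have := is_deriveZ (- k^-1) (is_derive1_comp (is_derive_cos (k * x)) (dk x)).
  by rewrite /GRing.scale /= mulNr mulNr mulrN opprK mulrCA mulVf // mulr1.
- by have := congr1 (@complex.Re R) e2; rewrite /= => ->; rewrite mulr0 cos0.
Qed.

End TrigIntegrals.

(** * Circle means of characteristic polynomials *)

Section BlockExpansion.
Variables (K : numFieldType).

Lemma prod_blocks (T : comNzRingType) (F : nat -> T) k c :
  \prod_(a < k * c) F (a %/ c)%N = \prod_(l < k) F l ^+ c.
Proof.
rewrite -(big_mkord xpredT (fun a => F (a %/ c)%N)).
elim: k => [|k IH]; first by rewrite mul0n big_geq // big_ord0.
rewrite big_ord_recr /= -IH mulSnr (@big_cat_nat _ _ _ (k * c)) ?leq_addr //=; congr (_ * _).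
rewrite -[X in \prod_(X <= _ < _) _]add0n big_addn addKn big_mkord.
rewrite -[RHS](_ : \prod_(i < c) F k = _); last by rewrite prodr_const card_ord.
apply: eq_bigr => i _; congr F.
by rewrite addnC divnMDl ?(leq_trans _ (ltn_ord i)) // divn_small ?ltn_ord ?addn0.
Qed.

(** Cutting ['I_(k * c)] into [k] blocks of length [c] indexes the terms of a
    product of [k] coefficients, each of them a coefficient of a [c]-fold product.
    *)
Lemma coef_power_blocks k' c N M (q : {poly K}) : (size q <= N.+1)%N ->
  ((q ^+ c)`_M) ^+ k'.+1 =
  \sum_(r : {ffun 'I_(k'.+1 * c) -> 'I_N.+1} |
     [forall l : 'I_k'.+1, \sum_(a < k'.+1 * c | a %/ c == l :> nat) r a == M]%N)
    \prod_a q`_(r a).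
Proof.
move=> sq; pose x : multinom k'.+1 := Multinom [tuple M | l < k'.+1].
have xE l : x l = M by rewrite multinomE tnth_mktuple.
transitivity (mcoeff x (\prod_(l < k'.+1) evalX l (q ^+ c))).
  rewrite mcoeff_prod_evalX; under [RHS]eq_bigr do rewrite xE.
  by rewrite prodr_const card_ord.
transitivity (mcoeff x (\prod_(a < k'.+1 * c) evalX (inord (a %/ c)%N) q)).
  congr (mcoeff x _); rewrite (prod_blocks (fun l => evalX (inord l : 'I_k'.+1) q)).
  by apply: eq_bigr => l _; rewrite inord_val /evalX rmorphXn.
under eq_bigr do rewrite (evalXE _ sq).
rewrite bigA_distr_bigA raddf_sum [RHS]big_mkcond /=; apply: eq_bigr => r _.
have divk (a : 'I_(k'.+1 * c)) : (a %/ c < k'.+1)%N.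
  by rewrite ltn_divLR //; case: c a {q sq r x xE} => [|//]; rewrite muln0 => -[].
have -> : \prod_(a < k'.+1 * c) (q`_(r a) *: mpolyX K (mnm1 (inord (a %/ c)%N)) ^+ r a) =
   (\prod_a q`_(r a)) *: mpolyX K (Multinom [tuple (\sum_(a < k'.+1 * c | a %/ c == l :> nat) r a)%N | l < k'.+1]).
  rewrite scaler_prod; congr (_ *: _); rewrite mprodXnE; congr (mpolyX K _).
  apply/mnmP => l; rewrite mnm_sumE multinomE tnth_mktuple [RHS]big_mkcond /=.
  apply: eq_bigr => a _; rewrite mulmnE mnm1E -val_eqE /= inordK //.
  by case: eqP => _; rewrite ?mul1n ?mul0n.
rewrite mcoeffZ mcoeffX; case: eqP => [E|ne].
  rewrite mulr1 ifT //; apply/forallP => l; apply/eqP.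
  by rewrite -(xE l) -E multinomE tnth_mktuple.
rewrite mulr0 ifF //; apply/negbTE; apply/negP => /forallP H; case: ne.
by apply/mnmP => l; rewrite multinomE tnth_mktuple xE; apply/eqP; exact: H.
Qed.

End BlockExpansion.

Section CircleMean.
Local Open Scope classical_set_scope.
Variables (R : realType) (N : nat).
Local Notation C := R[i].
Local Notation UN := (unitary_group R N).
Local Notation mean f := (\int[lebesgue_measure]_(theta in `[0, 2 * pi]%classic) f theta).

Lemma complexRe_sum (I : Type) (s : seq I) (F : I -> C) :
  complex.Re (\sum_(i <- s) F i) = \sum_(i <- s) complex.Re (F i).
Proof. by elim/big_rec2: _ => // i x y _ <-; case: (F i); case: y. Qed.

Lemma complexIm_sum (I : Type) (s : seq I) (F : I -> C) :
  complex.Im (\sum_(i <- s) F i) = \sum_(i <- s) complex.Im (F i).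
Proof. by elim/big_rec2: _ => // i x y _ <-; case: (F i); case: y. Qed.

(** Orthogonality of characters selects one coefficient; if [M] is beyond the
    range, no character is trivial. *)
Lemma mean_trig_poly (f : R -> R) (a : nat -> C) (sz M : nat) :
  (forall x, (f x)%:C%C = \sum_(r < sz) a r * expi ((M%:R - r%:R) * x)) ->
  ((2 * pi)^-1 * mean f)%:C%C = if (M < sz)%N then a M else 0.
Proof.
move=> fE.
have cRe (r : nat) : continuous (fun x : R => complex.Re (expi ((M%:R - r%:R) * x) : C)).
  by apply: (@continuous_scale_comp _ cos); exact: continuous_cos.
have cIm (r : nat) : continuous (fun x : R => complex.Im (expi ((M%:R - r%:R) * x) : C)).
  by apply: (@continuous_scale_comp _ sin); exact: continuous_sin.
have contM (c : R) (g : R -> R) : continuous g -> continuous (fun x => c * g x).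
  by move=> cg x; apply: continuousM; [exact: cst_continuous | exact: cg].
have contD (g h : R -> R) : continuous g -> continuous h -> continuous (fun x => g x + h x).
  by move=> cg ch x; apply: continuousD; [exact: cg | exact: ch].
have lin (c d : R) (g h : R -> R) : continuous g -> continuous h ->
    mean (fun x => c * g x + d * h x) = c * mean g + d * mean h.
  move=> cg ch; rewrite RintegralD //; try by apply: continuous_integrable; exact: contM.
  by rewrite !RintegralZl //; exact: continuous_integrable.
have sumM (u : nat -> R) : \sum_(r < sz) u r * ((M == r)%:R * (2 * pi)) =
    (if (M < sz)%N then u M else 0) * (2 * pi).
  case: ltnP => Ms.
    rewrite (bigD1 (Ordinal Ms)) //= eqxx mul1r big1 ?addr0 // => r /eqP ne.
    rewrite (_ : (M == r) = false) ?mul0r ?mulr0 //; apply/negbTE/eqP => E.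
    by apply: ne; apply/val_inj.
  rewrite big1 ?mul0r // => r _; rewrite (_ : (M == r) = false) ?mul0r ?mulr0 //.
  by apply/negbTE; rewrite neq_ltn (leq_trans (ltn_ord r) Ms) orbT.
have pi2 : (2 * pi : R) != 0 by rewrite gt_eqF // twopi_gt0.
have eR : mean f = (if (M < sz)%N then complex.Re (a M) else 0) * (2 * pi).
  rewrite -(sumM (fun r => complex.Re (a r))).
  transitivity (mean (fun x => \sum_(r < sz) (complex.Re (a r) * complex.Re (expi ((M%:R - r%:R) * x) : C)
     + - complex.Im (a r) * complex.Im (expi ((M%:R - r%:R) * x) : C)))).
    apply: eq_Rintegral => x _.
    have := congr1 (@complex.Re R) (fE x); rewrite complexRe_sum /= => ->.
    by apply: eq_bigr => r _; case: (a r) => u v /=; rewrite mulNr.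
  rewrite mean_sum => [|r]; last by apply: contD; apply: contM.
  apply: eq_bigr => r _; rewrite lin //; have [-> ->] := mean_expi R r M.
  by rewrite mulr0 addr0.
have eI : 0 = (if (M < sz)%N then complex.Im (a M) else 0) * (2 * pi).
  rewrite -(sumM (fun r => complex.Im (a r))).
  transitivity (mean (fun x => \sum_(r < sz) (complex.Re (a r) * complex.Im (expi ((M%:R - r%:R) * x) : C)
     + complex.Im (a r) * complex.Re (expi ((M%:R - r%:R) * x) : C)))).
    rewrite -[LHS](mul0r (fine (@lebesgue_measure R `[0, 2 * pi]))) -Rintegral_cst //.
    apply: eq_Rintegral => x _.
    have := congr1 (@complex.Im R) (fE x); rewrite complexIm_sum /= => E; rewrite [LHS]E.
    by apply: eq_bigr => r _; case: (a r) => u v /=.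
  rewrite mean_sum => [|r]; last by apply: contD; apply: contM.
  apply: eq_bigr => r _; rewrite lin //; have [-> ->] := mean_expi R r M.
  by rewrite mulr0 add0r.
have {}eI : (if (M < sz)%N then complex.Im (a M) else 0) = 0.
  by apply/eqP; have /esym/eqP := eI; rewrite mulf_eq0 (negPf pi2) orbF.
rewrite eR mulrC -mulrA divff // mulr1; move: eI.
by case: ltnP => _ //; case: (a M) => u v /= ->.
Qed.

Lemma exp_neg_iE x : exp_neg_i x = (expi x)^* :> C. Proof. by []. Qed.

Lemma expi_conjM x : expi x * (expi x)^* = 1 :> C.
Proof. by rewrite -expiN -expiD subrr expi0. Qed.

Lemma charpoly_secular (U : UN) x :
  charpoly_circle U x = (secular (val U)).[- (expi x)^*].
Proof.
rewrite /charpoly_circle /secular -horner_evalE -det_map_mx; congr (\det _).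
apply/matrixP => i j; rewrite !mxE /= horner_evalE !hornerE /= mulNr; congr (_ - _).
by case: eqP => _; rewrite !hornerE.
Qed.

(** The functional equation of the characteristic polynomial of a unitary
    matrix: the conjugate transpose of [U] is its inverse. *)
Lemma charpoly_conj (U : UN) x :
  (charpoly_circle U x)^* =
  (\det (val U))^* * (- expi x) ^+ N * charpoly_circle U x.
Proof.
have /unitarymxP/mulmx1C UU := valP U.
pose Ut := map_mx Num.conj ((val U)^T) : 'M[C]_N.
have e : 1%:M - expi x *: Ut = (- expi x) *: (Ut *m (1%:M - (expi x)^* *: val U)).
  rewrite mulmxBr mulmx1 -scalemxAr UU scalerBr scalerA mulNr expi_conjM.
  by rewrite scaleN1r opprK scaleNr addrC.
transitivity (\det (1%:M - expi x *: Ut)).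
  rewrite /charpoly_circle -det_tr -det_map_mx; congr (\det _).
  apply/matrixP => i j; rewrite !mxE rmorphB rmorphM /= exp_neg_iE conjCK.
  by rewrite rmorph_nat eq_sym.
rewrite e detZ det_mulmx /Ut det_map_mx det_tr mulrA; congr (_ * _); exact: mulrC.
Qed.

Lemma normc_charpoly (U : UN) x b :
  (ComplexField.Normc.normc (charpoly_circle U x) ^+ (2 * b))%:C%C =
  (\det (val U))^* ^+ b * (- expi x) ^+ (N * b) * charpoly_circle U x ^+ (2 * b).
Proof.
rewrite rmorphXn /= -[X in X ^+ _]/(`|charpoly_circle U x|).
rewrite [LHS]exprM normCK charpoly_conj [(- expi x) ^+ (N * b)]exprM.
rewrite [charpoly_circle U x ^+ (2 * b)]exprM -!exprMn; congr (_ ^+ b); ring.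
Qed.

(** By the functional equation the integrand is a trigonometric polynomial,
    whose mean is its constant coefficient. *)
Lemma circle_mean (U : UN) b :
  ((2 * pi)^-1 * mean (fun x => ComplexField.Normc.normc (charpoly_circle U x) ^+ (2 * b)))%:C%C =
  (\det (val U))^* ^+ b * ((secular (val U)) ^+ (2 * b))`_(N * b).
Proof.
set p := _ ^+ (2 * b); pose sz := size p; pose M := (N * b)%N.
(* the sign [(-1) ^+ M] comes from the functional equation and [(-1) ^+ r]
   from the evaluation of [secular] at a negative argument; at [r = M] they
   cancel *)
pose a r : C := (\det (val U))^* ^+ b * p`_r * (-1) ^+ (M + r).
rewrite (@mean_trig_poly _ a sz M) => [|x].
  rewrite /a addnn -signr_odd odd_double mulr1; case: ltnP => // szM.
  by rewrite nth_default ?mulr0.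
rewrite normc_charpoly charpoly_secular -horner_exp -/p horner_coef mulr_sumr.
apply: eq_bigr => r _; rewrite /a.
rewrite mulrBl expiD expiN -!expiX rmorphXn /= exprD.
rewrite [(- expi x) ^+ _]exprNn [(- _^*) ^+ _]exprNn.
ring.
Qed.

End CircleMean.

(** * Moments of moments *)

Section MomentsOfMoments.
Variables (R : realType) (N : nat) (mu : probability (borel_unitary R N) R).
Hypothesis haar : is_haar mu.
Variables (k' b n' : nat).
Local Notation k := k'.+1.
Local Notation n := n'.+1.
Local Notation m := (k * b)%N.
Local Notation UN := (unitary_group R N).
Local Notation C := R[i].
Hypothesis n_eq : n = (k * (2 * b))%N.

Definition block_patterns := [set g : {ffun 'I_n -> {ffun 'I_n -> 'I_N.+1}} |
  chain (@row0 n' N) (@interlaces n' N) n (top_row n' m N) g &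
  [forall l : 'I_k, \sum_(a < n | a %/ (2 * b) == l :> nat) pattern_weight m g a == N * b]%N].

Lemma MoM_cexpect : (MoM mu k b)%:C%C =
  cexpect mu (fun U => conj_det m U * (((secular (val U)) ^+ (2 * b))`_(N * b)) ^+ k).
Proof.
pose avg (U : UN) : R := (2 * pi)^-1 *
  Rintegral lebesgue_measure `[0, 2 * pi]%classic
    (fun x => ComplexField.Normc.normc (charpoly_circle U x) ^+ (2 * b)).
have avgE (U : UN) : (avg U ^+ k)%:C%C =
    conj_det m U * (((secular (val U)) ^+ (2 * b))`_(N * b)) ^+ k.
  by rewrite rmorphXn /= circle_mean exprMn /conj_det -exprM mulnC.
rewrite (cexpect_ext mu (fun U => esym (avgE U))) /cexpect.
rewrite (expect_cst mu 0 : expect mu (fun U => complex.Im (avg U ^+ k)%:C%C) = 0).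
congr (_ +i* _)%C; rewrite /MoM unlock /expect /Rintegral //.
Qed.

(** The block sums of [r] select moments, each of which counts the patterns of
    weight [r]. *)
Theorem MoM_patterns : MoM mu k b = #|block_patterns|%:R.
Proof.
have mm : n = (m + m)%N by rewrite n_eq mulnCA mul2n addnn.
suff : (MoM mu k b)%:C%C = (#|block_patterns|%:R : C).
  by move/(congr1 (@complex.Re R)); rewrite -(rmorph_nat (real_complex R)).
rewrite MoM_cexpect.
pose blocks (r : 'I_n -> nat) :=
  [forall l : 'I_k, \sum_(a < n | a %/ (2 * b) == l :> nat) r a == N * b]%N.
have expand (U : UN) : conj_det m U * (((secular (val U)) ^+ (2 * b))`_(N * b)) ^+ k =
    \sum_(r : {ffun 'I_n -> 'I_N.+1} | blocks (fun a => r a))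
      conj_det m U * \prod_a sec_coef U (r a).
  rewrite -mulr_sumr; congr (_ * _); rewrite /blocks.
  have := coef_power_blocks k' (2 * b) (N * b) (size_secular (val U)).
  by case: _ / n_eq.
rewrite (cexpect_ext mu expand) cexpect_sum => [|r]; last first.
  by apply: niceM; [exact: nice_conj_det | apply: nice_prod => a; exact: nice_sec_coef].
pose mr (r : 'I_n -> nat) : multinom n := Multinom [tuple r a | a < n].
have mrE r a : mr r a = r a by rewrite multinomE tnth_mktuple.
pose isc (g : {ffun 'I_n -> {ffun 'I_n -> 'I_N.+1}}) := chain (@row0 n' N) (@interlaces n' N) n (top_row n' m N) g.
transitivity (\sum_(r : {ffun 'I_n -> 'I_N.+1} | blocks (fun a => r a))
   \sum_(g | isc g && [forall a, r a == pattern_weight m g a :> nat]) (1 : C)).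
  apply: eq_bigr => r _.
  transitivity (moment mu m (mr (fun a => r a))).
    apply: cexpect_ext => U; congr (_ * _); apply: eq_bigr => a _; by rewrite mrE.
  rewrite moment_patterns // -sum1_card natr_sum; apply: eq_bigl => g.
  by rewrite finset.in_set; congr (_ && _); apply: eq_forallb => a; rewrite mrE.
have wle g (a : 'I_n) : isc g -> (pattern_weight m g a <= N)%N.
  move=> cg; rewrite leqNgt; apply/negP => wN.
  have : moment mu m (mr (fun a => pattern_weight m g a)) = 0.
    by apply: (moment_big mu m (a := a)); rewrite mrE.
  rewrite moment_patterns // => /eqP; rewrite pnatr_eq0 cards_eq0 => /eqP e0.
  have : g \in finset.set0 by rewrite -e0 finset.in_set -/(isc g) cg; apply/forallP => c; rewrite mrE.
  by rewrite finset.in_set0.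
rewrite (exchange_big_dep isc) /=; last by move=> r g _ /andP[].
rewrite -sum1_card natr_sum [RHS](eq_bigl _ _ (fun g => finset.in_set _ g)) /=.
rewrite [RHS]big_mkcondr /=; apply: eq_bigr => g cg.
pose r0 : {ffun 'I_n -> 'I_N.+1} := [ffun a : 'I_n => inord (pattern_weight m g a)].
have r0E (a : 'I_n) : r0 a = pattern_weight m g a :> nat by rewrite ffunE inordK // ltnS wle.
have b0 : blocks (fun a => r0 a) = blocks (pattern_weight m g).
  by apply: eq_forallb => l; congr (_ == _); apply: eq_bigr => a _; rewrite r0E.
rewrite -/(blocks (pattern_weight m g)) -b0.
case: ifP => bl.
  rewrite (big_pred1 r0) // => r.
  apply/andP/eqP => [[_ /andP[_ /forallP H]]|->].
    by apply/ffunP => a; apply/val_inj/(etrans _ (esym (r0E a))); exact/eqP/H.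
  by rewrite bl cg; split=> //; apply/forallP => a; rewrite r0E.
rewrite big_pred0 // => r; apply/negbTE/negP => /andP[blr /andP[_ /forallP H]].
suff E : r = r0 by rewrite E bl in blr.
by apply/ffunP => a; apply/val_inj/(etrans _ (esym (r0E a))); exact/eqP/H.
Qed.

End MomentsOfMoments.

(** * Patterns as monotone matrices *)

Local Open Scope nat_scope.

Section PatternsAsMatrices.
Variables (N k' b n' : nat).
Local Notation k := k'.+1.
Local Notation n := n'.+1.
Local Notation m := (k * b)%N.
Hypothesis n_eq : n = k * (2 * b).
Hypothesis b_gt0 : 0 < b.
Local Notation row := {ffun 'I_n -> 'I_N.+1}.
Local Notation top := (top_row n' m N).
Implicit Types (g : {ffun 'I_n -> row}) (y : {ffun 'I_m * 'I_m -> 'I_N.+1}).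

Let n_mm : n = m + m. Proof. by rewrite n_eq mulnCA mul2n addnn. Qed.

Definition level g j : row := if j == n then top else g (inord j).

Lemma chainP g : reflect
  (forall j, j < n ->
     (forall i, i < j -> row_entry (level g j.+1) i <= row_entry (level g j) i
                         <= row_entry (level g j.+1) i.+1) /\
     (forall i : 'I_n, j <= i -> g (inord j) i = ord0))
  (chain (@row0 n' N) (@interlaces n' N) n top g).
Proof.
have lj j : j < n -> level g j = g (inord j) by move=> jn; rewrite /level ltn_eqF.
have nj (j : 'I_n) : next_state g n top j = level g j.+1 by [].
apply: (iffP forallP) => H j.
  move=> jn; have := H (inord j); rewrite nj inordK // jn => /(interlacesP _ _ (ltnW jn)).
  by rewrite -lj.
have jn := ltn_ord j; rewrite jn; apply/(interlacesP _ _ (ltnW jn)).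
by have := H j jn; rewrite nj (lj j jn) inord_val.
Qed.

Definition level_sum g j := \sum_(i < j) row_entry (level g j) i.

Lemma level_sum_step g a : chain (@row0 n' N) (@interlaces n' N) n top g -> a < n ->
  level_sum g a.+1 = level_sum g a + pattern_weight m g a.
Proof.
move=> /chainP H an; have [H1 _] := H a an.
have -> : pattern_weight m g a = level_sum g a.+1 - level_sum g a.
  by rewrite /level_sum {2}/level (ltn_eqF an).
rewrite subnKC // /level_sum big_ord_recl /=; apply: leq_trans (leq_addl _ _).
by apply: leq_sum => i _; case/andP: (H1 i (ltn_ord i)).
Qed.

Lemma level_sum_range g x d : chain (@row0 n' N) (@interlaces n' N) n top g ->
  x + d <= n -> level_sum g (x + d) = level_sum g x + \sum_(x <= a < x + d) pattern_weight m g a.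
Proof.
move=> cg; elim: d => [|d IH] xd; first by rewrite addn0 big_geq ?addn0.
rewrite addnS big_nat_recr ?leq_addr //= addnA -IH; last by rewrite (leq_trans _ xd) // addnS.
by rewrite level_sum_step // -addnS.
Qed.

Lemma sum_block (f : nat -> nat) l : l < k ->
  \sum_(a < n | a %/ (2 * b) == l) f a = \sum_(l * (2 * b) <= a < l * (2 * b) + 2 * b) f a.
Proof.
move=> lk; have b2 : 0 < 2 * b by rewrite muln_gt0.
have le : l * (2 * b) + 2 * b <= n by rewrite n_eq -mulSnr leq_mul2r lk orbT.
rewrite (big_nat_widen _ _ n) // (big_nat_widenl _ 0) // big_mkord.
apply: eq_bigl => a; rewrite eqn_leq -ltnS ltn_divLR // leq_divRL // mulSnr.
by [].
Qed.

Lemma level_sum_top g : level_sum g n = m * N.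
Proof.
rewrite /level_sum /level eqxx n_mm big_split_ord /= big1 ?add0n => [|i _].
  transitivity (\sum_(i < m) N); last by rewrite sum_nat_const card_ord.
  apply: eq_bigr => i _.
  rewrite row_entry_top; last by rewrite n_mm ltn_add2l ltn_ord.
  by rewrite /top_part ltnNge leq_addr.
rewrite row_entry_top; last by rewrite n_mm ltn_addr ?ltn_ord.
by rewrite /top_part ltn_ord.
Qed.

(** The weights telescope to sums of whole rows; the last block follows from
    the sum of the top row. *)
Lemma block_sumsP g : chain (@row0 n' N) (@interlaces n' N) n top g ->
  reflect (forall l, 0 < l < k -> level_sum g (l * (2 * b)) = l * (N * b))
   [forall l : 'I_k, \sum_(a < n | a %/ (2 * b) == l :> nat) pattern_weight m g a == N * b].
Proof.
move=> cg.
have step l : l < k -> level_sum g (l.+1 * (2 * b)) = level_sum g (l * (2 * b)) +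
    \sum_(a < n | a %/ (2 * b) == l) pattern_weight m g a.
  move=> lk; rewrite sum_block // mulSnr level_sum_range //.
  by rewrite n_eq -mulSnr leq_mul2r lk orbT.
have S0 : level_sum g 0 = 0 by rewrite /level_sum big_ord0.
apply: (iffP forallP) => H.
  suff HS l : l < k -> level_sum g (l * (2 * b)) = l * (N * b) by move=> l /andP[_ /HS].
  elim: l => [|l IH] lk; first by rewrite !mul0n.
  by rewrite step ?(ltnW lk) // IH ?(ltnW lk) // (eqP (H (Ordinal (ltnW lk)))) mulSnr.
have H' l : l <= k -> level_sum g (l * (2 * b)) = l * (N * b).
  rewrite leq_eqVlt => /orP[/eqP->|lk]; first by rewrite -n_eq level_sum_top mulnAC mulnA.
  by case: l lk => [|l] lk; [rewrite !mul0n | apply: H].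
move=> l; have := step l (ltn_ord l); rewrite !H' ?(ltnW (ltn_ord l)) //.
by rewrite mulSnr => /addnI <-.
Qed.

(** The value of a row entry as a function of its position in the row and of
    its distance to the end of the row: interlacing with the top row forces the
    entries outside the square to be [N] or [0]. *)
Definition ext y (c r : nat) : nat :=
  if (insub c : option 'I_m, insub r : option 'I_m) is (Some c', Some r') then y (c', r')
  else if m <= c then N else 0.

Lemma ext_in y (c r : 'I_m) : ext y c r = y (c, r).
Proof. by rewrite /ext !valK. Qed.

Lemma ext_high y c r : m <= c -> ext y c r = N.
Proof. by move=> mc; rewrite /ext insubF ?ltnNge mc. Qed.

Lemma ext_low y c r : c < m -> m <= r -> ext y c r = 0.
Proof.
move=> cm mr; rewrite /ext insubT /= insubF ?ltnNge ?mr //= leqNgt cm //.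
Qed.

Lemma ext_le y c r : ext y c r <= N.
Proof.
rewrite /ext; case: insubP => [c' _ _|_]; last by case: ifP.
by case: insubP => [r' _ _|_]; [rewrite -ltnS | case: ifP].
Qed.

Definition antidiag_sum y j := \sum_(p : 'I_m * 'I_m | (p.1 + p.2).+1 == j) y p.

Definition constrained_matrices := [set y : {ffun 'I_m * 'I_m -> 'I_N.+1} |
  [&& [forall c : 'I_m, forall c' : 'I_m, forall r : 'I_m, (c <= c') ==> (y (c, r) <= y (c', r))],
      [forall c : 'I_m, forall r : 'I_m, forall r' : 'I_m, (r <= r') ==> (y (c, r') <= y (c, r))] &
      [forall l : 'I_k, (0 < l) ==> (antidiag_sum y (l * (2 * b)) == minn l (k - l) * b * N)]]].

(** Position [i] of the row of length [j] is read in column [i] on the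
    antidiagonal of level [j], that is in row [j.-1 - i]. *)
Definition pattern_of y : {ffun 'I_n -> row} :=
  [ffun j : 'I_n => [ffun i : 'I_n => if i < j then inord (ext y i (j.-1 - i)) else ord0]].

Lemma level_pattern y j i : j <= n -> i < j ->
  row_entry (level (pattern_of y) j) i = ext y i (j.-1 - i).
Proof.
move=> jn ij; have iN : i < n by exact: leq_trans ij jn.
rewrite /level; case: eqP => [->|/eqP nj].
  rewrite row_entry_top // /top_part; case: ltnP => im; last by rewrite ext_high.
  by rewrite ext_low // n_mm; clear -im; lia.
have {}jn : j < n by rewrite ltn_neqAle nj.
by rewrite /row_entry !ffunE !inordK // ij inordK // ltnS ext_le.
Qed.

Lemma pattern_of_inj : injective pattern_of.
Proof.
move=> y y' E; apply/ffunP => -[c r]; apply/val_inj => /=.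
have cm := ltn_ord c; have rm := ltn_ord r.
have jn : (c + r).+1 <= n by rewrite n_mm; clear -cm rm; lia.
have cj : c < (c + r).+1 by rewrite ltnS leq_addr.
have := level_pattern y jn cj; rewrite E level_pattern //.
by rewrite /= addKn !ext_in => ->.
Qed.

(** A row of length [j > m] consists of an antidiagonal of the square, of [j -
    m] entries forced to be [N] and of zeros. *)
Lemma level_sum_pattern y j : j <= n ->
  level_sum (pattern_of y) j = antidiag_sum y j + N * (j - m).
Proof.
move=> jn.
have -> : level_sum (pattern_of y) j = \sum_(i < j) ext y i (j.-1 - i).
  by apply: eq_bigr => i _; rewrite level_pattern.
rewrite (bigID (fun i : 'I_j => i < m)) /=; congr (_ + _); last first.
  transitivity (\sum_(i < j | ~~ (i < m)) N).
    by apply: eq_bigr => i; rewrite -leqNgt => mi; rewrite ext_high.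
  transitivity (\sum_(m <= i < j) N); last by rewrite sum_nat_const_nat mulnC.
  rewrite (big_nat_widenl _ 0) // big_mkord; apply: eq_bigl => i.
  by rewrite -leqNgt.
rewrite (big_ord_widen_cond (j + m) (fun i => i < m) (fun i => ext y i (j.-1 - i))) ?leq_addr //.
transitivity (\sum_(c < m | c < j) ext y c (j.-1 - c)).
  rewrite (big_ord_widen_cond (j + m) (fun i => i < j) (fun i => ext y i (j.-1 - i))) ?leq_addl //.
  by apply: eq_bigl => i; rewrite andbC.
transitivity (\sum_(c < m) \sum_(r < m | (c + r).+1 == j) y (c, r)); last first.
  by rewrite pair_big_dep; apply: eq_bigr => -[].
rewrite big_mkcond /=; apply: eq_bigr => c _.
case: ifP => cj; last first.
  rewrite big_pred0 // => r; apply/negbTE; apply: contraFN cj => /eqP <-.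
  by rewrite ltnS leq_addr.
have [rm|mr] := ltnP (j.-1 - c) m.
  rewrite (big_pred1 (Ordinal rm)) => [|r]; first by rewrite -(ext_in y c (Ordinal rm)).
  by rewrite /= -val_eqE /=; clear -cj; apply/eqP/eqP; lia.
rewrite ext_low // big_pred0 // => r; apply/negbTE/eqP => E.
by have := ltn_ord r; clear -E mr cj; lia.
Qed.

Section Inverse.
Variable g : {ffun 'I_n -> row}.
Hypothesis cg : chain (@row0 n' N) (@interlaces n' N) n top g.

(** One half of interlacing: an entry in a fixed position decreases with the
    length of the row. *)
Lemma level_le_same d j i : j + d <= n -> i < j ->
  row_entry (level g (j + d)) i <= row_entry (level g j) i.
Proof.
elim: d => [|d IH] jd ij; first by rewrite addn0.
rewrite addnS in jd *; apply: leq_trans (IH (ltnW jd) ij).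
have [H _] := (chainP g cg) _ jd.
by case/andP: (H i (leq_trans ij (leq_addr _ _))).
Qed.

(** The other half of interlacing: entries at a fixed distance from the end of
    the row increase with its length. *)
Lemma level_le_diag d j i : j + d <= n -> i < j ->
  row_entry (level g j) i <= row_entry (level g (j + d)) (i + d).
Proof.
elim: d => [|d IH] jd ij; first by rewrite !addn0.
rewrite !addnS in jd *; apply: leq_trans (IH (ltnW jd) ij) _.
have [H _] := (chainP g cg) _ jd.
have idj : i + d < j + d by rewrite ltn_add2r.
by case/andP: (H _ idj).
Qed.

Definition matrix_of : {ffun 'I_m * 'I_m -> 'I_N.+1} :=
  [ffun p : 'I_m * 'I_m => level g (p.1 + p.2).+1 (inord p.1)].

Lemma matrix_ofE (c r : 'I_m) : matrix_of (c, r) = row_entry (level g (c + r).+1) c :> nat.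
Proof. by rewrite ffunE. Qed.

Lemma ext_matrix_of j i : j <= n -> i < j ->
  ext matrix_of i (j.-1 - i) = row_entry (level g j) i.
Proof.
move=> jn ij; have iN := leq_trans ij jn.
have topE : level g n = top by rewrite /level eqxx.
have [im|mi] := ltnP i m; last first.
  rewrite ext_high //; apply/eqP; rewrite eqn_leq -[X in _ && X]ltnS ltn_ord andbT.
  have := @level_le_same (n - j) j i; rewrite subnKC // topE row_entry_top // /top_part.
  by rewrite [i < m]ltnNge mi; apply.
have [rm|mr] := ltnP (j.-1 - i) m.
  rewrite (ext_in matrix_of (Ordinal im) (Ordinal rm)) matrix_ofE /=.
  by rewrite subnKC ?prednK //; clear -ij; lia.
rewrite ext_low //; apply/esym/eqP; rewrite -leqn0.
have := @level_le_diag (n - j) j i; rewrite subnKC // topE row_entry_top; last first.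
  by clear -ij jn; lia.
rewrite /top_part ifT; first by apply.
have := n_mm; move: mr jn ij; clear; move: m n => m0 n0; lia.
Qed.

Lemma pattern_of_matrix : pattern_of matrix_of = g.
Proof.
apply/ffunP => j; apply/ffunP => i; rewrite !ffunE; case: ltnP => ij.
  apply/val_inj; rewrite /= ext_matrix_of ?(ltnW (ltn_ord j)) //.
  by rewrite /level ltn_eqF // inord_val /row_entry !inord_val.
by have [_] := (chainP g cg) j (ltn_ord j); rewrite inord_val => ->.
Qed.
End Inverse.

(** Beyond the middle row the forced entries account for [N * (l * (2 * b) -
    m)], which turns [l] into [k - l]. *)
Lemma antidiag_arith l A : 0 < l < k ->
  (l * (N * b) == A + N * (l * (2 * b) - k * b)) = (A == minn l (k - l) * b * N).
Proof.
move=> /andP[l0 lk]; have [lk2|kl2] := leqP (2 * l) k.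
  have -> : l * (2 * b) - k * b = 0 by apply/eqP; rewrite subn_eq0 mulnA leq_mul2r [l * 2]mulnC lk2 orbT.
  rewrite muln0 addn0 eq_sym (minn_idPl _); last by clear -lk2 lk; lia.
  by rewrite [N * b]mulnC mulnA.
have -> : minn l (k - l) = k - l by apply/minn_idPr; clear -kl2; lia.
have -> : l * (2 * b) - k * b = (2 * l - k) * b by rewrite mulnA [l * 2]mulnC -mulnBl.
have -> : l * (N * b) = (k - l) * b * N + N * ((2 * l - k) * b).
  rewrite [N * (_ * b)]mulnC -mulnDl -mulnDl mulnCA mulnC; congr (_ * _ * _).
  by clear -kl2 lk; lia.
by rewrite eqn_add2r eq_sym.
Qed.

Lemma ext_mono_col y c c' r : y \in constrained_matrices -> c <= c' -> ext y c r <= ext y c' r.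
Proof.
rewrite finset.in_set => /and3P[/forallP H _ _] cc.
have [c'm|mc'] := ltnP c' m; last by rewrite [X in _ <= X]ext_high // ext_le.
have cm := leq_ltn_trans cc c'm.
have [rm|mr] := ltnP r m; last by rewrite ext_low.
rewrite (ext_in y (Ordinal cm) (Ordinal rm)) (ext_in y (Ordinal c'm) (Ordinal rm)).
by have /forallP/(_ (Ordinal c'm))/forallP/(_ (Ordinal rm))/implyP := H (Ordinal cm); apply.
Qed.

Lemma ext_mono_row y c r r' : y \in constrained_matrices -> r <= r' -> ext y c r' <= ext y c r.
Proof.
rewrite finset.in_set => /and3P[_ /forallP H _] rr.
have [cm|mc] := ltnP c m; last by rewrite !ext_high.
have [r'm|mr'] := ltnP r' m; last by rewrite ext_low.
have rm := leq_ltn_trans rr r'm.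
rewrite (ext_in y (Ordinal cm) (Ordinal rm)) (ext_in y (Ordinal cm) (Ordinal r'm)).
by have /forallP/(_ (Ordinal rm))/forallP/(_ (Ordinal r'm))/implyP := H (Ordinal cm); apply.
Qed.

Lemma block_le_n l : l < k -> l * (2 * b) <= n.
Proof. by move=> lk; rewrite n_eq leq_mul2r (ltnW lk) orbT. Qed.

(** Interlacing is monotonicity along the rows and columns of the square, once
    the top row has forced all other entries. *)
Theorem card_block_patterns : #|block_patterns N k' b n'| = #|constrained_matrices|.
Proof.
rewrite -(card_imset _ pattern_of_inj); apply: eq_card => g.
rewrite finset.in_set; apply/andP/imsetP => [[cg /(block_sumsP cg) bg]|[y yc ->]].
  exists (matrix_of g); last by rewrite pattern_of_matrix.
  rewrite finset.in_set; apply/and3P; split.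
  - apply/forallP => c; apply/forallP => c'; apply/forallP => r; apply/implyP => cc.
    rewrite !matrix_ofE; have jn : (c + r).+1 + (c' - c) <= n.
      have := ltn_ord c'; have := ltn_ord r; rewrite n_mm; clear -cc; lia.
    have := level_le_diag cg jn (leq_addr _ _); rewrite subnKC //.
    by have -> : (c + r).+1 + (c' - c) = (c' + r).+1 by clear -cc; lia.
  - apply/forallP => c; apply/forallP => r; apply/forallP => r'; apply/implyP => rr.
    rewrite !matrix_ofE; have jn : (c + r).+1 + (r' - r) <= n.
      have := ltn_ord c; have := ltn_ord r'; rewrite n_mm; clear -rr; lia.
    have := level_le_same cg jn (leq_addr _ _).
    by have -> : (c + r).+1 + (r' - r) = (c + r').+1 by clear -rr; lia.
  - apply/forallP => l; apply/implyP => l0; have lk : 0 < l < k by rewrite l0 ltn_ord.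
    rewrite -antidiag_arith // -level_sum_pattern ?block_le_n //.
    by rewrite pattern_of_matrix // bg.
have cg : chain (@row0 n' N) (@interlaces n' N) n top (pattern_of y).
  apply/chainP => j jn; split=> [i ij|i ji]; last first.
    by rewrite !ffunE inordK // ltnNge ji.
  have ij' : i < j.+1 by exact: ltnW.
  have Sij : i.+1 < j.+1 by [].
  rewrite (level_pattern y jn ij') (level_pattern y (ltnW jn) ij) (level_pattern y jn Sij) /=.
  have -> : j - i.+1 = j.-1 - i by clear -ij; lia.
  by rewrite ext_mono_col // andbT ext_mono_row //; clear -ij; lia.
split=> //; apply/(block_sumsP cg) => l lk; have /andP[l0 lk'] := lk.
rewrite level_sum_pattern ?block_le_n //; apply/esym/eqP; rewrite antidiag_arith //.
move: yc; rewrite finset.in_set => /and3P[_ _ /forallP/(_ (Ordinal lk'))/implyP]; exact.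
Qed.

End PatternsAsMatrices.

Local Open Scope ring_scope.

(** * Volumes and cubes *)

Section Slicing.
Variables (R : realType) (I : finType).
Implicit Types (J : I -> interval R) (v x : I -> R) (s : seq I).
Local Open Scope ereal_scope.

Definition update x (i0 : I) (t : R) : I -> R := fun i => if i == i0 then t else x i.

(** The product of the indicator functions of the intervals [J i], in which
    those of the coordinates in [s] have been replaced by their integrals [v i].
    *)
Definition slice J v s x : R :=
  (\prod_i (if i \in s then v i else \1_([set` J i]) (x i)))%R.

Definition itv_lengths J v :=
  forall i, (0 <= v i)%R /\ lebesgue_measure ([set` J i] : set R) = (v i)%:E.

Lemma slice_ge0 J v s x : itv_lengths J v -> (0 <= slice J v s x)%R.
Proof. by move=> Jv; apply: prodr_ge0 => i _; case: ifP => // _; case: (Jv i). Qed.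

Lemma slice_update J v s x i0 t : i0 \notin s ->
  slice J v s (update x i0 t) =
  ((\prod_(i | i != i0) (if i \in s then v i else \1_([set` J i]) (x i))) *
   \1_([set` J i0]) t)%R.
Proof.
move=> i0s; rewrite /slice (bigD1 i0) //= mulrC (negPf i0s) /update eqxx.
by congr (_ * _)%R; apply: eq_bigr => i /negPf ->.
Qed.

Lemma measurable_slice J v s x i0 : i0 \notin s ->
  measurable_fun setT (fun t => (slice J v s (update x i0 t))%:E).
Proof.
move=> i0s; apply/measurable_realfun.measurable_EFinP.
under eq_fun => t do rewrite slice_update //.
by apply: measurable_funM => //; apply: measurable_indic; exact: measurable_itv.
Qed.

Lemma integral_slice J v s x i0 : itv_lengths J v -> i0 \notin s ->
  \int[lebesgue_measure]_t (slice J v s (update x i0 t))%:E =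
  (slice J v (i0 :: s) x)%:E.
Proof.
move=> Jv i0s; under eq_integral => t _ do rewrite slice_update // EFinM.
rewrite ge0_integralZl_EFin //.
- transitivity ((\prod_(i | i != i0) (if i \in s then v i else \1_([set` J i]) (x i)))%:E * (v i0)%:E).
    congr (_ * _); case: (Jv i0) => _ <-.
    have := @integral_indic _ _ R lebesgue_measure setT measurableT [set` J i0]%classic (measurable_itv (J i0)).
    by rewrite setIT.
  rewrite -EFinM; congr (_%:E).
  rewrite /slice [RHS](bigD1 i0) //= in_cons eqxx /= mulrC; congr (_ * _)%R.
  by apply: eq_bigr => i /negPf ni; rewrite in_cons ni.
- by apply/measurable_realfun.measurable_EFinP; exact: measurable_indic (measurable_itv _).
- by apply: prodr_ge0 => i _; case: ifP => // _; case: (Jv i).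
Qed.

(** Integration over one coordinate after the other turns an inequality
    between sums of indicator functions of boxes into one between their volumes;
    monotone convergence exchanges the integral with the infinite sum. *)
Lemma slicing (T : Type) (r : seq T) (J : T -> I -> interval R) v
    (J' : nat -> I -> interval R) (v' : nat -> I -> R) :
  (forall z, itv_lengths (J z) v) -> (forall n, itv_lengths (J' n) (v' n)) ->
  (forall x, \sum_(z <- r) (slice (J z) v [::] x)%:E <=
             \sum_(0 <= n <oo) (slice (J' n) (v' n) [::] x)%:E) ->
  (size r)%:R%:E * (\prod_i v i)%:E <= \sum_(0 <= n <oo) (\prod_i v' n i)%:E.
Proof.
move=> Jv Jv' le0.
have key s : uniq s -> forall x, \sum_(z <- r) (slice (J z) v s x)%:E <=
             \sum_(0 <= n <oo) (slice (J' n) (v' n) s x)%:E.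
  elim: s => // i0 s IHs /= /andP[i0s us] x.
  under eq_bigr => z _ do rewrite -integral_slice //.
  under eq_eseriesr => n _ do rewrite -integral_slice //.
  rewrite -ge0_integral_sum //=; first last.
  - by move=> z t _; rewrite lee_fin slice_ge0.
  - by move=> z; exact: measurable_slice.
  rewrite -integral_nneseries //=; first last.
  - by move=> z t _; rewrite lee_fin slice_ge0.
  - by move=> z; exact: measurable_slice.
  apply: ge0_le_integral => //=.
  - by move=> t _; apply: sume_ge0 => z _; rewrite lee_fin slice_ge0.
  - by apply: emeasurable_sum => z; exact: measurable_slice.
  - apply: ge0_emeasurable_sum.
      by move=> n t _ _; rewrite lee_fin slice_ge0.
    by move=> n _; exact: measurable_slice.
  - by move=> t _; exact: IHs.
pose x0 : I -> R := fun=> 0%R; have := key (enum I) (enum_uniq I) x0.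
have E (J0 : I -> interval R) (v0 : I -> R) : slice J0 v0 (enum I) x0 = (\prod_i v0 i)%R.
  by apply: eq_bigr => i _; rewrite mem_enum.
rewrite (eq_bigr (fun=> (\prod_i v i)%:E)); last by move=> z _; rewrite E.
rewrite (eq_eseriesr (g := fun n => (\prod_i v' n i)%:E)); last by move=> n _; rewrite E.
by rewrite sumEFin big_const_seq count_predT iter_addr addr0 -EFinM mulr_natl.
Qed.
End Slicing.

Section CubeBounds.
Variables (R : realType) (I : finType).
Hypothesis I_gt0 : (0 < #|I|)%N.
Variable N : nat.
Hypothesis N_gt0 : (0 < N)%N.
Implicit Types (z : {ffun I -> 'I_N.+1}) (K : set (I -> R)).

Definition cube z : set (I -> R) :=
  box (fun i => (z i)%:R / N%:R) (fun i => (z i).+1%:R / N%:R).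

Let N0 : (0 < N%:R :> R)%R. Proof. by rewrite ltr0n. Qed.

Lemma side_length z i : (z i).+1%:R / N%:R - (z i)%:R / N%:R = N%:R^-1 :> R.
Proof. by rewrite -mulrBl -natrB // subSnn mul1r. Qed.

(** Half-open cubes are disjoint, so the sum of their indicator functions is
    at most one, and at most the sum of those of the boxes of any cover of [K]. *)
Lemma vol_ge_cubes (S : {set {ffun I -> 'I_N.+1}}) K :
  (forall z, z \in S -> (cube z `<=` K)%classic) ->
  ((#|S|%:R / N%:R ^+ #|I|)%:E <= lebesgue_vol K)%E.
Proof.
move=> SK; apply: le_ereal_inf_tmp => _ [a [b [ab Kab ->]]].
pose J z i : interval R := Interval (BLeft ((z i)%:R / N%:R)) (BLeft ((z i).+1%:R / N%:R)).
pose J' n i : interval R := Interval (BLeft (a n i)) (BRight (b n i)).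
have -> : (#|S|%:R / N%:R ^+ #|I|)%:E =
    ((size (enum S))%:R%:E * (\prod_(i : I) (N%:R^-1 : R))%:E)%E.
  by rewrite -cardE prodr_const EFinM exprVn.
rewrite /box_volume; apply: (@slicing _ _ _ _ J _ J').
- move=> z i; split; first by rewrite invr_ge0 ltW.
  rewrite lebesgue_measure_itv /= lte_fin ltr_pM2r ?invr_gt0 // ltr_nat leqnn.
  by rewrite -EFinB side_length.
- move=> n i; split; first by rewrite subr_ge0.
  rewrite lebesgue_measure_itv /= lte_fin.
  have := ab n i; rewrite le_eqVlt => /predU1P[->|->]; last by rewrite EFinB.
  by rewrite ltxx subrr.
move=> x; have sl_ge0 n : (0%R <= (slice (J' n) (fun i => b n i - a n i) [::] x)%:E)%E.
  by rewrite lee_fin; apply: prodr_ge0.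
have [/hasP[z0]|/hasPn none] := boolP (has (fun z => slice (J z) (fun=> N%:R^-1) [::] x != 0) (enum S)); last first.
  by rewrite big1_seq ?nneseries_ge0 // => z /andP[_ /none/negPn/eqP ->].
have inJ z : slice (J z) (fun=> N%:R^-1) [::] x != 0 -> forall i, x i \in J z i.
  move=> /prodf_neq0 H i; have := H i isT; rewrite indicE.
  by case: (boolP (x i \in [set` J z i]%classic)); rewrite ?eqxx // inE.
rewrite mem_enum => z0S /inJ xz0.
have x_cube : cube z0 x.
  by move=> i; have := xz0 i; rewrite in_itv /= => /andP[-> /ltW].
have [n _ xn] := Kab _ (SK _ z0S _ x_cube).
apply: (@le_trans _ _ 1%E).
  rewrite (bigD1_seq z0) ?enum_uniq ?mem_enum //= big1.
    rewrite adde0 lee_fin; apply: prodr_ile1 => i _.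
    by rewrite indicE; case: (_ \in _); rewrite ler01 lexx.
  move=> z zz0; apply/eqP; rewrite eqe; apply/negPn/negP => /inJ xz; case/eqP: zz0.
  apply/ffunP => i; apply/val_inj => /=.
  have := xz i; have := xz0 i; rewrite !in_itv /= => /andP[A B] /andP[C D].
  have := le_lt_trans A D; have := le_lt_trans C B.
  rewrite !ltr_pM2r ?invr_gt0 // !ltr_nat !ltnS => ? ?.
  by apply/eqP; rewrite eqn_leq; apply/andP.
apply: (@le_trans _ _ (slice (J' n) (fun i => b n i - a n i) [::] x)%:E).
  rewrite lee_fin /slice big1 // => i _; rewrite indicE mem_set //=.
  by rewrite in_itv /=; exact: xn.
rewrite (nneseries_split 0 n.+1) // add0n big_nat_recr //= -addeA addeCA leeDl //.
by rewrite adde_ge0 ?nneseries_ge0 // sume_ge0.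
Qed.

(** The enumerated cubes are a cover. A cover is an infinite sequence, so they
    are followed by degenerate boxes, which have volume zero because [I] is not
    empty. *)
Lemma vol_le_cubes (S : {set {ffun I -> 'I_N.+1}}) K :
  (forall x, K x -> exists2 z, z \in S & cube z x) ->
  (lebesgue_vol K <= (#|S|%:R / N%:R ^+ #|I|)%:E)%E.
Proof.
move=> KS; apply: ereal_inf_lbound.
pose e := enum S; pose dflt : {ffun I -> 'I_N.+1} := [ffun=> ord0].
pose a n i : R := if (n < size e)%N then (nth dflt e n i)%:R / N%:R else 0.
pose b n i : R := if (n < size e)%N then (nth dflt e n i).+1%:R / N%:R else 0.
exists a, b; split.
- move=> n i; rewrite /a /b; case: ifP => // _.
  by rewrite ler_pM2r ?invr_gt0 // ler_nat.
- move=> x /KS[z zS zx]; have ze : z \in e by rewrite mem_enum.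
  exists (index z e) => // i; rewrite /a /b index_mem ze nth_index //; exact: zx.
have vol n : box_volume (a n) (b n) = if (n < size e)%N then N%:R^-1 ^+ #|I| else 0.
  rewrite /box_volume /a /b; case: ifP => _.
    by rewrite (eq_bigr (fun=> N%:R^-1)) ?prodr_const // => i _; exact: side_length.
  have [i0 _] := card_gt0P I_gt0.
  by rewrite (bigD1 i0) //= subrr mul0r.
rewrite (nneseries_split 0 (size e)); last first.
  by move=> n _; rewrite vol lee_fin; case: ifP => // _; rewrite exprn_ge0 // invr_ge0 ltW.
rewrite add0n eseries0 ?adde0; last by move=> n le _; rewrite vol ltnNge le.
rewrite sumEFin big_nat_cond (eq_bigr (fun=> N%:R^-1 ^+ #|I|)).
  by rewrite -big_nat_cond sumr_const_nat subn0 exprVn /e -cardE mulr_natl.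
by move=> n; rewrite andbT => /andP[_ ns]; rewrite vol ns.
Qed.
End CubeBounds.

(** * Lattice points of dilated polytopes *)

Section SlabCount.
Variables (R : realType) (I : finType).
Implicit Types (a : I -> R).

(** If [a i0] is not zero, two points of the slab that agree outside [i0]
    differ at [i0] by less than a constant [D]; a point is therefore determined by
    its other coordinates and by the residue modulo [D] of this one. *)
Lemma slab_count a (c : R) : (exists i, a i != 0) ->
  exists D : nat, forall (N : nat) (beta : R),
    (#|[set z : {ffun I -> 'I_N.+1} | (`|\sum_i a i * (z i)%:R - beta| <= c)%R]%SET|
     <= D * N.+1 ^ #|I|.-1)%N.
Proof.
move=> [i0 ai0]; have a_gt0 : 0 < `|a i0| by rewrite normr_gt0.
have c2 : 0 <= `|2 * c / a i0| by [].
pose D := (Num.truncn (`|2 * c / a i0|)).+1.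
have ltD : 2 * c < D%:R * `|a i0|.
  rewrite -ltr_pdivrMr // (le_lt_trans _ (andP (truncn_itv c2)).2) //.
  by rewrite normrM normfV ler_pM2r ?invr_gt0 // ler_norm.
exists D => N beta.
pose J := {i : I | i != i0}.
pose enc (z : {ffun I -> 'I_N.+1}) : 'I_D * {ffun J -> 'I_N.+1} :=
  (inord (z i0 %% D), [ffun i : J => z (val i)]).
have cardJ : #|{: 'I_D * {ffun J -> 'I_N.+1}}| = (D * N.+1 ^ #|I|.-1)%N.
  rewrite card_prod card_ord card_ffun card_ord card_sig.
  by rewrite (eq_card (_ : _ =i predC1 i0)) ?cardC1 // => i; rewrite !inE.
rewrite -cardJ; apply: (@leq_trans #|[set enc z | z in [set z : {ffun I -> 'I_N.+1} | (`|\sum_i a i * (z i)%:R - beta| <= c)%R]%SET]%SET|); last exact: max_card.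
rewrite card_in_imset // => z w; rewrite !inE => zc wc [/(congr1 (@nat_of_ord _)) ez /ffunP ew].
have E i : i != i0 -> z i = w i.
  by move=> ni; have := ew (exist _ i ni); rewrite !ffunE.
rewrite !inordK ?ltn_mod // in ez.
suff e0 : z i0 = w i0 by apply/ffunP => i; have [->|/E] := eqVneq i i0.
have : `|a i0 * ((z i0)%:R - (w i0)%:R)| <= 2 * c.
  have -> : a i0 * ((z i0)%:R - (w i0)%:R) =
     (\sum_i a i * (z i)%:R - beta) - (\sum_i a i * (w i)%:R - beta).
    rewrite opprB addrA subrK -sumrB (bigD1 i0) //= big1 ?addr0 ?mulrBr //.
    by move=> i /E ->; rewrite subrr.
  by apply: le_trans (ler_normB _ _) _; rewrite mulr2n mulrDl mul1r lerD.
move=> /le_lt_trans/(_ ltD); rewrite normrM mulrC ltr_pM2r // => lt.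
apply/val_inj; apply/eqP => /=; move: lt ez.
wlog le_wz : z w {zc wc ew E} / (w i0 <= z i0)%N.
  move=> H; case: (leqP (w i0) (z i0)) => [|/ltnW] le lt ez; first exact: H.
  by rewrite eq_sym; apply: H => //; rewrite distrC.
rewrite -natrB // ger0_norm ?ler0n // ltr_nat => lt /eqP.
rewrite eqn_mod_dvd // => dv; rewrite eqn_leq le_wz andbT -subn_eq0.
by case: posnP => // pos; move: (dvdn_leq pos dv); rewrite leqNgt lt.
Qed.
End SlabCount.

Section PolytopeCount.
Variables (R : realType) (I J : finType) (A : J -> I -> R) (B : J -> R).
Hypothesis I_gt0 : (0 < #|I|)%N.

Definition polytope : set (I -> R) := [set x | forall j, \sum_i A j i * x i <= B j]%classic.

Hypothesis polytope_unit : forall x, polytope x -> forall i, 0 <= x i <= 1.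

Definition scaled N (z : {ffun I -> 'I_N.+1}) : I -> R := fun i => (z i)%:R / N%:R.
Definition lattice_points N : {set {ffun I -> 'I_N.+1}} :=
  [set z | `[< polytope (scaled z) >]].
Definition inside N : {set {ffun I -> 'I_N.+1}} :=
  [set z | `[< (cube (R:=R) z `<=` polytope)%classic >]].
Definition meeting N : {set {ffun I -> 'I_N.+1}} :=
  [set z | `[< exists2 x, cube (R:=R) z x & polytope x >]].

Lemma scaled_cube N (z : {ffun I -> 'I_N.+1}) : (0 < N)%N -> cube (R:=R) z (scaled z).
Proof. by move=> N0 i; rewrite lexx ler_pM2r ?invr_gt0 ?ltr0n // ler_nat leqnSn. Qed.

Lemma inside_lattice N : (0 < N)%N -> inside N \subset lattice_points N.
Proof.
move=> N0; apply/fintype.subsetP => z; rewrite !finset.in_set => /asboolP zK.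
by apply/asboolP; exact: (zK _ (scaled_cube z N0)).
Qed.

Lemma lattice_meeting N : (0 < N)%N -> lattice_points N \subset meeting N.
Proof.
move=> N0; apply/fintype.subsetP => z; rewrite !finset.in_set => /asboolP zK.
by apply/asboolP; exists (scaled z) => //; exact: scaled_cube.
Qed.

Lemma polytope_meeting N x : (0 < N)%N -> polytope x -> exists2 z, z \in meeting N & cube (R:=R) z x.
Proof.
move=> N0 Kx; have N1 : 0 < N%:R :> R by rewrite ltr0n.
have itv i : (Num.truncn (x i * N%:R))%:R <= x i * N%:R < (Num.truncn (x i * N%:R)).+1%:R.
  by apply: truncn_itv; have /andP[? _] := polytope_unit Kx i; rewrite mulr_ge0 // ltW.
have leN i : (Num.truncn (x i * N%:R) < N.+1)%N.
  rewrite ltnS -(ler_nat R); have /andP[le _] := itv i; apply: le_trans le _.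
  by have /andP[_ le1] := polytope_unit Kx i; rewrite ler_piMl // ltW.
pose z : {ffun I -> 'I_N.+1} := [ffun i => Ordinal (leN i)].
have zx : cube (R:=R) z x.
  move=> i; rewrite /z ffunE /= ler_pdivrMr // ler_pdivlMr //.
  by have /andP[-> /ltW ->] := itv i.
by exists z => //; rewrite finset.in_set; apply/asboolP; exists x.
Qed.

Definition coef_norm j := \sum_i `|A j i|.

(** A linear form varies by at most the sum of the absolute values of its
    coefficients over a cube of side one. *)
Lemma cube_slab N (z : {ffun I -> 'I_N.+1}) x j : (0 < N)%N -> cube (R:=R) z x ->
  `|\sum_i A j i * (z i)%:R - (\sum_i A j i * x i) * N%:R| <= coef_norm j.
Proof.
move=> N0 zx; have N1 : 0 < N%:R :> R by rewrite ltr0n.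
rewrite mulr_suml -sumrB; apply: le_trans (ler_norm_sum _ _ _) _.
apply: ler_sum => i _; rewrite -mulrA -mulrBr normrM ler_piMr // ler_norml.
have := zx i; rewrite /= ler_pdivrMr // ler_pdivlMr // -natr1 => /andP[? ?].
by apply/andP; split; lra.
Qed.

(** Some inequality holds at one point of the cube and fails at another, so
    its linear form is close to the bound on the whole cube and cannot be zero. *)
Lemma boundary_slab N (z : {ffun I -> 'I_N.+1}) : (0 < N)%N ->
  z \in meeting N -> z \notin inside N ->
  exists2 j, (exists i, A j i != 0) & `|\sum_i A j i * (z i)%:R - B j * N%:R| <= coef_norm j.
Proof.
move=> N0; have N1 : 0 < N%:R :> R by rewrite ltr0n.
rewrite !finset.in_set => /asboolP[x zx Kx] /asboolP nz.
have [y [zy nKy]] : exists y, cube (R:=R) z y /\ ~ polytope y.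
  by apply: contra_notP nz => H y zy; apply: contra_notP H => nK; exists y.
have [j nj] : exists j, ~ (\sum_i A j i * y i <= B j).
  by apply: contra_notP nKy => H j; apply: contra_notP H => nK; exists j.
move/negP: nj; rewrite -ltNge => ltj; exists j.
  apply: contrapT => H; have A0 i : A j i = 0.
    by apply/eqP; apply: contra_notT H => ?; exists i.
  have sum0 w : \sum_i A j i * w i = 0 by rewrite big1 // => i _; rewrite A0 mul0r.
  by have := Kx j; rewrite leNgt sum0 -(sum0 y) ltj.
have := cube_slab j N0 zx; have := cube_slab j N0 zy; rewrite !ler_norml.
have leB : (\sum_i A j i * x i) * N%:R <= B j * N%:R by rewrite ler_pM2r //; exact: Kx.
have ltB : B j * N%:R <= (\sum_i A j i * y i) * N%:R by rewrite ler_pM2r // ltW.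
move=> /andP[? ?] /andP[? ?]; apply/andP; split; lra.
Qed.

Lemma boundary_count : exists D : nat, forall N, (0 < N)%N ->
  (#|meeting N :\: inside N| <= D * N.+1 ^ #|I|.-1)%N.
Proof.
have H j : exists D : nat, (exists i, A j i != 0) -> forall (N : nat),
    (#|[set z : {ffun I -> 'I_N.+1} | (`|\sum_i A j i * (z i)%:R - B j * N%:R| <= coef_norm j)%R]%SET|
     <= D * N.+1 ^ #|I|.-1)%N.
  have [nz|?] := pselect (exists i, A j i != 0); last by exists 0%N.
  by have [D HD] := slab_count (coef_norm j) nz; exists D => _ N.
have [D HD] := choice H; exists (\sum_j D j)%N => N N0.
pose slab j := [set z : {ffun I -> 'I_N.+1} | (`|\sum_i A j i * (z i)%:R - B j * N%:R| <= coef_norm j)%R]%SET.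
pose P j := `[< exists i, A j i != 0 >].
apply: (@leq_trans (\sum_(j | P j) #|slab j|)%N).
  under [X in (_ <= X)%N]eq_bigr => j _ do rewrite -sum1_card big_mkcond.
  rewrite exchange_big /= -sum1_card big_mkcond /=; apply: leq_sum => z _.
  case: ifP => //; rewrite finset.in_setD => /andP[nz mz].
  have [j /asboolP Pj zj] := boundary_slab N0 mz nz.
  by rewrite (bigD1 j) //= finset.in_set zj.
rewrite big_distrl /= big_mkcond /=; apply: leq_sum => j _.
by case: ifP => // /asboolP Pj; exact: HD.
Qed.

(** Both the number of lattice points and the normalised volume lie between
    the number of inner cubes and the number of cubes that meet the polytope. *)
Theorem polytope_count : exists C : R, forall N, (0 < N)%N ->
  `|#|lattice_points N|%:R - fine (lebesgue_vol polytope) * N%:R ^+ #|I| |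
    <= C * N%:R ^+ #|I|.-1.
Proof.
have [D HD] := boundary_count; exists (D * 2 ^ #|I|.-1)%:R => N N0.
have N1 : 0 < N%:R ^+ #|I| :> R by rewrite exprn_gt0 // ltr0n.
have lo : ((#|inside N|%:R / N%:R ^+ #|I|)%:E <= lebesgue_vol polytope)%E.
  by apply: vol_ge_cubes => // z; rewrite finset.in_set => /asboolP.
have hi : (lebesgue_vol polytope <= (#|meeting N|%:R / N%:R ^+ #|I|)%:E)%E.
  by apply: vol_le_cubes => // x; exact: polytope_meeting.
case: (lebesgue_vol polytope) lo hi => [v| |] //=.
rewrite !lee_fin ler_pdivrMr // ler_pdivlMr // => lo hi.
have : (#|meeting N| - #|inside N| <= D * 2 ^ #|I|.-1 * N ^ #|I|.-1)%N.
  rewrite -cardsDS ?(fintype.subset_trans (inside_lattice N0)) ?lattice_meeting //.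
  apply: leq_trans (HD N N0) _; rewrite -mulnA leq_mul2l -expnMn.
  by apply/orP; right; case: _.-1 => // e; rewrite leq_exp2r //; lia.
have := subset_leq_card (inside_lattice N0); have := subset_leq_card (lattice_meeting N0).
move=> lm il; rewrite -(ler_nat R) natrB ?(leq_trans il) // natrM natrX => le.
apply: le_trans le; rewrite ler_norml -!(ler_nat R) in lm il *.
by apply/andP; split; lra.
Qed.
End PolytopeCount.

(** * Excluded positions *)

Local Open Scope nat_scope.

Section Positions.
Variables (k' b : nat).
Local Notation k := k'.+1.
Local Notation m := (k'.+1 * b).
Hypothesis b_gt0 : 0 < b.

(** The excluded position on the antidiagonal of level [2 * b * l], for [0 < l
    < k]. In the second half it is the position attached to [k - l] in the last
    row; when [k] is even, both descriptions of the middle one agree. *)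
Definition excluded l : nat * nat :=
  if l <= k %/ 2 then (1, 2 * b * l) else (m - 2 * b * (k - l) + 1, m).

Lemma half_level l : l <= k %/ 2 -> 2 * b * l <= m.
Proof.
move=> lh; rewrite (mulnC 2) -mulnA mulnC leq_mul2r; apply/orP; right.
by have := leq_trunc_div k 2; lia.
Qed.

Lemma level_compl l : l <= k -> 2 * b * l + 2 * b * (k - l) = m + m.
Proof. by move=> lk; rewrite -mulnDr subnKC // -mulnA (mulnC b) mul2n addnn. Qed.

(** Each of the [k - 1] constrained antidiagonals contains exactly one
    excluded position, which its prescribed sum determines. *)
Lemma excluded_level l : 0 < l < k -> (excluded l).1 + (excluded l).2 = (2 * b * l).+1.
Proof.
move=> /andP[l0 lk]; rewrite /excluded; case: ifP => [|/negbT] lh /=; first by lia.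
have := level_compl (ltnW lk).
have : 2 * b * (k - l) <= m by apply: half_level; move: lh; rewrite -ltnNge; lia.
lia.
Qed.

Lemma excluded_range l : 0 < l < k ->
  [/\ 0 < (excluded l).1 <= m & 0 < (excluded l).2 <= m].
Proof.
move=> /andP[l0 lk]; have m0 : 0 < m by rewrite muln_gt0.
rewrite /excluded; case: ifP => [|/negbT] lh /=.
  have := half_level lh; have : 0 < 2 * b * l by rewrite !muln_gt0 b_gt0.
  by split; lia.
have : 2 * b * (k - l) <= m by apply: half_level; move: lh; rewrite -ltnNge; lia.
have : 0 < 2 * b * (k - l) by rewrite !muln_gt0 b_gt0 subn_gt0.
by split; lia.
Qed.

Lemma excluded_compl l : 0 < l <= k %/ 2 -> excluded (k - l) = (m - 2 * b * l + 1, m).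
Proof.
move=> /andP[l0 lh]; rewrite /excluded; case: ifP => lh2.
  have e : k - l = l by lia.
  have := @level_compl l; rewrite e => H; have {}H : 2 * b * l + 2 * b * l = m + m by apply: H; lia.
  have -> : 2 * b * l = m by lia.
  by rewrite subnn.
by rewrite subKn //; lia.
Qed.

Lemma free_indexP i j : 0 < i <= m -> 0 < j <= m ->
  reflect (exists2 l, 0 < l < k & (i, j) = excluded l) (~~ free_index k b i j).
Proof.
move=> ri rj; rewrite /free_index ri rj /= -has_predC; apply: (iffP hasP).
  move=> [l]; rewrite mem_iota => lr /=; rewrite negb_and !negbK.
  have lk : l < k by lia.
  move=> /orP[] /eqP e; rewrite e.
    by exists l; rewrite /excluded ?ifT //; lia.
  by exists (k - l); rewrite ?excluded_compl //; lia.
move=> [l lr ->]; have [lh|lh] := leqP l (k %/ 2).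
  exists l; first by rewrite mem_iota; lia.
  by rewrite /excluded lh /= eqxx.
exists (k - l); first by rewrite mem_iota; lia.
have {1 2}-> : l = k - (k - l) by lia.
by rewrite excluded_compl /= ?eqxx ?andbF //; lia.
Qed.

Lemma free_range i j : free_index k b i j -> (0 < i <= m) /\ (0 < j <= m).
Proof. by case/and3P. Qed.

Lemma excluded_inj l1 l2 : 0 < l1 < k -> 0 < l2 < k -> excluded l1 = excluded l2 -> l1 = l2.
Proof.
move=> r1 r2 e; have := excluded_level r1; rewrite e excluded_level // => -[/eqP].
by rewrite eqn_pmul2l ?muln_gt0 // => /eqP.
Qed.

Lemma excluded_not_free l : 0 < l < k -> ~~ free_index k b (excluded l).1 (excluded l).2.
Proof.
move=> lr; have [r1 r2] := excluded_range lr.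
by apply/free_indexP => //; exists l => //; case: (excluded l).
Qed.

Local Notation pos := (free_pos k b).
Definition npair (s : pos) : nat * nat := ((val s).1 : nat, (val s).2 : nat).

Lemma npair_inj : injective npair.
Proof.
by move=> s t [/val_inj e1 /val_inj e2]; apply/val_inj; rewrite [LHS]surjective_pairing e1 e2 -surjective_pairing.
Qed.

Lemma npair_free s : free_index k b (npair s).1 (npair s).2.
Proof. exact: (valP s). Qed.

Lemma free_npair i j : free_index k b i j -> exists s, npair s = (i, j).
Proof.
move=> fr; have [/andP[_ ri] /andP[_ rj]] := free_range fr.
pose p0 : 'I_m.+1 * 'I_m.+1 := (Ordinal (ri : i < m.+1), Ordinal (rj : j < m.+1)).
by exists (exist (fun p : 'I_m.+1 * 'I_m.+1 => is_true (free_index k b p.1 p.2)) p0 fr).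
Qed.

(** Lists of pairs of natural numbers, in which the index sets of the various
    sums over an antidiagonal can be compared by membership. *)
Definition free_seq (Q : pred (nat * nat)) := [seq npair s | s <- enum {: pos} & Q (npair s)].

Lemma free_seq_uniq Q : uniq (free_seq Q).
Proof. by rewrite (map_inj_uniq npair_inj); apply: filter_uniq; exact: enum_uniq. Qed.

Lemma mem_free_seq Q q : (q \in free_seq Q) = free_index k b q.1 q.2 && Q q.
Proof.
apply/mapP/andP => [[s]|[fr Qq]].
  by rewrite mem_filter => /andP[Qs _] ->; rewrite npair_free.
have [s es] := free_npair fr; exists s; last by rewrite es -surjective_pairing.
by rewrite mem_filter mem_enum es -surjective_pairing Qq.
Qed.

Definition square_seq (Q : pred (nat * nat)) :=
  [seq (p.1.+1, p.2.+1) | p : 'I_m * 'I_m <- enum {: 'I_m * 'I_m} & Q (p.1.+1, p.2.+1)].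

Lemma square_seq_uniq Q : uniq (square_seq Q).
Proof.
rewrite map_inj_uniq; first by apply: filter_uniq; exact: enum_uniq.
by move=> [p1 p2] [q1 q2] [] /val_inj -> /val_inj ->.
Qed.

Lemma mem_square_seq Q q : (q \in square_seq Q) = [&& 0 < q.1 <= m, 0 < q.2 <= m & Q q].
Proof.
apply/mapP/and3P => [[[p1 p2]]|].
  by rewrite mem_filter => /andP[/= Qp _] ->; rewrite /= !ltn_ord.
case: q => -[|i] [|j] [] // ri rj Qq; exists (Ordinal ri, Ordinal rj) => //.
by rewrite mem_filter mem_enum Qq.
Qed.

Lemma perm_square_free l : 0 < l < k ->
  perm_eq (square_seq (fun q => q.1 + q.2 == (2 * b * l).+1))
    (excluded l :: free_seq (fun q => q.1 + q.2 == (2 * b * l).+1)).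
Proof.
move=> lr; apply: uniq_perm; first exact: square_seq_uniq.
  rewrite cons_uniq free_seq_uniq andbT mem_free_seq negb_and.
  by rewrite excluded_not_free.
move=> q; rewrite mem_square_seq in_cons mem_free_seq.
have [->|ne] /= := eqVneq q (excluded l).
  by have [-> ->] := excluded_range lr; rewrite excluded_level // eqxx.
have [lv|_] := eqVneq (q.1 + q.2) (2 * b * l).+1; last by rewrite !andbF.
rewrite !andbT; apply/andP/idP => [[r1 r2]|/free_range[]//].
apply: contraT => /free_indexP[] // l2 lr2; rewrite -surjective_pairing => e.
have := excluded_level lr2; rewrite -e lv => -[/eqP].
rewrite eqn_pmul2l ?muln_gt0 // => /eqP el; by rewrite e el eqxx in ne.
Qed.

(** The positions on the antidiagonal of an excluded entry in the first
    column, except this entry itself. *)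
Lemma perm_first_column_free l : 0 < l <= k %/ 2 ->
  perm_eq (free_seq (fun q => q.1 + q.2 == (2 * b * l).+1))
    [seq (t, 2 * b * l + 1 - t) | t <- index_iota 2 (2 * b * l).+1].
Proof.
move=> /andP[l0 lh]; have lk : 0 < l < k by lia.
apply: uniq_perm; first exact: free_seq_uniq.
  by rewrite map_inj_uniq ?iota_uniq // => t1 t2 [].
move=> [i j]; rewrite mem_free_seq /=; have hl := half_level lh.
have ex : excluded l = (1, 2 * b * l) by rewrite /excluded lh.
apply/andP/mapP => [[fr /eqP lv]|[t]].
  have [r1 r2] := free_range fr; have := excluded_not_free lk; rewrite ex /= => nf.
  exists i; last by congr (_, _); lia.
  rewrite mem_index_iota; have : i <> 1.
    move=> e; case/negP: nf; move: fr; rewrite e.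
    by have -> : j = 2 * b * l by lia.
  lia.
rewrite mem_index_iota => rt [-> ->]; split; last by lia.
apply: contraT => /free_indexP[]; try lia; move=> l2 lr2 e.
have := excluded_level lr2; rewrite -e /= => lv.
have [/eqP] : (2 * b * l).+1 = (2 * b * l2).+1 by rewrite -lv; lia.
rewrite eqn_pmul2l ?muln_gt0 // => /eqP el; move: e; rewrite -el ex => -[]; lia.
Qed.

(** The positions on the antidiagonal of an excluded entry in the last row,
    except this entry itself. *)
Lemma perm_last_row_free l : 0 < l <= k %/ 2 ->
  perm_eq (free_seq (fun q => q.1 + q.2 == (2 * b * (k - l)).+1))
    [seq (m - 2 * b * l + t, m + 1 - t) | t <- index_iota 2 (2 * b * l).+1].
Proof.
move=> lr; have /andP[l0 lh] := lr; have lk : 0 < k - l < k by lia.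
have := level_compl (_ : l <= k); rewrite (_ : l <= k); last by lia.
move=> /(_ isT) cmpl; have hl := half_level lh.
apply: uniq_perm; first exact: free_seq_uniq.
  rewrite map_inj_in_uniq ?iota_uniq // => t1 t2.
  by rewrite !mem_index_iota => ? ? [] *; lia.
move=> [i j]; rewrite mem_free_seq /=; have ex := excluded_compl lr.
apply/andP/mapP => [[fr /eqP lv]|[t]].
  have [r1 r2] := free_range fr; have := excluded_not_free lk; rewrite ex /= => nf.
  exists (m + 1 - j); last by congr (_, _); lia.
  rewrite mem_index_iota; have : j <> m.
    move=> e; case/negP: nf; move: fr; rewrite e.
    by have -> : i = m - 2 * b * l + 1 by lia.
  lia.
rewrite mem_index_iota => rt [-> ->]; split; last by lia.
apply: contraT => /free_indexP[]; try lia; move=> l2 lr2 e.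
have := excluded_level lr2; rewrite -e /= => lv.
have [/eqP] : (2 * b * (k - l)).+1 = (2 * b * l2).+1 by rewrite -lv; lia.
rewrite eqn_pmul2l ?muln_gt0 // => /eqP el; move: e; rewrite -el ex => -[]; lia.
Qed.

Lemma card_free_pos : #|{: pos}| = (m ^ 2 - k').
Proof.
pose Q (q : nat * nat) := free_index k b q.1 q.2.
have E : perm_eq (square_seq xpredT) (free_seq xpredT ++ [seq excluded l | l <- iota 1 k']).
  apply: uniq_perm; first exact: square_seq_uniq.
    rewrite cat_uniq free_seq_uniq map_inj_in_uniq ?iota_uniq ?andbT; last first.
      by move=> l1 l2; rewrite !mem_iota => r1 r2; apply: excluded_inj; lia.
    apply/hasPn => _ /mapP[l lr ->]; rewrite mem_free_seq negb_and excluded_not_free //.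
    by rewrite mem_iota in lr; lia.
  move=> q; rewrite mem_square_seq mem_cat mem_free_seq !andbT.
  apply/andP/orP => [[r1 r2]|H].
    have [fr|/free_indexP[] // l lr e] := boolP (free_index k b q.1 q.2); first by left.
    right; apply/mapP; exists l; first by rewrite mem_iota; lia.
    by rewrite -e -surjective_pairing.
  case: H => [fr|/mapP[l lr ->]]; first by have [] := free_range fr.
  by apply: excluded_range; rewrite mem_iota in lr; lia.
have := perm_size E; rewrite size_cat !size_map size_iota -!enumT -!cardT.
by rewrite card_prod card_ord mulnn => ->; rewrite addnK.
Qed.
End Positions.

Local Open Scope ring_scope.

(** * The region as a polytope *)

Section Region.
Variables (R : realType) (k' b : nat).
Local Notation k := k'.+1.
Local Notation m := (k'.+1 * b)%N.
Hypothesis b_gt0 : (0 < b)%N.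
Local Notation pos := (free_pos k b).
Local Notation cell := ('I_m * 'I_m)%type.
Implicit Types (u : pos -> R) (x : nat -> nat -> R).

Lemma sum_free (V : nmodType) (Q : pred (nat * nat)) (F : nat * nat -> V) :
  \sum_(s : pos | Q (npair s)) F (npair s) = \sum_(q <- free_seq k' b Q) F q.
Proof. by rewrite big_map big_filter big_enum_cond. Qed.

Lemma sum_square (V : nmodType) (Q : pred (nat * nat)) (F : nat * nat -> V) :
  \sum_(p : cell | Q (p.1.+1, p.2.+1)) F (p.1.+1, p.2.+1) = \sum_(q <- square_seq k' b Q) F q.
Proof. by rewrite big_map big_filter big_enum_cond. Qed.

Definition on_level l (q : nat * nat) := (q.1 + q.2)%N == (2 * b * l).+1.
(** The sum prescribed on the antidiagonal of level [2 * b * l], for entries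
    in [[0, 1]]. *)
Definition level_mass l : nat := (minn l (k - l) * b)%N.

Definition fill_const i j : R :=
  if free_index k b i j then 0 else (level_mass ((i + j).-1 %/ (2 * b)))%:R.
Definition fill_coef i j (s : pos) : R :=
  if free_index k b i j then (npair s == (i, j))%:R
  else - (on_level ((i + j).-1 %/ (2 * b)) (npair s))%:R.
(** The entries of the completed matrix, as affine functions of the free ones.
    *)
Definition fill u i j : R := fill_const i j + \sum_s fill_coef i j s * u s.

Lemma fill_free u s : fill u (npair s).1 (npair s).2 = u s.
Proof.
rewrite /fill /fill_const /fill_coef npair_free add0r (bigD1 s) // -surjective_pairing eqxx.
by rewrite mul1r [X in _ + X = _]big1 /= ?addr0 // => t /negPf ts; rewrite (inj_eq (@npair_inj _ _)) ts mul0r.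
Qed.

Lemma fill_excluded u l : (0 < l < k)%N ->
  fill u (excluded k' b l).1 (excluded k' b l).2 =
  (level_mass l)%:R - \sum_(s | on_level l (npair s)) u s.
Proof.
move=> lr; rewrite /fill /fill_const /fill_coef (negPf (excluded_not_free _ lr)) //.
rewrite excluded_level //= mulKn ?muln_gt0 //; congr (_ + _).
rewrite -sumrN [RHS]big_mkcond; apply: eq_bigr => s _.
by case: ifP => _; rewrite ?mulN1r // oppr0 mul0r.
Qed.

Lemma completes_first_column u x l : (forall s : pos, x (val s).1 (val s).2 = u s) -> (0 < l <= k %/ 2)%N ->
  \sum_(2 <= t < (2 * b * l).+1) x t (2 * b * l + 1 - t)%N = \sum_(s | on_level l (npair s)) u s.
Proof.
move=> xu lr; rewrite (eq_bigr (fun s => x (npair s).1 (npair s).2)); last by move=> s _; rewrite xu.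
rewrite (sum_free (on_level l) (fun q => x q.1 q.2)).
by rewrite (perm_big _ (perm_first_column_free b_gt0 lr)) big_map.
Qed.

Lemma completes_last_row u x l : (forall s : pos, x (val s).1 (val s).2 = u s) -> (0 < l <= k %/ 2)%N ->
  \sum_(2 <= t < (2 * b * l).+1) x (m - 2 * b * l + t)%N (m + 1 - t)%N
  = \sum_(s | on_level (k - l) (npair s)) u s.
Proof.
move=> xu lr; rewrite (eq_bigr (fun s => x (npair s).1 (npair s).2)); last by move=> s _; rewrite xu.
rewrite (sum_free (on_level (k - l)) (fun q => x q.1 q.2)).
by rewrite (perm_big _ (perm_last_row_free b_gt0 lr)) big_map.
Qed.

Lemma level_mass_half l : (0 < l <= k %/ 2)%N ->
  level_mass l = (l * b)%N /\ level_mass (k - l) = (l * b)%N.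
Proof. by move=> lr; rewrite /level_mass; split; congr (_ * _)%N; lia. Qed.

(** Both families of equations in the completion say that the sum over the
    antidiagonal of an excluded position is [level_mass]. *)
Lemma completes_excluded u x : completes u x <->
  (forall s : pos, x (val s).1 (val s).2 = u s) /\
  (forall l, (0 < l < k)%N -> x (excluded k' b l).1 (excluded k' b l).2 =
     (level_mass l)%:R - \sum_(s | on_level l (npair s)) u s).
Proof.
split=> -[xu xl]; split=> // l lr; last first.
  have [e1 e2] := level_mass_half lr.
  rewrite (completes_first_column xu) // (completes_last_row xu) //; split.
    have := xl l; rewrite e1 => <-; last by lia.
    by rewrite /excluded; case/andP: lr => _ ->.
  have := xl (k - l)%N; rewrite e2 => <-; last by lia.
  by rewrite excluded_compl.
have [lh|lh] := leqP l (k %/ 2).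
  have lr2 : (0 < l <= k %/ 2)%N by lia.
  have [+ _] := xl l lr2; rewrite (completes_first_column xu) // (level_mass_half lr2).1 => <-.
  by rewrite /excluded lh.
have lr2 : (0 < k - l <= k %/ 2)%N by lia.
have [_] := xl (k - l)%N lr2; rewrite (completes_last_row xu) //.
have := excluded_compl b_gt0 lr2; have [_] := level_mass_half lr2.
by rewrite subKn; [move=> -> -> -> | lia].
Qed.

Lemma completes_fill u : completes u (fill u).
Proof.
by apply/completes_excluded; split=> [s|l lr]; [exact: (fill_free u s) | exact: fill_excluded].
Qed.

Lemma completes_unique u x i j : completes u x -> (0 < i <= m)%N -> (0 < j <= m)%N ->
  x i j = fill u i j.
Proof.
move=> /completes_excluded[xu xl] ri rj.
have [/free_npair[s [<- <-]]|/free_indexP[] // l lr e] := boolP (free_index k b i j).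
  by rewrite [RHS](fill_free u s) xu.
by have := xl l lr; rewrite -fill_excluded // -e.
Qed.

Lemma V_regionP u : V_region R k b u <->
  (forall p : cell, 0 <= fill u p.1.+1 p.2.+1 <= 1) /\
  (forall p q : cell, (p.1 <= q.1)%N -> (q.2 <= p.2)%N ->
     fill u p.1.+1 p.2.+1 <= fill u q.1.+1 q.2.+1).
Proof.
split=> [[u01 [x [cx xl [mc mr]]]]|[f01 mono]].
  have xE (p : cell) : x p.1.+1 p.2.+1 = fill u p.1.+1 p.2.+1.
    by apply: completes_unique => //; exact: ltn_ord.
  split=> [p|p q le1 le2]; last first.
    rewrite -!xE; have := mc p.2 p.1 q.1 le1; rewrite !mxE => /le_trans; apply.
    by have := mr q.1 q.2 p.2 le2; rewrite !mxE.
  have r1 : (0 < p.1.+1 <= m)%N by exact: ltn_ord.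
  have r2 : (0 < p.2.+1 <= m)%N by exact: ltn_ord.
  have [/free_npair[s [<- <-]]|/free_indexP[] // l lr e] := boolP (free_index k b p.1.+1 p.2.+1).
    by rewrite (fill_free u s).
  rewrite -xE; have [-> ->] : p.1.+1 = (excluded k' b l).1 /\ p.2.+1 = (excluded k' b l).2 by rewrite -e.
  have [lh|lh] := leqP l (k %/ 2).
    by rewrite {1 2 3 4}/excluded lh; have [] := xl l; first by lia.
  have -> : l = (k - (k - l))%N by lia.
  rewrite excluded_compl //; last by lia.
  by have [] := xl (k - l)%N; first by lia.
have cell_of i j : (0 < i <= m)%N -> (0 < j <= m)%N -> exists p : cell, p.1.+1 = i /\ p.2.+1 = j.
  by case: i j => [|i] [|j] // ri rj; exists (Ordinal (ri : (i < m)%N), Ordinal (rj : (j < m)%N)).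
have g01 i j : (0 < i <= m)%N -> (0 < j <= m)%N -> 0 <= fill u i j <= 1.
  by move=> ri rj; have [p [<- <-]] := cell_of _ _ ri rj.
split=> [s|].
  by rewrite -(fill_free u s); have [] := free_range (npair_free s) => ? ?; exact: g01.
exists (fill u); split; first exact: completes_fill.
  move=> l lr; have l1 : (0 < l < k)%N by lia.
  have l2 : (0 < k - l < k)%N by lia.
  split.
    have [] := excluded_range b_gt0 l1; rewrite /excluded; case/andP: (lr) => _ -> /= *.
    exact: g01.
  by have [] := excluded_range b_gt0 l2; rewrite excluded_compl //= => *; exact: g01.
split=> [j i1 i2 le|i j1 j2 le]; rewrite !mxE.
  exact: (mono (i1, j) (i2, j)).
exact: (mono (i, j2) (i, j1)).
Qed.

Local Notation constraint := (cell + cell + cell * cell)%type.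

(** The inequalities of [V_region] in the free coordinates: each entry is
    nonnegative, each is at most one, and entries increase with the column and
    decrease with the row. Pairs of cells that are not comparable give the trivial
    inequality. *)
Definition region_lhs (c : constraint) (s : pos) : R :=
  match c with
  | inl (inl p) => - fill_coef p.1.+1 p.2.+1 s
  | inl (inr p) => fill_coef p.1.+1 p.2.+1 s
  | inr (p, q) => if ((p.1 <= q.1) && (q.2 <= p.2))%N
      then fill_coef p.1.+1 p.2.+1 s - fill_coef q.1.+1 q.2.+1 s else 0
  end.

Definition region_rhs (c : constraint) : R :=
  match c with
  | inl (inl p) => fill_const p.1.+1 p.2.+1
  | inl (inr p) => 1 - fill_const p.1.+1 p.2.+1
  | inr (p, q) => if ((p.1 <= q.1) && (q.2 <= p.2))%N
      then fill_const q.1.+1 q.2.+1 - fill_const p.1.+1 p.2.+1 else 0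
  end.

Lemma V_region_polytope : V_region R k b = polytope region_lhs region_rhs.
Proof.
apply/seteqP; split=> u.
  move=> /V_regionP[f01 mono] [[p|p]|[p q]] /=.
  - under eq_bigr => s _ do rewrite mulNr.
    by rewrite sumrN; have /andP[] := f01 p; rewrite /fill => *; lra.
  - by have /andP[] := f01 p; rewrite /fill => *; lra.
  - case: ifP => [/andP[le1 le2]|_]; last by rewrite big1 // => s _; rewrite mul0r.
    under eq_bigr => s _ do rewrite mulrBl.
    by rewrite sumrB; have := mono p q le1 le2; rewrite /fill => *; lra.
move=> H; apply/V_regionP; split=> [p|p q le1 le2]; rewrite /fill.
  have := H (inl (inr p)); have := H (inl (inl p)) => /=.
  under eq_bigr => s _ do rewrite mulNr.
  by rewrite sumrN => *; lra.
have := H (inr (p, q)); rewrite /= le1 le2 /=.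
under eq_bigr => s _ do rewrite mulrBl.
by rewrite sumrB => *; lra.
Qed.

Lemma V_region_unit u : V_region R k b u -> forall s, 0 <= u s <= 1.
Proof. by case. Qed.
End Region.

Lemma convex_polytope (R : realType) (I J : finType) (A : J -> I -> R) (B : J -> R) :
  convex_set (polytope A B).
Proof.
move=> x y l; rewrite !inE => Kx Ky j; rewrite /conv /=.
rewrite (eq_bigr (fun i => l%:num * (A j i * x i) + (1 - l%:num) * (A j i * y i))).
  rewrite big_split /= -!mulr_sumr.
  have l0 : 0 <= l%:num by [].
  have l1 : 0 <= 1 - l%:num by rewrite subr_ge0.
  have := ler_wpM2l l0 (Kx j); have := ler_wpM2l l1 (Ky j).
  move=> le1 le2; apply: le_trans (lerD le2 le1) _.
  by rewrite -mulrDl addrC subrK mul1r.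
move=> i _; transitivity (A j i * (l%:num * x i + (1 - l%:num) * y i)) => //.
by rewrite mulrDr !(mulrCA (A j i)).
Qed.

Section LatticePoints.
Variables (R : realType) (N k' b : nat).
Local Notation k := k'.+1.
Local Notation m := (k'.+1 * b)%N.
Hypothesis b_gt0 : (0 < b)%N.
Hypothesis N_gt0 : (0 < N)%N.
Local Notation pos := (free_pos k b).
Local Notation cell := ('I_m * 'I_m)%type.
Implicit Types (y : {ffun cell -> 'I_N.+1}) (z : {ffun pos -> 'I_N.+1}) (g : nat * nat -> nat).

Let N0 : 0 < N%:R :> R. Proof. by rewrite ltr0n. Qed.
Let Nneq0 : N%:R != 0 :> R. Proof. by rewrite gt_eqF. Qed.
Let Ninv_neq0 : N%:R^-1 != 0 :> R. Proof. by rewrite invr_eq0. Qed.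

(** An integer matrix [g] that extends [z] and has the prescribed antidiagonal
    sums is, after scaling, the completion of [z]. *)
Lemma fill_scaled z g i j : (forall s, z s = g (npair s) :> nat) ->
  (forall l, (0 < l < k)%N ->
     (g (excluded k' b l) + \sum_(s : pos | on_level b l (npair s)) g (npair s) = level_mass k' b l * N)%N) ->
  (0 < i <= m)%N -> (0 < j <= m)%N ->
  fill (scaled R z) i j = (g (i, j))%:R / N%:R.
Proof.
move=> zg mass ri rj.
have [/free_npair[s [<- <-]]|/free_indexP[] // l lr e] := boolP (free_index k b i j).
  by rewrite (fill_free _ s) /scaled zg.
have := fill_excluded b_gt0 (scaled R z) lr; rewrite -e /= => ->.
apply: (mulIf Nneq0); rewrite divfK // mulrBl -natrM -mass // natrD e natr_sum mulr_suml.
rewrite [X in _ - X](eq_bigr (fun s => (g (npair s))%:R)) ?addrK // => s _.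
by rewrite /scaled divfK // zg.
Qed.

Lemma square_mass g l : (0 < l < k)%N ->
  (\sum_(p : cell | (p.1 + p.2).+1 == l * (2 * b)) g (p.1.+1, p.2.+1) =
   g (excluded k' b l) + \sum_(s : pos | on_level b l (npair s)) g (npair s))%N.
Proof.
move=> lr; rewrite (@sum_free k' b _ (on_level b l) g).
rewrite (eq_bigl (fun p : cell => on_level b l (p.1.+1, p.2.+1))); last first.
  by move=> p; rewrite /on_level /=; apply/eqP/eqP; lia.
rewrite (@sum_square k' b _ (on_level b l) g).
have := @perm_big nat addn 0%N _ _ _ xpredT g (perm_square_free b_gt0 lr).
by rewrite big_cons.
Qed.

Definition matrix_value y (q : nat * nat) : nat := ext y q.1.-1 q.2.-1.

Lemma matrix_mass y l : y \in constrained_matrices N k' b -> (0 < l < k)%N ->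
  (matrix_value y (excluded k' b l) + \sum_(s : pos | on_level b l (npair s)) matrix_value y (npair s)
   = level_mass k' b l * N)%N.
Proof.
rewrite finset.in_set => /and3P[_ _ /forallP H] lr; case/andP: (lr) => l0 lk.
have /implyP/(_ l0)/eqP := H (Ordinal lk); rewrite /antidiag_sum /= => <-.
rewrite -square_mass //; apply: eq_bigr => -[c r] _.
by rewrite /matrix_value /= ext_in.
Qed.

Definition restrict y : {ffun pos -> 'I_N.+1} := [ffun s => inord (matrix_value y (npair s))].

Lemma restrictE y s : restrict y s = matrix_value y (npair s) :> nat.
Proof. by rewrite ffunE inordK // ltnS ext_le. Qed.

Lemma fill_restrict y i j : y \in constrained_matrices N k' b ->
  (0 < i <= m)%N -> (0 < j <= m)%N ->
  fill (scaled R (restrict y)) i j = (matrix_value y (i, j))%:R / N%:R.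
Proof.
move=> yC; apply: (@fill_scaled _ (matrix_value y)); first exact: restrictE.
by move=> l; exact: matrix_mass.
Qed.

Lemma restrict_region y : y \in constrained_matrices N k' b ->
  V_region R k b (scaled R (restrict y)).
Proof.
move=> yC; apply/(V_regionP b_gt0); split=> [p|p q le1 le2].
  rewrite fill_restrict ?ltn_ord // divr_ge0 ?ler0n // ler_pdivrMr // mul1r ler_nat.
  exact: ext_le.
rewrite !fill_restrict ?ltn_ord // ler_pM2r ?invr_gt0 // ler_nat /matrix_value /=.
exact: leq_trans (ext_mono_col _ yC le1) (ext_mono_row _ yC le2).
Qed.

(** The completion recovers a matrix from its free entries. *)
Lemma restrict_inj : {in constrained_matrices N k' b &, injective restrict}.
Proof.
move=> y w yC wC e; apply/ffunP => -[c r]; apply/val_inj => /=.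
have rc : (0 < c.+1 <= m)%N by exact: ltn_ord.
have rr : (0 < r.+1 <= m)%N by exact: ltn_ord.
have := fill_restrict yC rc rr; rewrite e fill_restrict //.
move=> /(mulIf Ninv_neq0)/eqP.
by rewrite eqr_nat /matrix_value /= !ext_in => /eqP.
Qed.

(** The completion of an integer point has integer entries, since the
    prescribed sums are integers after dilation. *)
Lemma region_restrict z : V_region R k b (scaled R z) ->
  exists2 y, y \in constrained_matrices N k' b & z = restrict y.
Proof.
move=> /(V_regionP b_gt0)[f01 mono].
pose lv l := (\sum_(s : pos | on_level b l (npair s)) z s)%N.
(* the subtraction at excluded positions is exact by [lv_le], which is the
   nonnegativity of the completed entries *)
pose g (q : nat * nat) : nat := if free_index k b q.1 q.2
  then (\sum_(s : pos | npair s == q) z s)%N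
  else let l := ((q.1 + q.2).-1 %/ (2 * b))%N in (level_mass k' b l * N - lv l)%N.
have gz s : z s = g (npair s) :> nat.
  rewrite /g npair_free (bigD1 s) //= [X in (_ + X)%N]big1 ?addn0 //.
  by move=> t /andP[/eqP/npair_inj -> /eqP].
have lv_le l : (0 < l < k)%N -> (lv l <= level_mass k' b l * N)%N.
  move=> lr; have [r1 r2] := excluded_range b_gt0 lr.
  have := fill_excluded b_gt0 (scaled R z) lr.
  case: (excluded k' b l) r1 r2 => -[|i] [|j] // r1 r2 /= E.
  have := f01 (Ordinal (r1 : (i < m)%N), Ordinal (r2 : (j < m)%N)).
  rewrite /= E subr_ge0 => /andP[le _]; rewrite -(ler_nat R) natrM -ler_pdivrMr //.
  by rewrite natr_sum mulr_suml.
have mass l : (0 < l < k)%N ->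
     (g (excluded k' b l) + \sum_(s : pos | on_level b l (npair s)) g (npair s) = level_mass k' b l * N)%N.
  move=> lr; rewrite {1}/g (negPf (excluded_not_free _ lr)) // excluded_level //=.
  rewrite mulKn ?muln_gt0 // (eq_bigr (fun s => z s : nat)); last by move=> s _; rewrite gz.
  by rewrite subnK ?lv_le.
have fg (p : cell) : fill (scaled R z) p.1.+1 p.2.+1 = (g (p.1.+1, p.2.+1))%:R / N%:R.
  by apply: fill_scaled => //; exact: ltn_ord.
have gN (p : cell) : (g (p.1.+1, p.2.+1) < N.+1)%N.
  by have := f01 p; rewrite fg ler_pdivrMr // mul1r ler_nat ltnS => /andP[].
pose y : {ffun cell -> 'I_N.+1} := [ffun p : cell => inord (g (p.1.+1, p.2.+1))].
have yE (p : cell) : y p = g (p.1.+1, p.2.+1) :> nat by rewrite ffunE inordK.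
have g_mono (p q : cell) : (p.1 <= q.1)%N -> (q.2 <= p.2)%N -> (y p <= y q)%N.
  by move=> /(mono p q) le /le; rewrite !fg ler_pM2r ?invr_gt0 // ler_nat !yE.
exists y; last first.
  apply/ffunP => s; apply/val_inj; rewrite /= restrictE gz.
  have [/andP[s1 r1] /andP[s2 r2]] := free_range (npair_free s).
  rewrite /matrix_value; case: (npair s) s1 s2 r1 r2 => -[|i] [|j] // _ _ r1 r2 /=.
  by rewrite (ext_in y (Ordinal (r1 : (i < m)%N)) (Ordinal (r2 : (j < m)%N))) yE.
rewrite finset.in_set; apply/and3P; split.
- by do 3!(apply/forallP => ?); apply/implyP => le; exact: g_mono.
- by do 3!(apply/forallP => ?); apply/implyP => le; exact: g_mono.
apply/forallP => l; apply/implyP => l0; have lr : (0 < l < k)%N by rewrite l0 /=.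
apply/eqP; rewrite -/(level_mass k' b l) -mass // -square_mass //.
by apply: eq_bigr => p _; exact: yE.
Qed.

(** Free entries determine the matrix, and every lattice point of the region
    is the restriction of a matrix. *)
Lemma card_lattice_points :
  #|lattice_points (@region_lhs R k' b) (@region_rhs R k' b) N| = #|constrained_matrices N k' b|.
Proof.
rewrite -(card_in_imset restrict_inj); apply: eq_card => z.
rewrite finset.in_set -V_region_polytope //; apply/asboolP/imsetP.
  by move=> /region_restrict[y yC ->]; exists y.
by move=> [y yC ->]; exact: restrict_region.
Qed.
End LatticePoints.

(** * The asymptotics *)

Local Open Scope classical_set_scope.
Local Open Scope ring_scope.

Theorem theorem1p1 (R : realType) (k b : nat) :
  (1 <= k)%N -> (1 <= b)%N ->
  [/\ #|{: free_pos k b}| = ((k * b) ^ 2 - (k - 1))%N,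
      convex_set (V_region R k b)
    & exists C : R, \forall N \near \oo,
        forall mu : probability (borel_unitary R N) R, is_haar mu ->
          `| MoM mu k b
             - fine (lebesgue_vol (V_region R k b))
               * N%:R ^+ (k ^ 2 * b ^ 2 - k + 1) |
          <= C * N%:R ^+ (k ^ 2 * b ^ 2 - k)].
Proof.
case: k => // k' _ b1; have card_pos := card_free_pos k' b1.
have n_eq : ((k'.+1 * (2 * b)).-1.+1 = k'.+1 * (2 * b))%N by rewrite prednK ?muln_gt0 ?b1.
have dim : (k'.+1 <= k'.+1 ^ 2 * b ^ 2)%N.
  by rewrite -expnMn (leq_trans (leq_pmulr _ b1)) // -mulnn leq_pmulr // muln_gt0.
have dimS : #|{: free_pos k'.+1 b}| = (k'.+1 ^ 2 * b ^ 2 - k'.+1).+1.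
  by rewrite card_pos expnMn; lia.
split; first by rewrite card_pos subn1.
  by rewrite V_region_polytope //; exact: convex_polytope.
have pos_gt0 : (0 < #|{: free_pos k'.+1 b}|)%N by rewrite dimS.
have [|C HC] := @polytope_count R _ _ (@region_lhs R k' b) (@region_rhs R k' b) pos_gt0.
  by move=> u; rewrite -V_region_polytope //; exact: V_region_unit.
exists C; exists 1%N => // N /= N1 mu haar.
have := HC N N1; rewrite -V_region_polytope // card_lattice_points //.
by rewrite dimS addn1 (MoM_patterns haar n_eq) (card_block_patterns N n_eq b1).
Qed.
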